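(* Let $(\Omega,\mathcal F,\mathbb P)$ be a complete probability space, $d\ge 1$, $\beta\in(0,1)$, and let $\{\mathcal F(\tilde s)\}_{\tilde s\in\mathbb N_0^d}$ be a multi-parameter filtration satisfying (F1), (F2) and (F4) (see context). For $i=1,\dots,d$ let $\{h_i(t)\}_{t\in\mathbb N}$ be positive, bounded and $\mathbf F_i$-predictable. Fix $\tilde s\in\mathbb N_0^d$ and define the decreasing rewards $h_i'(t+1):=(1-\beta)\underline M_i(s_i,t)$, $t\ge s_i$. Then, almost surely, $$\Phi(\tilde s)=\Phi'(\tilde s)=\mathbb E\Big[\int_0^\infty\big(1-\beta^{\tau(m;\tilde s)}\big)\,\mathrm dm\,\Big|\,\mathcal F(\tilde s)\Big]=(1-\beta)\,\mathbb E\Big[\sum_{t=0}^\infty\beta^t N(t;\tilde s)\,\Big|\,\mathcal F(\tilde s)\Big].$$ Moreover the allocation strategy $\tilde T^*\in\mathcal A(\tilde s)$ defined in the context is optimal: $\Phi(\tilde s)=\mathbb E[\mathcal R(\tilde T^* )\mid\mathcal F(\tilde s)]\ge\mathbb E[\mathcal R(\tilde T)\mid\mathcal F(\tilde s)]$ a.s. for every $\tilde T\in\mathcal A(\tilde s)$.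
   Context: Conditions on the filtration: (F1) $\mathcal F(\tilde s)\subseteq\mathcal F(\tilde r)$ whenever $\tilde s\le\tilde r$ (componentwise order); (F2) $\mathcal F(\tilde 0)$ contains all $\mathbb P$-null sets; (F4) for all $\tilde s,\tilde r$, the $\sigma$-algebras $\mathcal F(\tilde s)$ and $\mathcal F(\tilde r)$ are conditionally independent given $\mathcal F(\tilde s\wedge\tilde r)$ (componentwise minimum). Let $\tilde e_i$ be the $i$th unit vector and $\mathbf F_i=\{\mathcal F_i(t)\}_{t\in\mathbb N_0}$ with $\mathcal F_i(t):=\mathcal F(t\tilde e_i)$; $\mathbf F_i$-predictable means $h_i(t)$ is $\mathcal F_i(t-1)$-measurable. Single-project objects (for each $i$, w.r.t. $\mathbf F_i$ and $h_i$; $\beta^{\infty}:=0$; $\mathcal S_i(t)$ = $\mathbf F_i$-stopping times with values in $\{t,t+1,\dots\}\cup\{\infty\}$): $V_i(t;m):=\operatorname{ess\,sup}_{\tau\in\mathcal S_i(t)}\mathbb E[\sum_{u=t}^{\tau-1}\beta^{u-t}h_i(u+1)+m\beta^{\tau-t}\mid\mathcal F_i(t)]$ for $m\ge0$ (a.s. continuous in $m$, so it may be evaluated at random $m$); $\sigma_i(t;m):=\inf\{\theta\ge t:V_i(\theta;m)=m\}$ ($\inf\emptyset=\infty$); Gittins index $M_i(t):=\operatorname{ess\,sup}\{X: X>0,\ X\ \mathcal F_i(t)\text{-measurable},\ V_i(t;X)\ge X\}$; lower envelope $\underline M_i(t,\theta):=\min_{t\le u\le\theta}M_i(u)$ for $t\le\theta$.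 Left limits: $\sigma_i(t;m-):=\lim_{\delta\downarrow0}\sigma_i(t;m-\delta)$. Total operational time $\tau(m;\tilde s):=\sum_{i=1}^d(\sigma_i(s_i;m)-s_i)$ and $N(t;\tilde s):=\inf\{m\ge0:\tau(m;\tilde s)\le t\}$, $t\in\mathbb N_0$ (these are built from the original rewards $h_i$). An allocation strategy for $\tilde s$ is an $\mathbb N_0^d$-valued sequence $\tilde T=\{\tilde T(t)\}_{t\in\mathbb N_0}$ with $\tilde T(0)=\tilde s$, $\tilde T(t+1)=\tilde T(t)+\tilde e_j$ for some (random) $j$, and $\{\tilde T(t+1)=\tilde T(t)+\tilde e_j,\ \tilde T(t)=\tilde r\}\in\mathcal F(\tilde r)$ for all $j,\tilde r$; $\mathcal A(\tilde s)$ is the set of these. Rewards: $\mathcal R(\tilde T):=\sum_{i=1}^d\sum_{t=0}^\infty\beta^t h_i(T_i(t+1))(T_i(t+1)-T_i(t))$, and $\mathcal R'(\tilde T)$ the same with $h_i'$ in place of $h_i$. Values: $\Phi(\tilde s):=\operatorname{ess\,sup}_{\tilde T\in\mathcal A(\tilde s)}\mathbb E[\mathcal R(\tilde T)\mid\mathcal F(\tilde s)]$ and $\Phi'(\tilde s):=\operatorname{ess\,sup}_{\tilde T\in\mathcal A(\tilde s)}\mathbb E[\mathcal R'(\tilde T)\mid\mathcal F(\tilde s)]$. Strategy $\tilde T^*$: for $t\in\mathbb N$ write $N=N(t;\tilde s)$ and set $y_i(t):=\sum_{j\le i}(\sigma_j(s_j;N-)-s_j)+\sum_{j>i}(\sigma_j(s_j;N)-s_j)$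 for $i=0,\dots,d$, so $y_0(t)=\tau(N;\tilde s)\le\dots\le y_d(t)=\tau(N-;\tilde s)$ and $\tau(N;\tilde s)\le t<\tau(N-;\tilde s)$; let $k=k(t)$ be the unique index with $y_{k-1}(t)\le t<y_k(t)$. Then $\tilde T^*(0)=\tilde s$ and for $t\in\mathbb N$: $T_i^*(t)=\sigma_i(s_i;N-)$ if $i<k$, $T_k^*(t)=\sigma_k(s_k;N)+t-y_{k-1}(t)$, and $T_i^*(t)=\sigma_i(s_i;N)$ if $i>k$.
   Formalization: The Gittins index is taken as the ess sup of positive X with V_i(t;X) > X, since V_i(t;X) ≥ X holds for every X (stop at τ = t), so the index as written would be infinite and Φ' would be infinite while Φ is finite. *)

(* Defs.v *)
From HB Require Import structures.
From mathcomp Require Import all_boot all_order all_algebra.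
From mathcomp Require Import all_classical all_reals all_analysis measurable_realfun.
Set Implicit Arguments. Unset Strict Implicit. Unset Printing Implicit Defensive.
Import Order.TTheory GRing.Theory Num.Theory.
Import numFieldNormedType.Exports.
Local Open Scope classical_set_scope.
Local Open Scope ring_scope.

Section Defs.
Context {R : realType} {d0 : measure_display} {Omega : measurableType d0}.
Variable P : probability Omega R.

Definition meas_wrt {d1} {T : measurableType d1} (G : set (set Omega))
    (f : Omega -> T) := forall B : set T, measurable B -> G (f @^-1` B).

Definition sub_sigma (G : set (set Omega)) :=
  sigma_algebra setT G /\ G `<=` measurable.

(** Y is a version of E[X | G] (extended-real valued, X >= 0 in all uses) *)
Definition cond_exp (G : set (set Omega)) (X Y : Omega -> \bar R) :=
  meas_wrt G Y /\
  forall A, G A -> (\int[P]_(x in A) Y x = \int[P]_(x in A) X x)%E.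

Definition ess_sup_of (G : set (set Omega)) (fam : set (Omega -> \bar R))
    (Z : Omega -> \bar R) :=
  [/\ meas_wrt G Z,
      (forall X, fam X -> {ae P, forall x, (X x <= Z x)%E}) &
      (forall Z', measurable_fun setT Z' ->
         (forall X, fam X -> {ae P, forall x, (X x <= Z' x)%E}) ->
         {ae P, forall x, (Z x <= Z' x)%E})].

Definition cond_indep (G1 G2 H : set (set Omega)) :=
  forall A B, G1 A -> G2 B ->
  forall YA YB YAB,
    cond_exp H (fun x => (\1_A x)%:E) YA ->
    cond_exp H (fun x => (\1_B x)%:E) YB ->
    cond_exp H (fun x => (\1_(A `&` B) x)%:E) YAB ->
    {ae P, forall x, YAB x = (YA x * YB x)%E}.
End Defs.

Definition mindex (d : nat) := 'I_d -> nat.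
Definition mle d (s r : mindex d) := forall i, (s i <= r i)%N.
Definition mmin d (s r : mindex d) : mindex d := fun i => minn (s i) (r i).
Definition mzero_idx d : mindex d := fun _ => 0%N.
Definition munit d (i : 'I_d) (t : nat) : mindex d :=
  fun j => if j == i then t else 0%N.
Definition madd d (s r : mindex d) : mindex d := fun i => (s i + r i)%N.

Section Bandit.
Context {R : realType} {d0 : measure_display} {Omega : measurableType d0}.
Variable d : nat.
Variable F : mindex d -> set (set Omega).
Variable beta : R.
Local Open Scope ereal_scope.

Definition Fi (i : 'I_d) (t : nat) := F (munit i t).

(** F_i-stopping times with values in {t, t+1, ...} \cup {oo} (None = oo) *)
Definition stopping_from (i : 'I_d) (t : nat) (tau : Omega -> option nat) :=
  (forall n, Fi i n [set x | tau x = Some n]) /\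
  (forall x n, tau x = Some n -> (t <= n)%N).

(** sum_{u=t}^{tau-1} beta^(u-t) h(u+1) + m beta^(tau-t)   (beta^oo = 0) *)
Definition gain (h : nat -> Omega -> R) (t : nat) (m : R)
    (tau : Omega -> option nat) (x : Omega) : \bar R :=
  match tau x with
  | Some n => (\sum_(t <= u < n) (beta ^+ (u - t) * h u.+1 x)%R)%:E
              + (m * beta ^+ (n - t))%:E
  | None => \sum_(t <= u <oo) ((beta ^+ (u - t) * h u.+1 x)%R)%:E
  end.

Definition allocation (s : mindex d) (T : nat -> Omega -> mindex d) :=
  [/\ forall x, T 0%N x = s,
      (forall t x, exists j, T t.+1 x = madd (T t x) (munit j 1)) &
      (forall j r t, F r [set x | T t.+1 x = madd (T t x) (munit j 1)
                                  /\ T t x = r])].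

Definition reward (h : 'I_d -> nat -> Omega -> \bar R)
    (T : nat -> Omega -> mindex d) (x : Omega) : \bar R :=
  \sum_(t <oo) \sum_(i < d)
     ((beta ^+ t)%:E * h i (T t.+1 x i) x
        * ((T t.+1 x i - T t x i)%N%:R)%:E).

Variable V : 'I_d -> nat -> R -> Omega -> R.

Definition sigma_ (i : 'I_d) (t : nat) (m : R) (x : Omega) : \bar R :=
  ereal_inf [set (th%:R)%:E | th in [set th : nat | (t <= th)%N /\ V i th m x = m]].

Definition sigma_minus (i : 'I_d) (t : nat) (m : R) (x : Omega) : \bar R :=
  lim ((fun m' => sigma_ i t m' x) @ at_left m).

Definition tau_ (s : mindex d) (m : R) (x : Omega) : \bar R :=
  \sum_(i < d) (sigma_ i (s i) m x - ((s i)%:R)%:E).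

Definition Nt (s : mindex d) (t : nat) (x : Omega) : \bar R :=
  ereal_inf [set m%:E | m in [set m : R | (0 <= m)%R /\ tau_ s m x <= (t%:R)%:E]].

Definition epow (y : \bar R) : \bar R :=
  match y with
  | r%:E => (beta `^ r)%:E
  | +oo => 0
  | -oo => +oo
  end.

(** y_i(t), i = 0..d (0-based project indices j < i use sigma(N-)) *)
Definition ycoord (s : mindex d) (i : nat) (t : nat) (x : Omega) : \bar R :=
  let N := fine (Nt s t x) in
  \sum_(j < d | (j < i)%N) (sigma_minus j (s j) N x - ((s j)%:R)%:E)
  + \sum_(j < d | (i <= j)%N) (sigma_ j (s j) N x - ((s j)%:R)%:E).

(** 0-based index k0 = k - 1 of the paper's unique k with
    y_{k-1}(t) <= t < y_k(t), i.e. the least k0 with t < y_{k0+1}(t) *)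
Definition kidx (s : mindex d) (t : nat) (x : Omega) : nat :=
  \big[minn/d]_(i < d | ((t%:R)%:E < ycoord s i.+1 t x)) (i : nat).

Definition Tstar_val (s : mindex d) (t : nat) (x : Omega) (i : 'I_d) : \bar R :=
  let N := fine (Nt s t x) in
  let k := kidx s t x in
  if (i < k)%N then sigma_minus i (s i) N x
  else if (i == k :> nat) then
    sigma_ i (s i) N x + (t%:R)%:E - ycoord s k t x
  else sigma_ i (s i) N x.

End Bandit.

(* Main.v *)
(**
  For one project, [V(t; m)] and the expectation of
  [sum_k beta^k (1-beta) max(envelope(t, t+k), m)] are convex in [m], agree for
  large [m] and share the subgradient [E beta^(sigma(t; m) - t)]; hence they
  agree at [m = 0]. So, from any time [t], the rewards [h] and the decreasing
  rewards [(1-beta) envelope(t, .)] have the same conditional discounted sum.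
  Replacing the envelope started at [t] by the one started at an earlier time
  [s] leaves an excess of conditional expectation [>= 0], and [= 0] when the
  index is at a new minimum at [t]. By (F4) this stays true given the larger
  [F(r)] with [r_i = t].

  Summing by parts along an allocation, its expected [h]-reward is its expected
  reward for the decreasing rewards minus nonnegative terms, one for every
  project idle at some time. For the greedy allocation an idle project is
  always at a new minimum of its index, so these terms vanish. For decreasing
  rewards the greedy allocation is pathwise optimal; its successive values are
  [N(t; s)], and [tau(m; s)] is the first [t] with [N(t; s) <= m].
*)
Require Import Defs.
From HB Require Import structures.
From mathcomp Require Import all_boot all_order all_algebra.
From mathcomp Require Import all_classical all_reals all_analysis measurable_realfun.
From mathcomp Require Import zify ring lra.
Set Implicit Arguments. Unset Strict Implicit. Unset Printing Implicit Defensive.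
Import Order.TTheory GRing.Theory Num.Theory.
Import numFieldNormedType.Exports.
Local Open Scope classical_set_scope.
Local Open Scope ring_scope.

(** * Discounted sums *)

(** A retirement reward [m] is paid as a perpetual rate [(1 - b) * m], whose discounted sum is [m].
    Every payoff is then a single discounted series, affine in [m] for a fixed stopping rule; this
    is where the subgradients come from, and nothing has to be differentiated in [m]. For each [m]
    separately, [V t m] is determined only up to a null set. Statements about all [m] at once are
    therefore proved on a countable grid and extended by continuity, while [W] and [gittins_index]
    are versions bounded at every point. Conditional statements are phrased as relations between
    [Ex (fun x => \1_A x * f x)] for the events [A] of the conditioning sigma-algebra. (F4) compares
    two sigma-algebras at a time, whereas an excess involves the whole future of its project. The
    excess is truncated after [n] terms, at a cost of order [b ^+ n]; the same geometric bound
    serves as the limit argument almost everywhere else. *)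

Section DiscountedSum.
Context {R : realType} (b : R).
Hypotheses (b0 : 0 < b) (b1 : b < 1).
Implicit Types f g : nat -> R.

Definition bseq f := exists K, forall k, `|f k| <= K.

Definition dsum f : R := limn (series (fun k => b ^+ k * f k)).

Let ob0 : 0 < 1 - b. Proof. by rewrite subr_gt0. Qed.

Lemma bseq_cst c : bseq (fun=> c).
Proof. by exists `|c|. Qed.

Lemma bseqD f g : bseq f -> bseq g -> bseq (fun k => f k + g k).
Proof.
move=> [K fK] [L gL]; exists (K + L) => k.
by rewrite (le_trans (ler_normD _ _)) ?lerD.
Qed.

Lemma bseqZ c f : bseq f -> bseq (fun k => c * f k).
Proof.
move=> [K fK]; exists (`|c| * K) => k.
by rewrite normrM ler_wpM2l.
Qed.

Lemma bseqB f g : bseq f -> bseq g -> bseq (fun k => f k - g k).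
Proof.
move=> [K fK] [L gL]; exists (K + L) => k.
by rewrite (le_trans (ler_normB _ _)) ?lerD.
Qed.

Lemma bseq_shift n f : bseq f -> bseq (fun k => f (n + k)%N).
Proof. by move=> [K fK]; exists K. Qed.

Lemma is_cvg_dsum f : bseq f -> cvgn (series (fun k => b ^+ k * f k)).
Proof.
move=> [K fK]; apply: normed_cvg.
have K0 : 0 <= K by exact: le_trans (normr_ge0 _) (fK 0%N).
apply: (@series_le_cvg _ _ (geometric K b)) => [n|n|n|].
- by rewrite normr_ge0.
- by rewrite /= mulr_ge0 // exprn_ge0 // ltW.
- by rewrite /= normrM ger0_norm ?exprn_ge0 ?(ltW b0) // mulrC ler_wpM2r
     ?exprn_ge0 ?(ltW b0).
- by apply: is_cvg_geometric_series; rewrite ger0_norm // ltW.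
Qed.

Lemma dsumD f g : bseq f -> bseq g ->
  dsum (fun k => f k + g k) = dsum f + dsum g.
Proof.
move=> bf bg; rewrite /dsum -lim_seriesD; [|exact: is_cvg_dsum..].
by congr (limn (series _)); apply/funext => k; rewrite mulrDr.
Qed.

Lemma dsumZ c f : bseq f -> dsum (fun k => c * f k) = c * dsum f.
Proof.
move=> bf; rewrite /dsum -[RHS]lim_seriesZ; last exact: is_cvg_dsum.
by congr (limn (series _)); apply/funext => k /=; rewrite /GRing.scale/= mulrCA.
Qed.

Lemma dsumB f g : bseq f -> bseq g ->
  dsum (fun k => f k - g k) = dsum f - dsum g.
Proof.
move=> bf bg; have -> : (fun k => f k - g k) = (fun k => f k + -1 * g k).
  by apply/funext => k; rewrite mulN1r.
by rewrite dsumD ?dsumZ ?mulN1r //; exact: bseqZ.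
Qed.

Lemma dsum_cst c : dsum (fun=> (1 - b) * c) = c.
Proof.
rewrite /dsum.
have -> : (fun k => b ^+ k * ((1 - b) * c)) = geometric ((1 - b) * c) b.
  by apply/funext => k; rewrite /= mulrC.
have /cvg_lim -> // : series (geometric ((1 - b) * c) b) x @[x --> \oo] -->
   ((1 - b) * c) / (1 - b).
  by apply: cvg_geometric_series; rewrite ger0_norm // ltW.
by rewrite mulrC mulKf// gt_eqF.
Qed.

Lemma ler_dsum f g : bseq f -> bseq g -> (forall k, f k <= g k) ->
  dsum f <= dsum g.
Proof.
move=> bf bg fg; apply: lim_series_le => [||k]; [exact: is_cvg_dsum..|].
by rewrite ler_wpM2l // exprn_ge0 // ltW.
Qed.

Lemma dsum0 : dsum (fun=> 0) = 0.
Proof. by rewrite -[RHS]dsum_cst; congr dsum; apply/funext => k; rewrite mulr0. Qed.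

Lemma dsum_ge0 f : bseq f -> (forall k, 0 <= f k) -> 0 <= dsum f.
Proof. by move=> bf f0; rewrite -dsum0 ler_dsum//; exact: bseq_cst. Qed.

Lemma dsum_bound f K : (forall k, `|f k| <= K) -> `|dsum f| <= K / (1 - b).
Proof.
move=> fK; have bf : bseq f by exists K.
have -> : K / (1 - b) = dsum (fun=> K).
  rewrite -[LHS]dsum_cst; congr dsum; apply/funext => k.
  by rewrite mulrCA mulfV ?mulr1// gt_eqF.
rewrite ler_norml.
have -> : - dsum (fun=> K) = dsum (fun=> - K).
  by rewrite -mulN1r -dsumZ; [congr dsum; apply/funext => k; rewrite mulN1r|exact: bseq_cst].
by apply/andP; split; apply: ler_dsum => //; try (exact: bseq_cst);
  move=> k; move: (fK k); rewrite ler_norml => /andP[].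
Qed.

Lemma dsumS f : bseq f -> dsum f = f 0%N + b * dsum (fun k => f k.+1).
Proof.
move=> bf; have bs : bseq (fun k => f k.+1) by exact: (bseq_shift 1).
rewrite {1}/dsum; apply: cvg_lim => //.
rewrite -(cvg_shiftS (series _)) /=.
have -> : (fun n => series (fun k => b ^+ k * f k) n.+1) =
  (fun n => f 0%N + b * series (fun k => b ^+ k * f k.+1) n).
  apply/funext => n; rewrite /series/= big_nat_recl //= expr0 mul1r; congr (_ + _).
  by rewrite big_distrr/=; apply: eq_bigr => i _; rewrite exprS mulrA.
apply: cvgD; first exact: cvg_cst.
apply: cvgM; first exact: cvg_cst.
exact: is_cvg_dsum.
Qed.

Lemma dsum_split n f : bseq f ->
  dsum f = \sum_(k < n) b ^+ k * f k + b ^+ n * dsum (fun k => f (n + k)%N).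
Proof.
move=> bf; elim: n => [|n IH]; first by rewrite big_ord0 add0r expr0 mul1r.
rewrite IH big_ord_recr/= -addrA; congr (_ + _).
rewrite dsumS; last exact: bseq_shift.
rewrite addn0 mulrDr mulrA -exprSr; congr (_ + _ * dsum _).
by apply/funext => k; rewrite addnS.
Qed.

Lemma dsum_trunc n f K : (forall k, `|f k| <= K) ->
  `|dsum f - \sum_(k < n) b ^+ k * f k| <= b ^+ n * (K / (1 - b)).
Proof.
move=> fK; rewrite (dsum_split n); last by exists K.
rewrite addrC addKr normrM ger0_norm ?exprn_ge0 ?(ltW b0)//.
by rewrite ler_wpM2l ?exprn_ge0 ?(ltW b0)// dsum_bound.
Qed.

Lemma eseries_dsum f : bseq f ->
  (\sum_(k <oo) (b ^+ k * f k)%:E = (dsum f)%:E)%E.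
Proof.
move=> bf; rewrite /dsum -EFin_lim; last exact: is_cvg_dsum.
by congr (limn _); apply/funext => n; rewrite /= sumEFin.
Qed.

(** Stands in for a limit: an estimate whose error decays like [b ^+ n] is exact. Identities between
    infinite sums or their expectations are reduced in this way to finite ones. *)
Lemma eq0_le_geo (x K : R) : (forall n, x <= b ^+ n * K) -> x <= 0.
Proof.
move=> xK; have [K0|K0] := leP K 0.
  by apply: le_trans (xK 0%N) _; rewrite expr0 mul1r.
apply/ler_addgt0Pr => e e0; rewrite add0r.
have : (b ^+ n @[n --> \oo] --> (0 : R)).
  by apply: cvg_expr; rewrite ger0_norm // ltW.
move/cvgrPdist_le => /(_ (e / K)) []; first by rewrite divr_gt0.
move=> N _ /(_ N) /=; rewrite leqnn => /(_ isT).
rewrite sub0r normrN ger0_norm ?exprn_ge0 ?(ltW b0)// => h.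
by apply: le_trans (xK N) _; rewrite -ler_pdivlMr.
Qed.

End DiscountedSum.

(** * Bounded functions measurable for a sub-sigma-algebra *)

Section BoundedMeasurable.
Context {R : realType} {d0 : measure_display} {Omega : measurableType d0}.
Implicit Types (G : set (set Omega)) (A B : set Omega) (f g : Omega -> R).

Lemma sub_sigmaT : sub_sigma (@measurable d0 Omega).
Proof.
split=> //; split; first exact: measurable0.
- by move=> A mA; rewrite setTD; exact: measurableC.
- by move=> A mA; exact: bigcup_measurable.
Qed.

(** [Omega] is equipped anew with [g_sigma_algebraType G], whose measurable sets are those of [G]
    since [G] is already a sigma-algebra. The general facts on measurable functions then apply to
    [meas_wrt G]. *)
Lemma meas_wrtE {d1} {T : measurableType d1} G (f : Omega -> T) :
  sub_sigma G -> meas_wrt G f <->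
  measurable_fun [set: g_sigma_algebraType G] (f : g_sigma_algebraType G -> T).
Proof.
move=> [sG _]; split=> [mf _ B mB|mf B mB].
  by rewrite setTI /measurable/= sigma_algebra_id//; exact: mf.
by have := mf measurableT B mB; rewrite setTI /measurable/= sigma_algebra_id.
Qed.

Lemma meas_wrt_sub {d1} {T : measurableType d1} G H (f : Omega -> T) :
  G `<=` H -> meas_wrt G f -> meas_wrt H f.
Proof. by move=> GH mf B mB; apply: GH; exact: mf. Qed.

Lemma meas_wrt_measurable {d1} {T : measurableType d1} G (f : Omega -> T) :
  sub_sigma G -> meas_wrt G f -> measurable_fun setT f.
Proof. by move=> [_ GH] mf _ B mB; rewrite setTI; apply: GH; exact: mf. Qed.

Section SigmaOps.
Variable G : set (set Omega).
Hypothesis sG : sub_sigma G.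

Lemma subsig_gE A : G A = measurable (A : set (g_sigma_algebraType G)).
Proof. by rewrite /measurable/= sigma_algebra_id //; case: sG. Qed.

Lemma subsigT : G setT.
Proof. by rewrite subsig_gE; exact: measurableT. Qed.
Lemma subsig0 : G set0.
Proof. by rewrite subsig_gE; exact: measurable0. Qed.
Lemma subsigC A : G A -> G (~` A).
Proof. by rewrite !subsig_gE; exact: measurableC. Qed.
Lemma subsigI A B : G A -> G B -> G (A `&` B).
Proof. by rewrite !subsig_gE; exact: measurableI. Qed.
Lemma subsigU A B : G A -> G B -> G (A `|` B).
Proof. by rewrite !subsig_gE; exact: measurableU. Qed.
Lemma subsigD A B : G A -> G B -> G (A `\` B).
Proof. by rewrite !subsig_gE; exact: measurableD. Qed.
Lemma subsig_bigcup (A_ : nat -> set Omega) (Q : set nat) :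
  (forall k, Q k -> G (A_ k)) -> G (\bigcup_(k in Q) A_ k).
Proof.
move=> H; rewrite subsig_gE; apply: bigcup_measurable => k Qk.
by rewrite -subsig_gE; exact: H.
Qed.
Lemma subsig_cstP (Q : Prop) : G [set _ | Q].
Proof.
have [q|q] := pselect Q.
  by rewrite (_ : [set _ | Q] = setT) ?predeqE//; exact: subsigT.
by rewrite (_ : [set _ | Q] = set0) ?predeqE//; exact: subsig0.
Qed.
Lemma subsig_existsT (I : finType) (A_ : I -> set Omega) :
  (forall k, G (A_ k)) -> G [set x | exists k, A_ k x].
Proof.
move=> H; rewrite subsig_gE.
rewrite (_ : [set x | _] = \bigcup_(k in [set: I]) A_ k); last first.
  by apply/seteqP; split => x /=; [move=> [k ?]; exists k|move=> [k _ ?]; exists k].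
by apply: fin_bigcup_measurable => // k _; rewrite -subsig_gE; exact: H.
Qed.
Lemma subsig_forallT (I : finType) (A_ : I -> set Omega) :
  (forall k, G (A_ k)) -> G [set x | forall k, A_ k x].
Proof.
move=> H; rewrite (_ : [set x | _] = ~` [set x | exists k, (~` A_ k) x]).
  by apply: subsigC; apply: subsig_existsT => k; exact: subsigC.
apply/seteqP; split => x /=; first by move=> h [k]; exact.
by move=> h k; apply: contrapT => nA; apply: h; exists k.
Qed.

Lemma meas_le f g : meas_wrt G f -> meas_wrt G g -> G [set x | f x <= g x].
Proof.
rewrite !meas_wrtE// subsig_gE => mf mg.
have := @measurable_fun_le _ (g_sigma_algebraType G) R setT f g measurableT mf mg.
by rewrite setTI.
Qed.
Lemma meas_lt f g : meas_wrt G f -> meas_wrt G g -> G [set x | f x < g x].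
Proof.
move=> mf mg; rewrite (_ : [set x | _] = ~` [set x | g x <= f x]).
  by apply: subsigC; exact: meas_le.
by apply/seteqP; split => x /=; rewrite ltNge => /negP.
Qed.
Lemma meas_cst {d1} {T : measurableType d1} (c : T) : meas_wrt G (fun=> c).
Proof. by rewrite meas_wrtE. Qed.

(** The bound holds at every point, so the class is closed under products and its members are
    integrable. *)
Definition bm f := meas_wrt G f /\ exists K, forall x, `|f x| <= K.

Lemma bm_cst c : bm (fun=> c).
Proof. by split; [exact: meas_cst|exists `|c|]. Qed.

Lemma bmD f g : bm f -> bm g -> bm (fun x => f x + g x).
Proof.
move=> [mf [K fK]] [mg [L gL]]; split.
  by move: mf mg; rewrite !meas_wrtE//; exact: measurable_funD.
by exists (K + L) => x; rewrite (le_trans (ler_normD _ _)) ?lerD.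
Qed.

Lemma bmB f g : bm f -> bm g -> bm (fun x => f x - g x).
Proof.
move=> [mf [K fK]] [mg [L gL]]; split.
  by move: mf mg; rewrite !meas_wrtE//; exact: measurable_funB.
by exists (K + L) => x; rewrite (le_trans (ler_normB _ _)) ?lerD.
Qed.

Lemma bmM f g : bm f -> bm g -> bm (fun x => f x * g x).
Proof.
move=> [mf [K fK]] [mg [L gL]]; split.
  by move: mf mg; rewrite !meas_wrtE//; exact: measurable_funM.
by exists (K * L) => x; rewrite normrM ler_pM.
Qed.

Lemma bm_max f g : bm f -> bm g -> bm (fun x => Num.max (f x) (g x)).
Proof.
move=> [mf [K fK]] [mg [L gL]]; split.
  by move: mf mg; rewrite !meas_wrtE//; exact: measurable_maxr.
exists (Num.max K L) => x; rewrite le_max.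
by case: (leP (f x) (g x)) => _; rewrite ?fK ?gL ?orbT.
Qed.

Lemma bm_min f g : bm f -> bm g -> bm (fun x => Num.min (f x) (g x)).
Proof.
move=> [mf [K fK]] [mg [L gL]]; split.
  by move: mf mg; rewrite !meas_wrtE//; exact: measurable_minr.
exists (Num.max K L) => x; rewrite le_max.
by case: (leP (f x) (g x)) => _; rewrite ?fK ?gL ?orbT.
Qed.

Lemma bm_ind A : G A -> bm \1_A.
Proof.
rewrite subsig_gE => mA; split; last first.
  by exists 1 => x; rewrite indicE; case: (_ \in _); rewrite ?normr1 ?normr0.
by rewrite meas_wrtE //; exact: (@measurable_indic _ (g_sigma_algebraType G)).
Qed.

Lemma bm_sum (I : Type) (r : seq I) (Q : pred I) (f : I -> Omega -> R) :
  (forall i, bm (f i)) -> bm (fun x => \sum_(i <- r | Q i) f i x).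
Proof.
move=> H; elim: r => [|i r IH].
  rewrite (_ : (fun x => _) = (fun=> 0)); first exact: bm_cst.
  by apply/funext => x; rewrite big_nil.
rewrite (_ : (fun x => _) =
    (fun x => if Q i then f i x + \sum_(i <- r | Q i) f i x
              else \sum_(i <- r | Q i) f i x)).
  by case: (Q i) => //; exact: bmD.
by apply/funext => x; rewrite big_cons.
Qed.

Lemma bm_dsum (b : R) (f : nat -> Omega -> R) : 0 < b -> b < 1 ->
  (forall k, meas_wrt G (f k)) -> (exists K, forall k x, `|f k x| <= K) ->
  bm (fun x => dsum b (f^~ x)).
Proof.
move=> b0 b1 mf [K fK]; split; last first.
  by exists (K / (1 - b)) => x; exact: dsum_bound.
apply/meas_wrtE => //.
apply: (@measurable_fun_cvg _ (g_sigma_algebraType G) R setT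
  (fun n x => series (fun k => b ^+ k * f k x) n)).
  move=> n; rewrite /series/=; apply: measurable_sum => k.
  apply: measurable_funM; first exact: measurable_cst.
  exact/meas_wrtE.
move=> x _; apply: is_cvg_dsum => //; by exists K.
Qed.

End SigmaOps.

Lemma bm_sub G H f : G `<=` H -> bm G f -> bm H f.
Proof. by move=> GH [mf bf]; split => //; exact: meas_wrt_sub mf. Qed.

Lemma meas_if {d1} {T : measurableType d1} G A (f g : Omega -> T) :
  sub_sigma G -> G A -> meas_wrt G f -> meas_wrt G g ->
  meas_wrt G (fun x => if x \in A then f x else g x).
Proof.
move=> sG GA mf mg B mB; rewrite (_ : _ @^-1` B = A `&` f @^-1` B `|` ~` A `&` g @^-1` B).
  apply: subsigU => //; apply: subsigI => //; [exact: mf|exact: subsigC|exact: mg].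
apply/seteqP; split => x /=; case: (boolP (x \in A)) => [|/negP] xA.
- by move=> ?; left; split => //; exact: set_mem.
- by move=> ?; right; split => // Ax; apply: xA; exact: mem_set.
- by move=> [[]//|[]]; move: xA => /set_mem.
- by move=> [[Ax _]|[]//]; case: xA; exact: mem_set.
Qed.

Lemma bm_if G A f g : sub_sigma G -> G A -> bm G f -> bm G g ->
  bm G (fun x => if x \in A then f x else g x).
Proof.
move=> sG GA bf bg.
rewrite (_ : (fun x => _) = (fun x => \1_A x * f x + (1 - \1_A x) * g x)).
  by apply: bmD => //; apply: bmM => //; [|apply: bmB => //; first exact: bm_cst];
    exact: bm_ind.
apply/funext => x; rewrite indicE; case: ifP => _.
  by rewrite mul1r subrr mul0r addr0.
by rewrite mul0r add0r subr0 mul1r.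
Qed.

Lemma bm_weak G f : sub_sigma G -> bm G f -> bm measurable f.
Proof. by move=> [_ GT]; exact: bm_sub. Qed.

End BoundedMeasurable.

Ltac bmt := repeat first
  [ solve [trivial] | exact: sub_sigmaT | apply: bm_cst | apply: bmB | apply: bmD
  | apply: bmM | (apply: bm_sum; [|move=> ?]) | apply: bm_max | apply: bm_min | apply: bm_ind ].

(** * Expectations of bounded functions as real numbers *)

Section Expectation.
Context {R : realType} {d0 : measure_display} {Omega : measurableType d0}.
Variable P : probability Omega R.
Implicit Types (A : set Omega) (f g : Omega -> R).
Local Notation bmT := (@bm R d0 Omega (@measurable d0 Omega)).

Definition Ex f : R := fine (\int[P]_x (f x)%:E)%E.

Lemma bm_meas f : bmT f -> measurable_fun setT f.
Proof. by move=> [mf _] _ B mB; rewrite setTI; exact: mf. Qed.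

Lemma bm_integrable f : bmT f -> P.-integrable setT (EFin \o f).
Proof.
move=> bf; have [_ [K fK]] := bf.
apply: measurable_bounded_integrable => //.
- by rewrite ltey_eq fin_num_measure.
- exact: bm_meas.
- exists K; split; first exact: num_real.
  by move=> M KM x _ /=; rewrite (le_trans (fK x))// ltW.
Qed.

Lemma integral_bm f : bmT f -> (\int[P]_x (f x)%:E = (Ex f)%:E)%E.
Proof.
move=> bf; rewrite /Ex fineK//; by apply: integrable_fin_num => //; exact: bm_integrable.
Qed.

Lemma ExD f g : bmT f -> bmT g -> Ex (fun x => f x + g x) = Ex f + Ex g.
Proof.
move=> bf bg; apply: EFin_inj; rewrite -integral_bm; last bmt.
by rewrite EFinD -!integral_bm// -integralD//; exact: bm_integrable.
Qed.

Lemma ExZ c f : bmT f -> Ex (fun x => c * f x) = c * Ex f.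
Proof.
move=> bf; apply: EFin_inj; rewrite -integral_bm; last bmt.
by rewrite (EFinM c) -integral_bm// -integralZl//; exact: bm_integrable.
Qed.

Lemma ExB f g : bmT f -> bmT g -> Ex (fun x => f x - g x) = Ex f - Ex g.
Proof.
move=> bf bg; rewrite (_ : (fun x => f x - g x) = (fun x => f x + -1 * g x)).
  rewrite ExD// ?ExZ ?mulN1r//; bmt.
by apply/funext => x; rewrite mulN1r.
Qed.

Lemma Ex_cst c : Ex (fun=> c) = c.
Proof. by rewrite /Ex integral_cst// [X in (_ * X)%E]probability_setT mule1. Qed.

Lemma Ex_sum (I : Type) (r : seq I) (Q : pred I) (f : I -> Omega -> R) :
  (forall i, bmT (f i)) ->
  Ex (fun x => \sum_(i <- r | Q i) f i x) = \sum_(i <- r | Q i) Ex (f i).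
Proof.
move=> H; elim: r => [|i r IH].
  by rewrite big_nil -[RHS](Ex_cst 0); congr Ex; apply/funext => x; rewrite big_nil.
rewrite big_cons -IH; case: ifPn => Qi.
  rewrite -ExD//; last bmt.
  by congr Ex; apply/funext => x; rewrite big_cons Qi.
by congr Ex; apply/funext => x; rewrite big_cons (negbTE Qi).
Qed.

Lemma ae_eq_Ex f g : bmT f -> bmT g -> {ae P, forall x, f x = g x} ->
  Ex f = Ex g.
Proof.
move=> bf bg fg; congr fine; apply: ae_eq_integral => //.
- by apply/measurable_EFinP; exact: bm_meas.
- by apply/measurable_EFinP; exact: bm_meas.
- by apply: filterS fg => x /= -> _.
Qed.

Lemma Ex_ge0 f : (forall x, 0 <= f x) -> 0 <= Ex f.
Proof. by move=> f0; apply: fine_ge0; apply: integral_ge0 => x _; rewrite lee_fin. Qed.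

Lemma ae_Ex_ge0 f : bmT f -> {ae P, forall x, 0 <= f x} -> 0 <= Ex f.
Proof.
move=> bf f0; rewrite (@ae_eq_Ex f (fun x => Num.max 0 (f x)))//.
- by apply: Ex_ge0 => x; rewrite le_max lexx.
- bmt.
- by apply: filterS f0 => x f0; rewrite max_r.
Qed.

Lemma ae_ler_Ex f g : bmT f -> bmT g -> {ae P, forall x, f x <= g x} ->
  Ex f <= Ex g.
Proof.
move=> bf bg fg; rewrite -subr_ge0 -ExB//; apply: ae_Ex_ge0.
  bmt.
by apply: filterS fg => x; rewrite subr_ge0.
Qed.

Lemma ler_Ex f g : bmT f -> bmT g -> (forall x, f x <= g x) -> Ex f <= Ex g.
Proof. by move=> bf bg fg; apply: ae_ler_Ex => //; exact: aeW. Qed.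

Lemma Ex_bound f K : bmT f -> (forall x, `|f x| <= K) -> `|Ex f| <= K.
Proof.
move=> bf fK; rewrite ler_norml; apply/andP; split.
  rewrite -(Ex_cst (- K)); apply: ler_Ex => [||x]; [bmt|bmt|].
  by have := fK x; rewrite ler_norml => /andP[].
rewrite -[leRHS](Ex_cst K); apply: ler_Ex => [||x]; [bmt|bmt|].
by have := fK x; rewrite ler_norml => /andP[].
Qed.

Lemma integral_bm_in A f : measurable A -> bmT f ->
  (\int[P]_(x in A) (f x)%:E = (Ex (fun x => \1_A x * f x))%:E)%E.
Proof.
move=> mA bf; rewrite -integral_bm; last first.
  by bmt.
rewrite integral_mkcond; apply: eq_integral => x _ /=.
by rewrite /patch indicE; case: ifP; rewrite ?mul1r ?mul0r.
Qed.

End Expectation.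

(** * Conditional expectations *)

Section ConditionalExpectation.
Context {R : realType} {d0 : measure_display} {Omega : measurableType d0}.
Variable P : probability Omega R.
Implicit Types (A B : set Omega).

Lemma ge0_integral_eq0 A (g : Omega -> \bar R) : measurable A ->
  measurable_fun setT g -> (forall x, A x -> 0 <= g x)%E ->
  (\int[P]_(x in A) g x <= 0)%E -> {ae P, forall x, A x -> g x = 0%E}.
Proof.
move=> mA mg g0 gle; apply/(ae_eq_integral_abs P mA); first exact: measurable_funTS.
apply/eqP; rewrite eq_le; apply/andP; split; last exact: integral_ge0.
by under eq_integral => x /set_mem Ax do rewrite gee0_abs ?g0//.
Qed.

Variable G : set (set Omega).
Hypothesis sG : sub_sigma G.

Local Notation OG := (g_sigma_algebraType G).

(** The identity, seen as a map onto [Omega] with the events of [G]. Its law [mu] is the restriction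
    of [P] to [G], to which uniqueness and existence of densities apply. *)
Let idG : Omega -> OG := fun x => x.

Let measurable_idG : measurable_fun setT idG.
Proof.
move=> _ B mB; rewrite setTI; apply: (proj2 sG).
by rewrite (subsig_gE sG).
Qed.

Let Xid : {mfun Omega >-> OG} := mfun_Sub (mem_set measurable_idG).

Let mu := distribution P Xid.

Let integral_mu A (g : Omega -> \bar R) : G A -> meas_wrt G g ->
  (\int[mu]_(x in A) g x = \int[P]_(x in A) g x)%E.
Proof.
move=> GA; rewrite meas_wrtE// => mg.
rewrite integralE [RHS]integralE; congr (_ - _)%E.
  rewrite ge0_integral_pushforward//.
  - by rewrite -(subsig_gE sG).
  - by apply: measurable_funTS; exact: measurable_funepos.
rewrite ge0_integral_pushforward//.
- by rewrite -(subsig_gE sG).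
- by apply: measurable_funTS; exact: measurable_funeneg.
Qed.

Lemma cond_ae_eq (Y1 Y2 : Omega -> \bar R) :
  meas_wrt G Y1 -> meas_wrt G Y2 -> P.-integrable setT Y2 ->
  (forall A, G A -> \int[P]_(x in A) Y1 x = \int[P]_(x in A) Y2 x)%E ->
  {ae P, forall x, Y1 x = Y2 x}.
Proof.
move=> m1 m2 i2 e12.
have : ae_eq mu setT Y2 Y1.
  apply: integral_ae_eq => //.
  - apply: integrable_pushforward => //.
    by apply/meas_wrtE.
  - by apply/meas_wrtE.
  - move=> E _ mE; have GE : G E by rewrite (subsig_gE sG).
    by rewrite !integral_mu// e12.
move=> [N [mN N0 sub]]; exists N; split => //.
  by apply: (proj2 sG); rewrite (subsig_gE sG).
by move=> x /= n12; apply: sub => /= e; apply: n12; rewrite e.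
Qed.

(** The event where [k < g] belongs to [G]; tested on it, the hypothesis gives the nonnegative
    function [g - k] an integral at most 0. *)
Lemma cond_ae_le (g k : Omega -> \bar R) :
  meas_wrt G g -> meas_wrt G k ->
  P.-integrable setT g -> P.-integrable setT k ->
  (forall x, g x \is a fin_num) -> (forall x, k x \is a fin_num) ->
  (forall A, G A -> \int[P]_(x in A) g x <= \int[P]_(x in A) k x)%E ->
  {ae P, forall x, g x <= k x}%E.
Proof.
move=> mg mk ig ik gf kf le_gk.
pose A := [set x | (k x < g x)%E].
have GA : G A.
  rewrite (subsig_gE sG)//.
  have := @measurable_lte _ OG R setT measurableT k g.
  by rewrite setTI; apply; exact/meas_wrtE.
have mA := (proj2 sG) _ GA.
have : {ae P, forall x, A x -> (g x - k x)%E = 0%E}.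
  apply: ge0_integral_eq0 => //.
  - by apply: emeasurable_funB; exact: (meas_wrt_measurable sG).
  - by move=> x /ltW kg; rewrite sube_ge0// kf.
  rewrite integralB//; [|exact: integrableS ig|exact: integrableS ik].
  rewrite leeBlDr ?add0e; first exact: le_gk.
  by apply: integrable_fin_num => //; exact: integrableS ik.
apply: filterS => x h; rewrite leNgt; apply/negP => kg.
have := h kg; rewrite -(fineK (gf x)) -(fineK (kf x)) -EFinB => -[/eqP].
by rewrite subr_eq0 => /eqP gk; rewrite -(fineK (gf x)) -(fineK (kf x)) gk ltxx in kg.
Qed.

Let nu (f : Omega -> R) (A : set OG) : \bar R := (\int[P]_(x in A) (f x)%:E)%E.

(** The Radon-Nikodym derivative of the charge [nu f] with respect to the restriction of [P] to
    [G]. *)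
Lemma cond_exp_exists (f : Omega -> R) K :
  bm measurable f -> (forall x, 0 <= f x <= K) ->
  exists y, [/\ bm G y, forall x, 0 <= y x <= K &
    forall A, G A -> Ex P (fun x => \1_A x * y x) = Ex P (fun x => \1_A x * f x)].
Proof.
move=> bf fK; pose ef := (fun x => (f x)%:E).
have mf : measurable_fun setT ef by apply/measurable_EFinP; exact: bm_meas.
have mG (A : set OG) : measurable A -> G A by rewrite -(subsig_gE sG).
have mP A : G A -> measurable A by exact: (proj2 sG).
have nu0 : nu f set0 = 0%E by rewrite /nu integral_set0.
have nufin : forall A : set OG, measurable A -> nu f A \is a fin_num.
  move=> A /mG /mP mA; apply: integrable_fin_num => //.
  by apply: integrableS (bm_integrable P bf).
have nuadd : semi_sigma_additive (nu f).
  move=> /= F mF tF mUF.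
  apply: (@semi_sigma_additive_nng_induced _ _ _ P ef) => //.
  - by move=> x; rewrite lee_fin; case/andP: (fK x).
  - by move=> i; apply/mP/mG.
  - by apply/mP/mG.
pose nm := isCharge.Build _ _ _ (nu f) nu0 nufin nuadd.
pose nuc : {charge set OG -> \bar R} := HB.pack (nu f) nm.
have dom : nuc `<< mu.
  apply/null_content_dominatesP => A mA muA0.
  rewrite /nuc/= /nu; apply: null_set_integral => //; first exact/mP/mG.
  exact: measurable_funTS.
pose g : Omega -> \bar R := Radon_Nikodym nuc mu.
have gfin x : g x \is a fin_num by exact: Radon_Nikodym_fin_num.
have mg : meas_wrt G g.
  by apply/meas_wrtE => //; exact: measurable_int (Radon_Nikodym_integrable dom).
have mgT : measurable_fun setT g by exact: (meas_wrt_measurable sG mg).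
have gE A : G A -> (\int[P]_(x in A) g x = \int[P]_(x in A) (f x)%:E)%E.
  move=> GA; rewrite -integral_mu// -[RHS]/(nuc A) (Radon_Nikodym_integral dom)//.
  by rewrite -(subsig_gE sG).
have ig : P.-integrable setT g.
  apply/integrableP; split => //.
  have := Radon_Nikodym_integrable dom => /integrableP[_].
  rewrite (integral_mu (subsigT sG))//; apply/meas_wrtE => //.
  by apply: measurableT_comp => //; exact/meas_wrtE.
(* The derivative lies in [[0, K]] only almost everywhere; clamping gives the bounds at every point
   and preserves measurability. *)
pose y x := Num.min K (Num.max 0 (fine (g x))).
have K0 : 0 <= K.
  by case: (fK point) => /andP[]; exact: le_trans.
have y0K x : 0 <= y x <= K.
  by rewrite /y le_min K0 le_max lexx ge_min lexx.
have by_ : bm G y.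
  split; last by exists K => x; rewrite ger0_norm; case/andP: (y0K x).
  apply/meas_wrtE => //; apply: measurable_minr; first exact: measurable_cst.
  apply: measurable_maxr; first exact: measurable_cst.
  apply: measurableT_comp; first exact: fine_measurable.
  exact/meas_wrtE.
exists y; split => // A GA.
have bK (c : R) : bm (@measurable d0 Omega) (fun=> c) by apply: bm_cst; exact: sub_sigmaT.
have fE A' : G A' -> (\int[P]_(x in A') (f x)%:E = (Ex P (fun x => \1_A' x * f x))%:E)%E.
  by move=> GA'; apply: integral_bm_in => //; exact: mP.
have g0 : {ae P, forall x, cst 0 x <= g x}%E.
  apply: cond_ae_le => //; [exact: meas_cst|exact: integrable0|].
  move=> B GB; rewrite gE// integral_cst ?mul0e; last exact: mP.
  by apply: integral_ge0 => x _; rewrite lee_fin; case/andP: (fK x).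
have gK : {ae P, forall x, g x <= cst K%:E x}%E.
  apply: cond_ae_le => //; first exact: meas_cst.
    exact: (bm_integrable P (bK K)).
  move=> B GB; rewrite gE//; apply: ge0_le_integral => //.
  - exact: mP.
  - by move=> x _; rewrite lee_fin; case/andP: (fK x).
  - exact: measurable_funTS.
  - by move=> x _; rewrite lee_fin; case/andP: (fK x).
apply: EFin_inj; rewrite -fE// -gE// -integral_bm_in//; [|exact: mP|exact: (bm_weak sG by_)].
apply: ae_eq_integral => //.
- exact: mP.
- apply: measurable_funTS; apply/measurable_EFinP; apply: bm_meas.
  exact: (bm_weak sG by_).
- exact: measurable_funTS.
- apply: filterS2 g0 gK => x /= g0 gK _.
  rewrite /y -{2}(fineK (gfin x)); congr EFin.
  have -> : Num.max 0 (fine (g x)) = fine (g x).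
    by apply/max_idPr; rewrite -lee_fin fineK.
  by apply/min_idPr; rewrite -lee_fin fineK.
Qed.

End ConditionalExpectation.

(** * Testing bounded functions against the events of a sigma-algebra *)

Section Testing.
Context {R : realType} {d0 : measure_display} {Omega : measurableType d0}.
Variable P : probability Omega R.
Implicit Types (G H : set (set Omega)) (A B : set Omega) (f g : Omega -> R).
Local Notation bmT := (@bm R d0 Omega (@measurable d0 Omega)).
Local Notation Ex := (Ex P).

(** The sum counts the integers in [[1, y]], so it is the integer part of [y], written through
    superlevel conditions. *)
Lemma staircase_near (N : nat) (y : R) : 0 <= y <= N%:R ->
  `|y - \sum_(k < N) ((k.+1%:R <= y)%R)%:R| <= 1.
Proof.
elim: N => [|N IH].
  by move=> /le_anti <-; rewrite big_ord0 subrr normr0.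
move=> /andP[y0 yN]; rewrite big_ord_recr/=.
have [yN'|Ny] := leP y N%:R.
  have -> : (N.+1%:R <= y) = false.
    by apply/negbTE; rewrite -ltNge (le_lt_trans yN')// ltr_nat.
  by rewrite addr0 IH// y0.
rewrite (_ : \sum_(k < N) _ = N%:R); last first.
  rewrite (eq_bigr (fun=> 1)) ?sumr_const ?card_ord// => k _.
  by rewrite (le_trans _ (ltW Ny))// ler_nat.
rewrite -natr1 in yN *.
by case: (leP (N%:R + 1) y) => h; rewrite /= ler_norml; apply/andP; split; lra.
Qed.

Section Fix.
Variable G : set (set Omega).
Hypothesis sG : sub_sigma G.

Lemma Ex_mul_ge0 Y Z : bm G Y -> (forall x, 0 <= Y x) -> bmT Z ->
  (forall A, G A -> 0 <= Ex (fun x => \1_A x * Z x)) ->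
  0 <= Ex (fun x => Y x * Z x).
Proof.
move=> bY Y0 bZ H.
have bYT := bm_weak sG bY.
have [K YK] := proj2 bY; have [L ZL] := proj2 bZ.
have L0 : 0 <= L by exact: le_trans (normr_ge0 _) (ZL point).
apply/ler_addgt0Pr => e e0.
pose n := (Num.trunc (L / e)).+1.
have n0 : (0 : R) < n%:R by rewrite ltr0n.
have Ln : L / n%:R <= e.
  rewrite ler_pdivrMr// mulrC -ler_pdivrMr// ltW// /n.
  by rewrite Num.Theory.truncnS_gt.
pose N := (Num.trunc (n%:R * K)).+1.
have YN x : 0 <= n%:R * Y x <= N%:R.
  rewrite mulr_ge0 ?(ltW n0)//= ltW//; apply: le_lt_trans (_ : n%:R * K < _).
    by rewrite ler_pM2l// (le_trans (ler_norm _)).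
  by rewrite Num.Theory.truncnS_gt.
pose S k := [set x | k.+1%:R <= n%:R * Y x].
have GS k : G (S k).
  apply: meas_le => //; first exact: meas_cst.
  by have [] : bm G (fun x => n%:R * Y x) by bmt.
(* Y is approximated within 1/n by the step function floor(n Y) / n, on which
   the hypothesis applies to each superlevel set. *)
pose Yn x : R := n%:R^-1 * \sum_(k < N) \1_(S k) x.
have bS k : bm G (\1_(S k) : Omega -> R) by apply: bm_ind.
have bYn : bm G Yn by rewrite /Yn; bmt.
have bYnT := bm_weak sG bYn.
have YYn x : `|Y x - Yn x| <= n%:R^-1.
  have := staircase_near (YN x).
  rewrite (eq_bigr (fun k : 'I_N => \1_(S k) x)); last first.
    move=> k _; rewrite indicE; congr (_ %:R : R); congr nat_of_bool.
    by apply/idP/idP => [h|/set_mem //]; apply/mem_set.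
  move=> h; rewrite -(ler_pM2l n0) mulfV ?gt_eqF// -[X in X * _]gtr0_norm//.
  by rewrite -normrM mulrBr /Yn mulrA mulfV ?gt_eqF// mul1r.
have Yn0 : 0 <= Ex (fun x => Yn x * Z x).
  have -> : (fun x => Yn x * Z x) =
      (fun x => n%:R^-1 * \sum_(k < N) \1_(S k) x * Z x).
    by apply/funext => x; rewrite /Yn -mulrA mulr_suml.
  have bSZ (k : 'I_N) : bmT (fun x => \1_(S k) x * Z x).
    by have bSk := bm_weak sG (bS k); bmt.
  rewrite ExZ; last by bmt.
  rewrite mulr_ge0 ?invr_ge0 ?(ltW n0)// Ex_sum//.
  by apply: sumr_ge0 => k _; exact: H.
apply: le_trans Yn0 _; rewrite -lerBlDl -ExB; [|bmt..].
apply: le_trans (ler_norm _) _; apply: Ex_bound => [|x]; first bmt.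
rewrite -mulrBl normrM; apply: le_trans Ln.
by rewrite mulrC ler_pM// distrC.
Qed.

(** Adding a bound [K] makes [Y] nonnegative and changes nothing, because [Z] has mean 0 (test on
    [setT]). Applied to [Z] and to its opposite, this gives both inequalities. *)
Lemma Ex_mul_eq0 Y Z : bm G Y -> bmT Z ->
  (forall A, G A -> Ex (fun x => \1_A x * Z x) = 0) ->
  Ex (fun x => Y x * Z x) = 0.
Proof.
move=> bY bZ H; have bYT := bm_weak sG bY.
have [K YK] := proj2 bY.
have Ypos Z' : bmT Z' -> (forall A, G A -> Ex (fun x => \1_A x * Z' x) = 0) ->
    0 <= Ex (fun x => Y x * Z' x).
  move=> bZ' H'.
  have Z0 : Ex Z' = 0.
    rewrite -(H' setT (subsigT sG)); congr Ex; apply/funext => x.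
    by rewrite indicE in_setT mul1r.
  suff : 0 <= Ex (fun x => (Y x + K) * Z' x).
    have -> : (fun x => (Y x + K) * Z' x) = (fun x => Y x * Z' x + K * Z' x).
      by apply/funext => x; rewrite mulrDl.
    by rewrite ExD ?ExZ ?Z0 ?mulr0 ?addr0//; bmt.
  apply: Ex_mul_ge0 => //; first by bmt.
    by move=> x; have := YK x; rewrite ler_norml => /andP[h _]; rewrite -lerBlDr sub0r.
  by move=> A GA; rewrite H'.
apply/eqP; rewrite eq_le Ypos// andbT.
rewrite -oppr_ge0 -mulN1r -ExZ; last by bmt.
have -> : (fun x => -1 * (Y x * Z x)) = (fun x => Y x * (-1 * Z x)).
  by apply/funext => x; rewrite mulrCA.
apply: Ypos => [|A GA]; first by bmt.
have -> : (fun x => \1_A x * (-1 * Z x)) = (fun x => -1 * (\1_A x * Z x)).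
  by apply/funext => x; rewrite mulrCA.
have bA : bmT \1_A by apply: bm_weak sG _; exact: bm_ind.
by rewrite ExZ ?H ?mulr0//; bmt.
Qed.

Lemma ae_le_of_Ex f g : bm G f -> bm G g ->
  (forall A, G A -> Ex (fun x => \1_A x * f x) <= Ex (fun x => \1_A x * g x)) ->
  {ae P, forall x, f x <= g x}.
Proof.
move=> bf bg H; have bfT := bm_weak sG bf; have bgT := bm_weak sG bg.
have mE k : bm G k -> meas_wrt G (EFin \o k).
  by case=> mk _; apply/meas_wrtE => //; apply/measurable_EFinP; exact/meas_wrtE.
have : {ae P, forall x, (EFin \o f) x <= (EFin \o g) x}%E.
  apply: (cond_ae_le sG) => //; try exact: mE; try exact: bm_integrable.
  move=> A GA; have mA := proj2 sG _ GA.
  by rewrite !integral_bm_in// lee_fin H.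
by apply: filterS => x; rewrite lee_fin.
Qed.

Lemma integral_ae_bm A (X : Omega -> \bar R) f : measurable_fun setT X ->
  bmT f -> {ae P, forall x, X x = (f x)%:E} -> measurable A ->
  (\int[P]_(x in A) X x = (Ex (fun x => \1_A x * f x))%:E)%E.
Proof.
move=> mX bf Xf mA; rewrite -integral_bm_in//; apply: ae_eq_integral => //.
- exact: measurable_funTS.
- by apply: measurable_funTS; apply/measurable_EFinP; exact: bm_meas.
- by apply: filterS Xf => x + _.
Qed.

Lemma cond_exp_real (X : Omega -> \bar R) f K : measurable_fun setT X ->
  bmT f -> (forall x, 0 <= f x <= K) -> {ae P, forall x, X x = (f x)%:E} ->
  exists y, [/\ bm G y, (forall x, 0 <= y x <= K),
    (forall A, G A -> Ex (fun x => \1_A x * y x) = Ex (fun x => \1_A x * f x)),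
    cond_exp P G X (fun x => (y x)%:E) &
    forall Y, cond_exp P G X Y -> {ae P, forall x, Y x = (y x)%:E}].
Proof.
move=> mX bf fK Xf; have [y [by_ yK yE]] := cond_exp_exists P sG bf fK.
have byT := bm_weak sG by_.
have mE : meas_wrt G (fun x => (y x)%:E).
  apply/meas_wrtE => //; apply/measurable_EFinP; apply/meas_wrtE => //.
  by case: by_.
have iE A : G A -> (\int[P]_(x in A) (y x)%:E = \int[P]_(x in A) X x)%E.
  move=> GA; have mA := proj2 sG _ GA.
  by rewrite (integral_ae_bm mX bf)// integral_bm_in// yE.
exists y; split => // Y [mY YE].
apply: (cond_ae_eq sG) => //; first exact: (bm_integrable P byT).
by move=> A GA; rewrite YE// iE.
Qed.

End Fix.

(** Against functions measurable for [G2], an event of [G1] may be replaced by its conditional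
    probability [y] given [H]. For an event [A] of [G2] with conditional probability [u], the
    product formula turns the probability of the intersection into [E[u y]], and this is [E[1_A y]]
    because [y] is [H]-measurable. [Ex_mul_eq0] passes from events to [f]. *)
Lemma cond_indep_Ex G1 G2 H B f y : sub_sigma G1 -> sub_sigma G2 ->
  sub_sigma H -> cond_indep P G1 G2 H -> G1 B ->
  bm H y -> (forall x, 0 <= y x <= 1) ->
  (forall A, H A -> Ex (fun x => \1_A x * y x) = Ex (fun x => \1_A x * \1_B x)) ->
  bm G2 f -> Ex (fun x => \1_B x * f x) = Ex (fun x => y x * f x).
Proof.
move=> s1 s2 sH ci GB by_ y01 yE bf.
have byT := bm_weak sH by_; have bfT := bm_weak s2 bf.
have bI A : measurable A -> bmT \1_A by move=> mA; exact: (bm_ind sub_sigmaT mA).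
have ind01 A x : (0 : R) <= \1_A x <= (1 : R).
  by rewrite indicE; case: (_ \in _); rewrite ?lexx ?ler01.
have mE (k : Omega -> R) : bmT k -> measurable_fun setT (fun x => (k x)%:E).
  by move=> bk; apply/measurable_EFinP; exact: bm_meas.
have mB := proj2 s1 _ GB; have bB := bI _ mB.
have condE (k u : Omega -> R) : bmT k -> bm H u ->
    (forall A, H A -> Ex (fun x => \1_A x * u x) = Ex (fun x => \1_A x * k x)) ->
    cond_exp P H (fun x => (k x)%:E) (fun x => (u x)%:E).
  move=> bk bu uE; have buT := bm_weak sH bu; split.
    apply/meas_wrtE => //; apply/measurable_EFinP; apply/meas_wrtE => //.
    by case: bu.
  by move=> A HA; rewrite !integral_bm_in ?uE//; exact: (proj2 sH).
suff E0 : Ex (fun x => f x * (\1_B x - y x)) = 0.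
  apply/eqP; rewrite -subr_eq0 -ExB; [|bmt..]; apply/eqP; rewrite -[RHS]E0.
  by congr Ex; apply/funext => x; rewrite -mulrBl mulrC.
apply: (Ex_mul_eq0 s2) => //; first by bmt.
move=> A GA; have mA := proj2 s2 _ GA; have bA := bI _ mA.
have [u [bu u01 uE cu _]] := cond_exp_real sH (mE _ bA) bA (ind01 A) (aeW P (fun=> erefl)).
have mBA : measurable (B `&` A) by exact: measurableI.
have bBA := bI _ mBA.
have [v [bv v01 vE cv _]] :=
  cond_exp_real sH (mE _ bBA) bBA (ind01 _) (aeW P (fun=> erefl)).
have buT := bm_weak sH bu; have bvT := bm_weak sH bv.
have vuy : {ae P, forall x, v x = u x * y x}.
  have := ci B A GB GA _ _ _ (condE _ _ bB by_ yE) cu cv.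
  by apply: filterS => x; rewrite -EFinM => -[->]; rewrite mulrC.
have bAy : bmT (fun x => \1_A x * y x) by bmt.
have bAB : bmT (fun x => \1_A x * \1_B x) by bmt.
have -> : (fun x => \1_A x * (\1_B x - y x)) =
    (fun x => \1_A x * \1_B x - \1_A x * y x).
  by apply/funext => x; rewrite mulrBr.
rewrite ExB//; apply/eqP; rewrite subr_eq0; apply/eqP.
transitivity (Ex v).
  transitivity (Ex (fun x => \1_setT x * \1_(B `&` A) x)).
    by congr Ex; apply/funext => x; rewrite indicT mul1r setIC indicI.
  rewrite -vE; last exact: subsigT.
  by congr Ex; apply/funext => x; rewrite indicT mul1r.
transitivity (Ex (fun x => u x * y x)); first by apply: ae_eq_Ex => //; bmt.
apply/eqP; rewrite -subr_eq0 -ExB//; last by bmt.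
rewrite (_ : (fun x => _) = (fun x => y x * (u x - \1_A x))); last first.
  by apply/funext => x; rewrite mulrBr mulrC [_ * y x]mulrC.
apply/eqP; apply: (Ex_mul_eq0 sH) => //; first by bmt.
move=> A' HA'; have bA' := bI _ (proj2 sH _ HA').
rewrite (_ : (fun x => _) = (fun x => \1_A' x * u x - \1_A' x * \1_A x)).
  by rewrite ExB ?uE ?subrr//; bmt.
by apply/funext => x; rewrite mulrBr.
Qed.

End Testing.

(** * A single project *)

Section Envelope.
Context {R : realType}.
Implicit Types (M : nat -> R) (s k j : nat).

(* env M s k is the minimum of M over [s, s + k]. *)
Fixpoint env M s k : R :=
  if k is k'.+1 then Num.min (env M s k') (M (s + k)%N) else M s.

Lemma env_le M s k j : (j <= k)%N -> env M s k <= M (s + j)%N.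
Proof.
elim: k => [|k IH]; first by rewrite leqn0 => /eqP ->; rewrite addn0.
rewrite leq_eqVlt => /predU1P[->|/IH h]; first by rewrite /= ge_min lexx orbT.
by rewrite /= ge_min h.
Qed.

Lemma env_noninc M s j k : (j <= k)%N -> env M s k <= env M s j.
Proof.
move=> /subnK <-; elim: (k - j)%N => [|n IH]; first by rewrite add0n.
by rewrite addSn /= ge_min IH.
Qed.

Lemma envS M s k : env M s k.+1 = Num.min (M s) (env M s.+1 k).
Proof.
elim: k => [|k IH]; first by rewrite /= addn1.
by rewrite [LHS]/= -/(env M s k.+1) IH /= minA addSnnS.
Qed.

Lemma env_bound M s k D : (forall u, 0 < M u <= D) -> 0 < env M s k <= D.
Proof.
move=> MD; elim: k => [|k /andP[IH1 IH2]] //=.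
by have /andP[h1 h2] := MD (s + k.+1)%N; rewrite lt_min IH1 h1 ge_min IH2.
Qed.

Lemma env_add_le M s j k : env M s (j + k)%N <= env M (s + j) k.
Proof.
elim: k => [|k IH]; first by rewrite addn0; exact: env_le.
rewrite addnS /= le_min ge_min IH/= addnS addnA -addnS.
by rewrite ge_min addnS lexx orbT.
Qed.

(** At a minimum over the past, ties included, the past ceases to influence the envelope. *)
Lemma env_add_eq M s j k : M (s + j)%N <= env M s j ->
  env M s (j + k)%N = env M (s + j) k.
Proof.
move=> Mj; elim: k => [|k IH].
  by rewrite addn0 /=; apply/eqP; rewrite eq_le Mj env_le.
by rewrite addnS /= IH -!addnS addnA.
Qed.

Definition subgradient (f q : R -> R) D := forall m m',
  0 <= m -> m <= D -> 0 <= m' -> m' <= D -> f m + (m' - m) * q m <= f m'.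

(** On a grid of mesh [D / n], an increment of [f] is at most the mesh times [q] at the right end,
    and one of [g] at least the mesh times [q] at the left end. The discrepancy telescopes to
    [D / n * (q D - q 0)], which is at most [D / n]. *)
Lemma subgradient_le (f g q : R -> R) D : 0 < D ->
  (forall m, 0 <= m -> m <= D -> 0 <= q m <= 1) ->
  subgradient f q D -> subgradient g q D -> f D - f 0 <= g D - g 0.
Proof.
move=> D0 q01 hf hg; apply/ler_addgt0Pr => e e0.
pose n := (Num.trunc (D / e)).+1.
have n0 : (0 : R) < n%:R by rewrite ltr0n.
have Dn : D / n%:R <= e.
  by rewrite ler_pdivrMr// mulrC -ler_pdivrMr// ltW// truncnS_gt.
pose p k : R := D * (k%:R / n%:R).
have p0 k : 0 <= p k by rewrite /p mulr_ge0 ?divr_ge0 ?(ltW D0).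
have pD k : (k <= n)%N -> p k <= D.
  by move=> kn; rewrite /p ler_piMr ?(ltW D0)// ler_pdivrMr// mul1r ler_nat.
have pS k : p k.+1 - p k = D / n%:R.
  by rewrite /p -mulrBr -mulrBl -natr1 [_ + 1]addrC addrK mul1r.
have step k : (k <= n)%N ->
    f (p k) - f 0 <= g (p k) - g 0 + D / n%:R * (q (p k) - q 0).
  elim: k => [|k IH] kn.
    by rewrite /p mul0r mulr0 !subrr mulr0 addr0.
  have := hf (p k.+1) (p k) (p0 _) (pD _ kn) (p0 _) (pD _ (ltnW kn)).
  have := hg (p k) (p k.+1) (p0 _) (pD _ (ltnW kn)) (p0 _) (pD _ kn).
  rewrite -[p k - p k.+1]opprB pS; have := IH (ltnW kn); lra.
have pn : p n = D by rewrite /p divff ?mulr1// gt_eqF.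
have := step n (leqnn n); rewrite pn => h; apply: le_trans h _.
rewrite lerD2l; apply: le_trans Dn; rewrite ler_piMr ?divr_ge0 ?(ltW D0)//.
have /andP[_ q1] := q01 D (ltW D0) (lexx D).
have /andP[q0 _] := q01 0 (lexx 0) (ltW D0); lra.
Qed.

Lemma subgradient_unique (f g q : R -> R) D : 0 < D ->
  (forall m, 0 <= m -> m <= D -> 0 <= q m <= 1) ->
  subgradient f q D -> subgradient g q D -> f D - f 0 = g D - g 0.
Proof.
by move=> D0 q01 hf hg; apply/eqP; rewrite eq_le !(@subgradient_le _ _ q).
Qed.

End Envelope.

Section Project.
Context {R : realType} {d0 : measure_display} {Omega : measurableType d0}.
Variables (P : probability Omega R) (d : nat).
Variables (F : mindex d -> set (set Omega)) (i : 'I_d) (b C : R).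
Variables (h : nat -> Omega -> R) (V : nat -> R -> Omega -> R).
Local Notation G := (Fi F i).
Local Notation bmT := (@bm R d0 Omega (@measurable d0 Omega)).
Local Notation Ex := (Ex P).
Hypotheses (b0 : 0 < b) (b1 : b < 1).
Hypothesis sG : forall t, sub_sigma (G t).
Hypothesis GS : forall t, G t `<=` G t.+1.
Hypothesis h0 : forall t x, 0 < h t.+1 x.
Hypothesis hC : forall t x, h t.+1 x <= C.
Hypothesis mh : forall t, meas_wrt (G t) (h t.+1).
Hypothesis essV : forall t (m : R), 0 <= m ->
  ess_sup_of P (G t)
    [set Y | exists tau, stopping_from F i t tau /\
                         cond_exp P (G t) (gain b h t m tau) Y]
    (fun x => (V t m x)%:E).

Local Notation D := (C / (1 - b)).

Let ob0 : 0 < 1 - b. Proof. by rewrite subr_gt0. Qed.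
Let C0 : 0 < C. Proof. exact: lt_le_trans (h0 0%N point) (hC _ _). Qed.
Let D0 : 0 < D. Proof. by rewrite divr_gt0. Qed.
Let DC : (1 - b) * D = C. Proof. by rewrite mulrC divfK// gt_eqF. Qed.

Implicit Types (S : nat -> set Omega) (t u v : nat) (m : R).

Lemma Fi_mono t u : (t <= u)%N -> G t `<=` G u.
Proof.
move=> /subnK <-; elim: (u - t)%N => [|n IH]; first by rewrite add0n.
by move=> A /IH; exact: GS.
Qed.

(* The discounted payoff of stopping on entry into the increasing family S. *)
Definition stop_payoff (S : nat -> set Omega) t m x : R :=
  dsum b (fun k => if x \in S (t + k)%N then (1 - b) * m else h (t + k).+1 x).

(** [S v] plays the role of the event that stopping has occurred by time [v]. Such families encode
    stopping times, the value infinity included. *)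
Definition adapted_from t (S : nat -> set Omega) :=
  forall v, (t <= v)%N -> G v (S v) /\ S v `<=` S v.+1.

Lemma payoff_seq_bound S t m x k : 0 <= m ->
  0 <= (if x \in S (t + k)%N then (1 - b) * m else h (t + k).+1 x)
    <= (1 - b) * (D + m).
Proof.
move=> m0; rewrite mulrDr DC; case: ifP => _.
  by rewrite mulr_ge0 ?(ltW ob0)//= lerDr ltW.
by rewrite (ltW (h0 _ _))/= (le_trans (hC _ _))// lerDl mulr_ge0 ?(ltW ob0).
Qed.

Lemma payoff_bseq S t m x : 0 <= m ->
  bseq (fun k => if x \in S (t + k)%N then (1 - b) * m else h (t + k).+1 x).
Proof.
move=> m0; exists ((1 - b) * (D + m)) => k.
have /andP[p0 pD] := payoff_seq_bound S t x k m0.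
by rewrite ger0_norm.
Qed.

Lemma stop_payoff_bound S t m x : 0 <= m -> 0 <= stop_payoff S t m x <= D + m.
Proof.
move=> m0; apply/andP; split.
  apply: dsum_ge0 => //; first exact: payoff_bseq.
  by move=> k; have /andP[] := payoff_seq_bound S t x k m0.
rewrite -[leRHS](dsum_cst b0 b1); apply: ler_dsum => //.
- exact: payoff_bseq.
- exact: bseq_cst.
- by move=> k; have /andP[] := payoff_seq_bound S t x k m0.
Qed.

Lemma bm_stop_payoff S t m : 0 <= m ->
  (forall k, measurable (S (t + k)%N)) -> bmT (stop_payoff S t m).
Proof.
move=> m0 mS; apply: bm_dsum => //; first exact: sub_sigmaT.
  move=> k; suff [] : bmT (fun x =>
     if x \in S (t + k)%N then (1 - b) * m else h (t + k).+1 x) by [].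
  apply: bm_if => //; [exact: sub_sigmaT|bmt|].
  apply: (bm_weak (sG (t + k))); split => //.
  by exists C => x; rewrite ger0_norm// ltW.
exists ((1 - b) * (D + m)) => k x.
have /andP[p0 pD] := payoff_seq_bound S t x k m0.
by rewrite ger0_norm.
Qed.

Lemma stop_payoffS S t m x : 0 <= m -> stop_payoff S t m x =
  (if x \in S t then (1 - b) * m else h t.+1 x) + b * stop_payoff S t.+1 m x.
Proof.
move=> m0; rewrite /stop_payoff dsumS//; last exact: payoff_bseq.
rewrite addn0; congr (_ + _ * dsum _ _).
by apply/funext => k; rewrite addnS addSn.
Qed.

Lemma adapted_fromS t S : adapted_from t S -> adapted_from t.+1 S.
Proof. by move=> aS v /ltnW; exact: aS. Qed.

Lemma adapted_sub t S v k : adapted_from t S -> (t <= v)%N ->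
  S v `<=` S (v + k)%N.
Proof.
move=> aS tv; elim: k => [|k IH]; first by rewrite addn0.
move=> x /IH; rewrite addnS; apply: (proj2 (aS _ _)).
by rewrite (leq_trans tv)// leq_addr.
Qed.

Lemma adapted_measurable t S k : adapted_from t S -> measurable (S (t + k)%N).
Proof. by move=> aS; apply: (proj2 (sG (t + k))); case: (aS (t + k)%N (leq_addr _ _)). Qed.

Lemma bm_adapted_payoff S t m : 0 <= m -> adapted_from t S ->
  bmT (stop_payoff S t m).
Proof. by move=> m0 aS; apply: bm_stop_payoff => // k; exact: adapted_measurable aS. Qed.

Lemma stop_payoff_stopped S t m x : adapted_from t S -> S t x ->
  stop_payoff S t m x = m.
Proof.
move=> aS Sx; rewrite /stop_payoff -[RHS](dsum_cst b0 b1); congr dsum.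
apply/funext => k; rewrite ifT//; apply/mem_set.
exact: (adapted_sub k aS (leqnn t)).
Qed.

Definition stopped (tau : Omega -> option nat) v : set Omega :=
  [set x | exists2 n, (n <= v)%N & tau x = Some n].

Lemma stopped_adapted t tau : stopping_from F i t tau ->
  adapted_from t (stopped tau).
Proof.
move=> [mtau _] v tv; split.
  rewrite (_ : stopped tau v = \bigcup_(n in [set n | (n <= v)%N]) [set x | tau x = Some n]).
    by apply: (subsig_bigcup (sG v)) => n /= nv; exact: (Fi_mono nv (mtau n)).
  by apply/seteqP; split => x /= [n nv e]; exists n.
by move=> x [n nv e]; exists n => //; exact: leqW.
Qed.

(** The lump sum paid at the stopping time equals the discounted annuity of rate [(1 - b) * m] from
    then on. *)
Lemma gain_stop_payoff t m tau x : 0 <= m -> stopping_from F i t tau ->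
  gain b h t m tau x = (stop_payoff (stopped tau) t m x)%:E.
Proof.
move=> m0 [_ tau_ge]; rewrite /gain /stop_payoff; case e: (tau x) => [n|].
  have tn := tau_ge _ _ e.
  rewrite -EFinD; congr EFin.
  rewrite (dsum_split b0 b1 (n - t)); last exact: payoff_bseq.
  congr (_ + _).
    rewrite -{1}(subnK tn) -{1}[t]add0n big_addn addnK big_mkord.
    apply: eq_bigr => k _; rewrite addnK ifF; first by rewrite addnC.
    apply/negbTE/negP => /set_mem[n' n't]; rewrite e => -[nn'].
    by move: n't (ltn_ord k); rewrite -nn'; lia.
  rewrite mulrC; congr (_ * _); rewrite -[LHS](dsum_cst b0 b1); congr dsum.
  apply/funext => k; rewrite ifT//; apply/mem_set; exists n => //.
  by rewrite addnA subnKC// leq_addr.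
rewrite -eseries_dsum//; last exact: payoff_bseq.
transitivity (\sum_(0 <= k <oo) (b ^+ k * h (t + k).+1 x)%:E)%E.
  rewrite -nneseries_addn.
    by apply: eq_eseriesr => k _; rewrite addnK addnC.
  by move=> k; rewrite lee_fin mulr_ge0// ?exprn_ge0 ?ltW.
apply: eq_eseriesr => k _; rewrite ifF//.
by apply/negbTE/negP => /set_mem[n' _]; rewrite e.
Qed.

(** Converse of [stopped_adapted]: [tau] is the first entry into [S], and for [n > t] the event
    [tau = n] is the difference of [S n] and [S n.-1]. *)
Lemma adapted_stopping t S : adapted_from t S ->
  exists2 tau, stopping_from F i t tau &
    forall v, (t <= v)%N -> stopped tau v = S v.
Proof.
move=> aS.
pose Q x v := (t <= v)%N && (x \in S v).
pose tau x := if pselect (exists v, Q x v) is left e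
              then Some (ex_minn e) else None.
have tauP x n : tau x = Some n <-> Q x n /\ forall v, Q x v -> (n <= v)%N.
  rewrite /tau; case: pselect => [e|ne].
    case: ex_minnP => k Qk mink; split=> [[<-]//|[Qn minn]].
    by congr Some; apply/eqP; rewrite eqn_leq mink// minn.
  by split => // -[Qn _]; case: ne; exists n.
have Smon v w x : (t <= v)%N -> (v <= w)%N -> S v x -> S w x.
  by move=> tv vw; rewrite -(subnKC vw); exact: (adapted_sub _ aS tv).
have GSw v w : (t <= v)%N -> (v <= w)%N -> G w (S v).
  by move=> tv vw; apply: Fi_mono vw _ _; case: (aS v tv).
exists tau.
  split=> [n|x n /tauP[/andP[]//]].
  have [nt|tn] := ltnP n t.
    rewrite (_ : [set x | _] = set0); first exact: (subsig0 (sG n)).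
    apply/seteqP; split => x //= /tauP[/andP[+ _] _].
    by rewrite leqNgt nt.
  have [tn'|nt'] := ltnP t n; last first.
    have -> : n = t by apply/eqP; rewrite eqn_leq nt'.
    rewrite (_ : [set x | _] = S t); first by case: (aS t (leqnn t)).
    apply/seteqP; split => x /=; first by move=> /tauP[/andP[_ /set_mem]].
    move=> Sx; apply/tauP; split; first by rewrite /Q leqnn mem_set.
    by move=> v /andP[].
  rewrite (_ : [set x | _] = S n `\` S n.-1).
    by apply: (subsigD (sG n)); apply: GSw => //; [rewrite -ltnS prednK//; exact: leq_ltn_trans tn'|exact: leq_pred].
  have n0 : (0 < n)%N by exact: leq_ltn_trans tn'.
  apply/seteqP; split => x /=.
    move=> /tauP[/andP[_ /set_mem Sn] mn]; split => // Sn1.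
    have := mn n.-1; rewrite /Q -ltnS prednK// tn' mem_set// => /(_ isT).
    by rewrite -ltnS prednK// ltnn.
  move=> [Sn Sn1]; apply/tauP; split; first by rewrite /Q tn mem_set.
  move=> v /andP[tv /set_mem Sv]; rewrite leqNgt; apply/negP => vn.
  by apply: Sn1; apply: (Smon v) => //; rewrite -ltnS prednK.
move=> v tv; apply/seteqP; split => x /=.
  by move=> [n nv /tauP[/andP[tn /set_mem Sn] _]]; exact: (Smon n).
move=> Sv.
have e : exists v, Q x v by exists v; rewrite /Q tv mem_set.
exists (ex_minn e); last by rewrite /tau; case: pselect => // e'; congr Some; apply: eq_ex_minn.
by case: ex_minnP => n _; apply; rewrite /Q tv mem_set.
Qed.

(** * Bounds on the value of stopping for a fixed retirement reward *)

Lemma meas_V t m : 0 <= m -> meas_wrt (G t) (V t m).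
Proof.
move=> m0; have [mV _ _] := essV t m0.
apply/meas_wrtE => //; move/meas_wrtE : mV => /(_ (sG t)).
by move/measurable_EFinP.
Qed.

(** Minimality of the essential supremum, reduced to real expectations: each competitor is almost
    surely a bounded version of a conditional payoff, and two such versions are compared by testing
    on events. *)
Lemma V_le Z t m : 0 <= m -> bm (G t) Z ->
  (forall S, adapted_from t S -> forall A, G t A ->
     Ex (fun x => \1_A x * stop_payoff S t m x) <= Ex (fun x => \1_A x * Z x)) ->
  {ae P, forall x, V t m x <= Z x}.
Proof.
move=> m0 bZ H; have [_ _ minV] := essV t m0.
have bZT := bm_weak (sG t) bZ.
have mS S : adapted_from t S -> measurable_fun setT (fun x => (stop_payoff S t m x)%:E).
  by move=> aS; apply/measurable_EFinP; apply: bm_meas; exact: bm_adapted_payoff.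
have : {ae P, forall x, ((V t m x)%:E <= (Z x)%:E)%E}; last first.
  by apply: filterS => x; rewrite lee_fin.
apply: minV; first by apply/measurable_EFinP; exact: bm_meas.
move=> Y [tau [stau cY]].
have aS := stopped_adapted stau.
have [y [by_ _ yE _ yU]] := cond_exp_real (sG t) (mS _ aS)
  (bm_adapted_payoff m0 aS) (fun x => stop_payoff_bound _ t x m0) (aeW P (fun=> erefl)).
have {cY} cY : cond_exp P (G t) (fun x => (stop_payoff (stopped tau) t m x)%:E) Y.
  by move: cY; congr cond_exp; apply/funext => x; exact: gain_stop_payoff.
have yZ : {ae P, forall x, y x <= Z x}.
  by apply: (ae_le_of_Ex (sG t)) => // A GA; rewrite yE// H.
by apply: filterS2 (yU _ cY) yZ => x ->; rewrite lee_fin.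
Qed.

Lemma V_ge_aux S t m : 0 <= m -> adapted_from t S -> exists y,
  [/\ bm (G t) y, {ae P, forall x, y x <= V t m x} &
      forall A, G t A -> Ex (fun x => \1_A x * y x) =
        Ex (fun x => \1_A x * stop_payoff S t m x)].
Proof.
move=> m0 aS; have [_ ubV _] := essV t m0.
have [tau stau tauS] := adapted_stopping aS.
have eS : (fun x => (stop_payoff S t m x)%:E) = gain b h t m tau.
  apply/funext => x; rewrite (gain_stop_payoff _ m0 stau); congr EFin.
  congr dsum; apply/funext => k; rewrite tauS//; exact: leq_addr.
have bS := bm_adapted_payoff m0 aS.
have mS : measurable_fun setT (fun x => (stop_payoff S t m x)%:E).
  by apply/measurable_EFinP; exact: bm_meas.
have [y [by_ _ yE cy _]] := cond_exp_real (sG t) mS bS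
  (fun x => stop_payoff_bound _ t x m0) (aeW P (fun=> erefl)).
exists y; split => //.
have : {ae P, forall x, ((y x)%:E <= (V t m x)%:E)%E}; last first.
  by apply: filterS => x; rewrite lee_fin.
by apply: ubV; exists tau; split => //; rewrite -eS.
Qed.

Lemma V_ge Z S t m : 0 <= m -> adapted_from t S -> bm (G t) Z ->
  (forall x, stop_payoff S t m x = Z x) -> {ae P, forall x, Z x <= V t m x}.
Proof.
move=> m0 aS bZ e; have [y [by_ yV yE]] := V_ge_aux m0 aS.
have Zy : {ae P, forall x, Z x <= y x}.
  apply: (ae_le_of_Ex (sG t)) => // A GA; rewrite yE//.
  apply: ler_Ex => [||x]; last by rewrite e.
    have := bm_weak (sG t) bZ; have := bm_weak (sG t) (bm_ind (sG t) GA) => ? ?.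
    by bmt.
  have := bm_adapted_payoff m0 aS; have := bm_weak (sG t) (bm_ind (sG t) GA) => ? ?.
  by bmt.
by apply: filterS2 Zy yV => x; exact: le_trans.
Qed.

Lemma V_ge_cst t m : 0 <= m -> {ae P, forall x, m <= V t m x}.
Proof.
move=> m0; have aT : adapted_from t (fun=> setT).
  by move=> v _; split => //; exact: (subsigT (sG v)).
apply: (V_ge m0 aT); first exact: bm_cst (sG t) _.
by move=> x; exact: (stop_payoff_stopped m aT).
Qed.

Lemma bm_h t : bm (G t) (h t.+1).
Proof. by split => //; exists C => x; rewrite ger0_norm// ltW. Qed.

(** The rule that plays once and retires at [t + 1]. This is what makes the index positive later. *)
Lemma V_ge_step t m : 0 <= m -> {ae P, forall x, h t.+1 x + b * m <= V t m x}.
Proof.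
move=> m0; pose S v : set Omega := [set _ | (t < v)%N].
have aS : adapted_from t S.
  move=> v _; split; first exact: (subsig_cstP (sG v)).
  by move=> x /= /leqW.
apply: (V_ge m0 aS).
  by have := sG t; have := bm_h t => ? ?; bmt.
move=> x; rewrite stop_payoffS// ifF; last first.
  by apply/negbTE/negP => /set_mem; rewrite /S/= ltnn.
by rewrite (stop_payoff_stopped m (adapted_fromS aS))// /S/= ltnS.
Qed.

(** Here the annuity rate [(1 - b) * m] is at least [C], so no reward beats immediate retirement. *)
Lemma V_le_cst t m : D <= m -> {ae P, forall x, V t m x <= m}.
Proof.
move=> Dm; have m0 : 0 <= m := le_trans (ltW D0) Dm.
have bA A : G t A -> bmT \1_A.
  by move=> GA; apply: (bm_weak (sG t)); exact: (bm_ind (sG t)).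
apply: V_le => //; first exact: bm_cst.
move=> S aS A GA; have bS := bm_adapted_payoff m0 aS; have bA' := bA _ GA.
apply: ler_Ex => [||x]; [bmt|bmt|].
rewrite ler_wpM2l ?indicE// -[leRHS](dsum_cst b0 b1).
apply: ler_dsum => // [||k]; [exact: payoff_bseq|exact: bseq_cst|].
case: ifP => // _; apply: le_trans (hC _ _) _.
by rewrite -DC ler_wpM2l// ltW.
Qed.

Lemma V_le_bound t m : 0 <= m -> {ae P, forall x, V t m x <= D + m}.
Proof.
move=> m0; apply: V_le => //; first exact: bm_cst.
move=> S aS A GA; have bS := bm_adapted_payoff m0 aS.
have bA : bmT \1_A by apply: (bm_weak (sG t)); exact: (bm_ind (sG t)).
apply: ler_Ex => [||x]; [bmt|bmt|].
by rewrite ler_wpM2l ?indicE//; case/andP: (stop_payoff_bound S t x m0).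
Qed.

(** A version of [V] that is bounded at every point, so that the calculus of [bm] and [Ex]
    applies. *)
Definition W t m x := Num.min (D + m) (Num.max 0 (V t m x)).

Lemma bm_W t m : 0 <= m -> bm (G t) (W t m).
Proof.
move=> m0; split.
  apply/meas_wrtE => //; apply: measurable_minr; first exact: measurable_cst.
  apply: measurable_maxr; first exact: measurable_cst.
  by apply/meas_wrtE => //; exact: meas_V.
exists (D + m) => x; rewrite ger0_norm; first by rewrite ge_min lexx.
by rewrite le_min addr_ge0 ?(ltW D0)//= le_max lexx.
Qed.

Lemma W_bound t m x : 0 <= m -> 0 <= W t m x <= D + m.
Proof.
by move=> m0; rewrite le_min addr_ge0 ?(ltW D0)//= le_max lexx/= ge_min lexx.
Qed.

Lemma ae_W t m : 0 <= m -> {ae P, forall x, V t m x = W t m x}.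
Proof.
move=> m0; apply: filterS2 (V_ge_cst t m0) (V_le_bound t m0) => x mV VD.
by rewrite /W (max_r (le_trans m0 mV)) min_r.
Qed.

Lemma W_ge S t m : 0 <= m -> adapted_from t S -> forall A, G t A ->
  Ex (fun x => \1_A x * stop_payoff S t m x) <= Ex (fun x => \1_A x * W t m x).
Proof.
move=> m0 aS A GA; have [y [by_ yV yE]] := V_ge_aux m0 aS.
rewrite -yE//.
have bA : bmT \1_A by apply: (bm_weak (sG t)); exact: (bm_ind (sG t)).
have byT := bm_weak (sG t) by_; have bWT := bm_weak (sG t) (bm_W t m0).
apply: ae_ler_Ex => //; [bmt|bmt|].
apply: filterS2 yV (ae_W t m0) => x yV <-.
by rewrite ler_wpM2l ?indicE.
Qed.

(** Whatever the rule, raising the reward adds at most [(1 - b) * (m' - m)] to the rate of each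
    period. *)
Lemma V_lip t m m' : 0 <= m -> m <= m' ->
  {ae P, forall x, V t m' x <= V t m x + (m' - m)}.
Proof.
move=> m0 mm'; have m'0 := le_trans m0 mm'.
have d0' : 0 <= m' - m by rewrite subr_ge0.
have bW := bm_W t m0; have bWT := bm_weak (sG t) bW.
suff : {ae P, forall x, V t m' x <= W t m x + (m' - m)}.
  by apply: filterS2 (ae_W t m0) => x ->.
apply: V_le => //; first by have := sG t => ?; bmt.
move=> S aS A GA.
have bA : bmT \1_A by apply: (bm_weak (sG t)); exact: (bm_ind (sG t)).
have bS := bm_adapted_payoff m0 aS; have bS' := bm_adapted_payoff m'0 aS.
have -> : (fun x => \1_A x * (W t m x + (m' - m))) =
   (fun x => \1_A x * W t m x + \1_A x * (m' - m)).
  by apply/funext => x; rewrite mulrDr.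
rewrite ExD; [|bmt..].
apply: le_trans (_ : Ex (fun x => \1_A x * stop_payoff S t m x + \1_A x * (m' - m)) <= _).
  apply: ler_Ex => [||x]; [bmt|bmt|].
  rewrite -mulrDr ler_wpM2l ?indicE//.
  rewrite -[X in _ + X](dsum_cst b0 b1) -dsumD//; [|exact: payoff_bseq|exact: bseq_cst].
  apply: ler_dsum => // [||k]; first exact: payoff_bseq.
    by apply: bseqD; [exact: payoff_bseq|exact: bseq_cst].
  case: ifP => _; first by rewrite -mulrDr subrKC.
  by rewrite lerDl mulr_ge0// ltW.
rewrite ExD; [|bmt..].
by rewrite lerD2r W_ge.
Qed.

(** The upper half of the Bellman equation. A rule retires on [S t], which is worth [m], or plays
    once and follows a rule from [t + 1], worth at most [W t.+1 m]; [y] is the conditional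
    expectation of the latter given [G t]. *)
Lemma V_bellman t m : 0 <= m -> exists y,
  [/\ bm (G t) y,
     forall A, G t A -> Ex (fun x => \1_A x * y x) = Ex (fun x => \1_A x * W t.+1 m x) &
     {ae P, forall x, V t m x <= Num.max m (h t.+1 x + b * y x)}].
Proof.
move=> m0; have bW1 := bm_weak (sG t.+1) (bm_W t.+1 m0).
have [y [by_ yK yE]] := cond_exp_exists P (sG t) bW1 (fun x => W_bound t.+1 x m0).
exists y; split => //.
have sGt := sG t; have bh := bm_h t.
apply: V_le => //; first by bmt.
have byT := bm_weak (sG t) by_; have bhT := bm_weak (sG t) bh.
move=> S aS A GA; have [GSt _] := aS t (leqnn t).
have bS := bm_adapted_payoff m0 aS.
have bS1 := bm_adapted_payoff m0 (adapted_fromS aS).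
pose A1 := A `&` S t; pose A2 := A `\` S t.
have GA1 : G t A1 by apply: (subsigI (sG t)).
have GA2 : G t A2 by apply: (subsigD (sG t)).
have bI B : G t B -> bmT \1_B by move=> GB; apply: (bm_weak (sG t)); exact: (bm_ind (sG t)).
have b1' := bI _ GA1; have b2' := bI _ GA2; have bA := bI _ GA.
have -> : (fun x => \1_A x * stop_payoff S t m x) =
  (fun x => (\1_A1 x * m + \1_A2 x * h t.+1 x) + b * (\1_A2 x * stop_payoff S t.+1 m x)).
  apply/funext => x; rewrite !indicE /A1 /A2 in_setI in_setD.
  case: (boolP (x \in A)) => _ /=; last by rewrite !(mul0r, mulr0, addr0).
  case: (boolP (x \in S t)) => xS /=.
    rewrite !(mul1r, mul0r, mulr0, addr0); apply: stop_payoff_stopped => //.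
    exact/set_mem.
  by rewrite !(mul1r, mul0r, add0r) stop_payoffS// (negbTE xS).
have -> : Ex (fun x => \1_A x * Num.max m (h t.+1 x + b * y x)) =
   Ex (fun x => (\1_A1 x + \1_A2 x) * Num.max m (h t.+1 x + b * y x)).
  congr Ex; apply/funext => x; congr (_ * _); rewrite !indicE /A1 /A2 in_setI in_setD.
  by case: (x \in A); case: (x \in S t); rewrite /= ?addr0 ?add0r.
apply: (@le_trans _ _ (Ex (fun x => (\1_A1 x * m + \1_A2 x * h t.+1 x) + b * (\1_A2 x * y x)))).
  rewrite !ExD ?ExZ; try bmt.
  rewrite lerD2l ler_wpM2l ?(ltW b0)// yE//.
  by apply: W_ge => //; [exact: adapted_fromS|exact: GS].
apply: ler_Ex => [||x]; [bmt|bmt|].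
rewrite mulrDl -addrA; apply: lerD.
  by rewrite ler_wpM2l ?indicE// le_max lexx.
rewrite mulrCA -mulrDr ler_wpM2l ?indicE//.
by rewrite le_max lexx orbT.
Qed.

Hypothesis contV : forall t, {ae P, forall x,
  {within [set m : R | 0 <= m], continuous (fun m => V t m x)}}.

(** * Regularity in the retirement reward, simultaneously for all rewards *)

Let qn (n k : nat) : R := k%:R / n.+1%:R.
(** Numbers the first grid point strictly above [m]. Approaching from the right stays in the domain
    where [V] is continuous, and the strictness is used in [V_eq_iff]. *)
Let up n m := (Num.trunc (m * n.+1%:R)).+1.

Let qn_ge0 n k : 0 <= qn n k. Proof. by rewrite divr_ge0. Qed.

Let qn_gt n m : m < qn n (up n m).
Proof. by rewrite /qn /up ltr_pdivlMr// truncnS_gt. Qed.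

Let qn_le n m : 0 <= m -> qn n (up n m) <= m + n.+1%:R^-1.
Proof.
move=> m0; rewrite /qn /up ler_pdivrMr// mulrDl mulVf ?pnatr_eq0//.
by rewrite -natr1 lerD2r truncn_le mulr_ge0.
Qed.

Let le_qn_up n m m' : m <= m' -> qn n (up n m) <= qn n (up n m').
Proof.
move=> mm'; rewrite /qn ler_wpM2r ?invr_ge0// ler_nat ltnS.
by apply: le_truncn; rewrite ler_wpM2r.
Qed.

Let qn_cvg m : 0 <= m -> qn n (up n m) @[n --> \oo] --> m.
Proof.
move=> m0; apply: (@squeeze_cvgr _ _ _ _ (fun=> m) (fun n => m + n.+1%:R^-1)).
- by apply: nearW => n; rewrite (ltW (qn_gt n m)) qn_le.
- exact: cvg_cst.
- by rewrite -[X in _ --> X]addr0; apply: cvgD; [exact: cvg_cst|exact: cvg_harmonic].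
Qed.

Let qn_cvg_comp (f : R -> R) m : 0 <= m ->
  {within [set m : R | 0 <= m], continuous f} ->
  f (qn n (up n m)) @[n --> \oo] --> f m.
Proof.
move=> m0 /subspace_continuousP/(_ m m0) cf.
apply: cvg_comp cf; move=> A /=; rewrite /within/= => WA.
have H : \forall n \near \oo, 0 <= qn n (up n m) -> A (qn n (up n m)) := qn_cvg m0 WA.
by apply: (filterS _ H) => n; apply; exact: qn_ge0.
Qed.

(** Each inequality holds off one null set at the countably many grid points, and continuity carries
    it to every [m >= 0]. *)
Lemma V_regular t : {ae P, forall x,
  [/\ forall m, 0 <= m -> m <= V t m x,
      forall m, 0 <= m -> h t.+1 x + b * m <= V t m x,
      forall m m', 0 <= m -> m <= m' -> V t m' x <= V t m x + (m' - m) &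
      {within [set m : R | 0 <= m], continuous (fun m => V t m x)}]}.
Proof.
have H1 : {ae P, forall x, forall n k, qn n k <= V t (qn n k) x}.
  by apply: ae_foralln => n; apply: ae_foralln => k; exact: V_ge_cst.
have H2 : {ae P, forall x, forall n k, h t.+1 x + b * qn n k <= V t (qn n k) x}.
  by apply: ae_foralln => n; apply: ae_foralln => k; exact: V_ge_step.
have H3 : {ae P, forall x, forall n k k', qn n k <= qn n k' ->
    V t (qn n k') x <= V t (qn n k) x + (qn n k' - qn n k)}.
  apply: ae_foralln => n; apply: ae_foralln => k; apply: ae_foralln => k'.
  have [kk'|kk'] := boolP (qn n k <= qn n k'); last exact: aeW.
  by apply: filterS (V_lip t (qn_ge0 n k) kk') => x.
near=> x.
have h1 : forall n k, qn n k <= V t (qn n k) x by near: x.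
have h2 : forall n k, h t.+1 x + b * qn n k <= V t (qn n k) x by near: x.
have h3 : forall n k k', qn n k <= qn n k' ->
    V t (qn n k') x <= V t (qn n k) x + (qn n k' - qn n k) by near: x.
have cV : {within [set m : R | 0 <= m], continuous (fun m => V t m x)} by near: x.
split => // [m m0|m m0|m m' m0 mm'].
- apply: ler_cvg_to (qn_cvg m0) (qn_cvg_comp m0 cV) _; exact: nearW.
- apply: ler_cvg_to (qn_cvg_comp m0 cV) _; last by apply: nearW => n; exact: h2.
  by apply: cvgD; [exact: cvg_cst|apply: cvgM; [exact: cvg_cst|exact: (qn_cvg m0)]].
- have m'0 := le_trans m0 mm'.
  apply: ler_cvg_to (qn_cvg_comp m'0 cV) _ _; last first.
    by apply: nearW => n; apply: h3; exact: le_qn_up mm'.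
  apply: cvgD; first exact: (qn_cvg_comp m0 cV).
  by apply: cvgB; [exact: (qn_cvg m'0)|exact: (qn_cvg m0)].
Unshelve. all: by end_near.
Qed.

(** * The Gittins index as the threshold at which retirement becomes optimal *)

Variable M : nat -> Omega -> \bar R.
Hypothesis essM : forall t, ess_sup_of P (G t)
  [set Y | exists X : Omega -> R,
     [/\ Y = (fun x => (X x)%:E), meas_wrt (G t) X,
         (forall x, 0 < X x) & {ae P, forall x, X x < V t (X x) x}]]
  (M t).

Lemma index_gt0 t : {ae P, forall x, (0 < M t x)%E}.
Proof.
have [_ ubM _] := essM t.
(* As [D / C] is the inverse of [1 - b], this is half the next reward, capitalised for ever. Since
   [(1 - b) * X x] is less than that reward, playing once, worth [h t.+1 x + b * X x], beats
   retiring with [X x]. *)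
pose X x : R := 2^-1 * h t.+1 x * (D / C).
have X0 x : 0 < X x by rewrite /X !mulr_gt0 ?invr_gt0.
have XE x : (1 - b) * X x = 2^-1 * h t.+1 x.
  by rewrite /X; field; rewrite !gt_eqF.
have : {ae P, forall x, ((X x)%:E <= M t x)%E}.
  apply: ubM; exists X; split => //.
    have [] : bm (G t) X; last by [].
    by have := bm_h t; have := sG t => ? ?; rewrite /X; bmt.
  apply: filterS (V_regular t) => x [_ hV _ _].
  apply: lt_le_trans (hV _ (ltW (X0 x))).
  rewrite -ltrBlDr -{1}[X x]mul1r -mulrBl XE.
  by have := h0 t x; lra.
by apply: filterS => x; apply: lt_le_trans; rewrite lte_fin.
Qed.

Lemma index_leD t : {ae P, forall x, (M t x <= D%:E)%E}.
Proof.
have [_ _ minM] := essM t.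
apply: minM => [|Y [X [-> mX X0 XV]]]; first exact: measurable_cst.
apply: filterS3 XV (V_regular t) (V_le_cst t (lexx D)) => x XV [_ _ lip _] VD.
rewrite lee_fin leNgt; apply/negP => DX.
have := lip D (X x) (ltW D0) (ltW DX); lra.
Qed.

(** By the slope bound, retirement that is optimal at [m] stays optimal for larger rewards, so no
    candidate [X] exceeds [m] there. The strict inequality required of candidates is essential:
    [m <= V t m x] holds almost surely for every [m]. *)
Lemma index_le_of_V t m : 0 <= m ->
  {ae P, forall x, V t m x <= m -> (M t x <= m%:E)%E}.
Proof.
move=> m0; have [_ _ minM] := essM t.
pose A := [set x | V t m x <= m].
have GA : G t A by apply: (meas_le (sG t)); [exact: meas_V|exact: (meas_cst (sG t))].
(* Minimality of [M t] asks for an upper bound on the whole space, so the bound is infinite off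
   [A]. *)
pose Z x : \bar R := if x \in A then m%:E else +oo%E.
have mZ : meas_wrt (G t) Z.
  by apply: (meas_if (sG t)) => //; exact: (meas_cst (sG t)).
have : {ae P, forall x, (M t x <= Z x)%E}.
  apply: minM => [|Y [X [-> mX X0 XV]]]; first exact: (meas_wrt_measurable (sG t)).
  apply: filterS2 XV (V_regular t) => x XV [_ _ lip _].
  rewrite /Z; case: ifP => [/set_mem Ax|_]; last exact: leey.
  rewrite lee_fin leNgt; apply/negP => mX'.
  have := lip m (X x) m0 (ltW mX'); move: Ax; rewrite /A/=; lra.
by apply: filterS => x + Vm; rewrite /Z ifT//; exact/mem_set.
Qed.

Lemma index_ge_of_V t m : 0 <= m ->
  {ae P, forall x, m < V t m x -> (m%:E <= M t x)%E}.
Proof.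
rewrite le_eqVlt => /predU1P[<-|m0].
  by apply: filterS (index_gt0 t) => x /ltW.
have [_ ubM _] := essM t.
pose X0 x : R := 2^-1 * h t.+1 x * (D / C).
have X0_gt0 x : 0 < X0 x by rewrite /X0 !mulr_gt0 ?invr_gt0.
have XE x : (1 - b) * X0 x = 2^-1 * h t.+1 x.
  by rewrite /X0; field; rewrite !gt_eqF.
pose A := [set x | m < V t m x].
have GA : G t A.
  by apply: (meas_lt (sG t)); [exact: (meas_cst (sG t))|apply: meas_V; exact: ltW].
(* A candidate must be positive and strictly improvable off [A] as well; there the capitalised half
   reward from [index_gt0] does the job. *)
pose X x : R := if x \in A then m else X0 x.
have : {ae P, forall x, ((X x)%:E <= M t x)%E}.
  apply: ubM; exists X; split => //.
  - apply: (meas_if (sG t)) => //; first exact: (meas_cst (sG t)).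
    have [] : bm (G t) X0; last by [].
    by have := bm_h t; have := sG t => ? ?; rewrite /X0; bmt.
  - by move=> x; rewrite /X; case: ifP.
  apply: filterS (V_regular t) => x [_ hV _ _].
  rewrite /X; case: ifP => [/set_mem//|_].
  apply: lt_le_trans (hV _ (ltW (X0_gt0 x))).
  rewrite -ltrBlDr -{1}[X0 x]mul1r -mulrBl XE.
  by have := h0 t x; lra.
by apply: filterS => x + Vm; rewrite /X ifT//; exact/mem_set.
Qed.

(** A real version of [M t] with values in [(0, D]] at every point; on the exceptional null set [D]
    is just some value in this range. *)
Definition gittins_index t x : R :=
  if x \in [set x | (0 < M t x)%E] `&` [set x | (M t x <= D%:E)%E]
  then fine (M t x) else D.

Lemma index_bound t x : 0 < gittins_index t x <= D.
Proof.
rewrite /gittins_index; case: ifP => [/set_mem[/= M0 MD]|_]; last by rewrite D0 lexx.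
by move: M0 MD; case: (M t x) => //= r; rewrite lte_fin lee_fin => -> ->.
Qed.

Lemma bm_index t : bm (G t) (gittins_index t).
Proof.
have [mM _ _] := essM t; have mM' := (meas_wrtE _ (sG t)).1 mM.
split; last first.
  by exists D => x; have /andP[/ltW i0 iD] := index_bound t x; rewrite ger0_norm.
apply: (meas_if (sG t)); last exact: (meas_cst (sG t)).
  apply: (subsigI (sG t)).
    rewrite (subsig_gE (sG t)).
    have := @measurable_lte _ (g_sigma_algebraType (G t)) R setT measurableT
      (cst 0%E) (M t); rewrite setTI; apply => //.
  rewrite (_ : [set x | _] = ~` [set x | (D%:E < M t x)%E]).
    apply: (subsigC (sG t)); rewrite (subsig_gE (sG t)).
    have := @measurable_lte _ (g_sigma_algebraType (G t)) R setT measurableT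
      (cst D%:E) (M t); rewrite setTI; apply => //.
  by apply/seteqP; split => x /=; rewrite leNgt => /negP.
apply/meas_wrtE => //; apply: measurableT_comp => //; exact: fine_measurable.
Qed.

Lemma ae_index t : {ae P, forall x, M t x = (gittins_index t x)%:E}.
Proof.
apply: filterS2 (index_gt0 t) (index_leD t) => x M0 MD.
rewrite /gittins_index ifT; last by apply/mem_set.
by rewrite fineK// fin_numE; move: M0 MD; case: (M t x).
Qed.

(** Both directions pass through grid points [q > m]. If [V t m x = m], the slope bound gives
    [V t q x <= q], so the index is at most [q]. If the index is at most [m], it is below [q], so
    again [V t q x <= q], and [q] decreases to [m] by continuity. *)
Lemma V_eq_iff t : {ae P, forall x, forall m, 0 <= m ->
  (V t m x = m <-> gittins_index t x <= m)}.
Proof.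
have H1 : {ae P, forall x, forall n k, V t (qn n k) x <= qn n k -> (M t x <= (qn n k)%:E)%E}.
  by apply: ae_foralln => n; apply: ae_foralln => k; exact: index_le_of_V.
have H2 : {ae P, forall x, forall n k, qn n k < V t (qn n k) x -> ((qn n k)%:E <= M t x)%E}.
  by apply: ae_foralln => n; apply: ae_foralln => k; exact: index_ge_of_V.
near=> x.
have h1 : forall n k, V t (qn n k) x <= qn n k -> gittins_index t x <= qn n k.
  have e : M t x = (gittins_index t x)%:E by near: x; exact: ae_index.
  have : forall n k, V t (qn n k) x <= qn n k -> (M t x <= (qn n k)%:E)%E by near: x.
  by move=> H n k /H; rewrite e lee_fin.
have h2 : forall n k, qn n k < V t (qn n k) x -> qn n k <= gittins_index t x.
  have e : M t x = (gittins_index t x)%:E by near: x; exact: ae_index.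
  have : forall n k, qn n k < V t (qn n k) x -> ((qn n k)%:E <= M t x)%E by near: x.
  by move=> H n k /H; rewrite e lee_fin.
have [Vm _ lip cV] : [/\ forall m, 0 <= m -> m <= V t m x,
      forall m, 0 <= m -> h t.+1 x + b * m <= V t m x,
      forall m m', 0 <= m -> m <= m' -> V t m' x <= V t m x + (m' - m) &
      {within [set m : R | 0 <= m], continuous (fun m => V t m x)}].
  by near: x; exact: V_regular.
move=> m m0; split=> [e|im].
  apply: ler_cvg_to (cvg_cst (gittins_index t x)) (qn_cvg m0) _; apply: nearW => n.
  by apply: h1; have := lip m (qn n (up n m)) m0 (ltW (qn_gt n m)); rewrite e; lra.
apply/eqP; rewrite eq_le Vm// andbT.
apply: ler_cvg_to (qn_cvg_comp m0 cV) (qn_cvg m0) _; apply: nearW => n.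
rewrite leNgt; apply/negP => /h2; apply/negP; rewrite -ltNge.
exact: le_lt_trans im (qn_gt n m).
Unshelve. all: by end_near.
Qed.


Local Notation e t k x := (env (gittins_index^~ x) t k).

(** * Optimality of stopping when the envelope reaches the retirement reward *)

Lemma bm_env t k : bm (G (t + k)) (fun x => e t k x).
Proof.
elim: k => [|k IH]; first by rewrite addn0; exact: bm_index.
have sGk := sG (t + k.+1); have ? := bm_index (t + k.+1).
have ? : bm (G (t + k.+1)) (fun x => e t k x).
  by apply: bm_sub IH; apply: Fi_mono; rewrite leq_add2l.
by rewrite /=; bmt.
Qed.

Lemma env_index_bound t k x : 0 < e t k x <= D.
Proof. by apply: env_bound => u; exact: index_bound. Qed.

(** For [v >= t], the event that the index has been at most [m] somewhere in [[t, v]], that is, up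
    to a null set, [sigma(t; m) <= v]. Written with the envelope, it is visibly increasing in
    [v]. *)
Definition below t m v : set Omega := [set x | e t (v - t) x <= m].

Lemma below_adapted t m : adapted_from t (below t m).
Proof.
move=> v tv; split.
  have [mE _] := bm_env t (v - t); rewrite subnKC// in mE.
  by apply: (meas_le (sG v)) => //; exact: (meas_cst (sG v)).
move=> x; rewrite /below/= => /(le_trans _); apply; apply: env_noninc.
exact: leq_sub2r.
Qed.

Lemma in_below t m k x : (x \in below t m (t + k)) = (e t k x <= m).
Proof. by apply/idP/idP => [/set_mem|em]; [|apply/mem_set]; rewrite /below/= addKn. Qed.

(** While the index at [t] exceeds [m], the minima from [t] and from [t + 1] reach [m] at the same
    time, so the rule simply restarts. *)
Lemma below_payoffS t m x : 0 <= m -> m < gittins_index t x ->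
  stop_payoff (below t m) t m x = h t.+1 x + b * stop_payoff (below t.+1 m) t.+1 m x.
Proof.
move=> m0 mi; rewrite stop_payoffS// ifF; last first.
  by rewrite -[X in below t m X]addn0 in_below/= leNgt mi.
congr (_ + _ * dsum _ _); apply/funext => k; rewrite in_below addSnnS in_below.
by rewrite envS ge_min leNgt mi.
Qed.

(** Value iteration: after [n] uses of [V_bellman] along the rule, only the trivial bound [D + m]
    remains, discounted [n] times. On [I] the value is [m], which the rule collects; off [I] the
    value exceeds [m] by [V_eq_iff], so the maximum in the Bellman bound is attained by
    continuing. *)
Lemma optimal_stopping_le n t m A : 0 <= m -> G t A ->
  Ex (fun x => \1_A x * W t m x) <=
  Ex (fun x => \1_A x * stop_payoff (below t m) t m x) + b ^+ n * (D + m).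
Proof.
move=> m0; elim: n t A => [|n IH] t A GA.
  have bA : bmT \1_A by apply: (bm_weak (sG t)); exact: (bm_ind (sG t)).
  have bW1 := bm_weak (sG t) (bm_W t m0).
  rewrite expr0 mul1r; apply: (@le_trans _ _ (D + m)).
    apply: le_trans (ler_norm _) _; apply: Ex_bound => [|x]; first bmt.
    have /andP[w0 wD] := W_bound t x m0.
    by rewrite normrM (ger0_norm w0) indicE; case: (_ \in _);
      rewrite ?normr1 ?normr0 ?mul1r ?mul0r// (le_trans w0 wD).
  rewrite lerDr; apply: Ex_ge0 => x.
  by have /andP[w0 _] := stop_payoff_bound (below t m) t x m0; rewrite mulr_ge0// indicE.
have [y [by_ yE Vy]] := V_bellman t m0.
pose I := [set x | gittins_index t x <= m].
have GI : G t I.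
  by apply: (meas_le (sG t)); [case: (bm_index t)|exact: (meas_cst (sG t))].
pose A1 := A `&` I; pose A2 := A `\` I.
have GA1 : G t A1 by apply: (subsigI (sG t)).
have GA2 : G t A2 by apply: (subsigD (sG t)).
have bI B : G t B -> bmT \1_B by move=> GB; apply: (bm_weak (sG t)); exact: (bm_ind (sG t)).
have b1' := bI _ GA1; have b2' := bI _ GA2; have bA := bI _ GA.
have bW1 := bm_weak (sG t) (bm_W t m0).
have bW2 := bm_weak (sG t.+1) (bm_W t.+1 m0).
have byT := bm_weak (sG t) by_; have bhT := bm_weak (sG t) (bm_h t).
have bS := bm_adapted_payoff m0 (@below_adapted t m).
have bS1 := bm_adapted_payoff m0 (@below_adapted t.+1 m).
apply: (@le_trans _ _ (Ex (fun x => (\1_A1 x * m + \1_A2 x * h t.+1 x) + b * (\1_A2 x * y x)))).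
  apply: ae_ler_Ex; [bmt|bmt|].
  have VE : {ae P, forall x, m <= V t m x /\ (V t m x = m <-> gittins_index t x <= m)}.
    by apply: filterS2 (V_ge_cst t m0) (V_eq_iff t) => x mV /(_ m m0).
  apply: filterS3 Vy (ae_W t m0) VE => x {}Vy <- [mV VE].
  rewrite !indicE /A1 /A2 in_setI in_setD.
  case: (boolP (x \in A)) => _ /=; last by rewrite !(mul0r, mulr0, addr0).
  case: (boolP (x \in I)) => /= [/set_mem xI|/negP xI].
    by rewrite !(mul1r, mul0r, mulr0, addr0) (VE.2 xI).
  rewrite !(mul1r, mul0r, add0r).
  move: Vy; rewrite le_max => /orP[Vm|//].
  by case: xI; apply/mem_set; apply/VE; apply/eqP; rewrite eq_le Vm mV.
rewrite !ExD ?ExZ; try bmt.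
rewrite yE//; have := IH t.+1 A2 (GS GA2).
rewrite -(ler_pM2l b0) mulrDr => le1; apply: le_trans (lerD (lexx _) le1) _.
rewrite exprS -mulrA addrA lerD2r -ExZ -?ExD; try bmt.
apply: ler_Ex => [||x]; [bmt|bmt|].
rewrite !indicE /A1 /A2 in_setI in_setD.
case: (boolP (x \in A)) => _ /=; last by rewrite !(mul0r, mulr0, addr0).
case: (boolP (x \in I)) => /= [/set_mem xI|/negP xI].
  rewrite !(mul1r, mul0r, mulr0, addr0) stop_payoff_stopped//; first exact: below_adapted.
  by rewrite /below/= subnn.
rewrite !(mul1r, mul0r, add0r) (@below_payoffS t)//.
by rewrite ltNge; apply/negP => im; apply: xI; exact/mem_set.
Qed.

Lemma optimal_stopping t m A : 0 <= m -> G t A ->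
  Ex (fun x => \1_A x * W t m x) =
  Ex (fun x => \1_A x * stop_payoff (below t m) t m x).
Proof.
move=> m0 GA; apply/eqP; rewrite eq_le W_ge ?andbT//; last exact: below_adapted.
rewrite -subr_le0; apply: (@eq0_le_geo _ b b0 b1 _ (D + m)) => n.
by rewrite lerBlDl; exact: optimal_stopping_le.
Qed.

(** This is [b] to the power [sigma(t; m) - t] up to a null set: the rate [1 - b], paid from the
    stopping time on. *)
Definition below_weight t m x :=
  dsum b (fun k => if e t k x <= m then 1 - b else 0).

Lemma below_weight_bseq t m x : bseq (fun k => if e t k x <= m then 1 - b else 0).
Proof. by exists (1 - b) => k; case: ifP => _; rewrite ?normr0 ?ger0_norm// ltW. Qed.

Lemma below_weight_bound t m x : 0 <= below_weight t m x <= 1.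
Proof.
apply/andP; split.
  apply: dsum_ge0 => // [|k]; first exact: below_weight_bseq.
  by case: ifP => // _; exact: ltW.
rewrite -(dsum_cst b0 b1 1); apply: ler_dsum => // [||k].
- exact: below_weight_bseq.
- exact: bseq_cst.
- by rewrite mulr1; case: ifP => // _; exact: ltW.
Qed.

Lemma bm_below_weight t m : bmT (below_weight t m).
Proof.
apply: bm_dsum => //; first exact: sub_sigmaT.
  move=> k; have [] // : bmT (fun x => if e t k x <= m then 1 - b else 0).
  rewrite (_ : (fun x => _) =
    (fun x => if x \in below t m (t + k) then 1 - b else 0)); last first.
    by apply/funext => x; rewrite in_below.
  apply: bm_if; [exact: sub_sigmaT| |bmt|bmt].
  exact: (adapted_measurable _ (@below_adapted t m)).
by exists (1 - b) => k x; case: ifP => _; rewrite ?normr0 ?ger0_norm// ltW.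
Qed.

(** The rule stays the optimal one for [m] while the reward moves to [m'], where it is a mere
    competitor; this yields the subgradient of the value. *)
Lemma below_payoff_affine t m m' x : 0 <= m -> 0 <= m' ->
  stop_payoff (below t m) t m' x =
  stop_payoff (below t m) t m x + (m' - m) * below_weight t m x.
Proof.
move=> m0 m'0; rewrite /below_weight -dsumZ//; last exact: below_weight_bseq.
rewrite -dsumD//; [|exact: payoff_bseq|by apply: bseqZ; exact: below_weight_bseq].
congr dsum; apply/funext => k; rewrite in_below; case: ifP => _.
  by ring.
by rewrite mulr0 addr0.
Qed.

Let env_max_bseq t m x : 0 <= m -> m <= D ->
  bseq (fun k => (1 - b) * Num.max (e t k x) m).
Proof.
move=> m0 mD; apply: bseqZ; exists D => k.
have /andP[/ltW e0 eD] := env_index_bound t k x.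
by rewrite ger0_norm ?ge_max ?eD// le_max e0.
Qed.

Lemma bm_envT t k : bmT (fun x => e t k x).
Proof. exact: (bm_weak (sG _) (bm_env t k)). Qed.

Let bm_env_max t m : 0 <= m -> m <= D ->
  bmT (fun x => dsum b (fun k => (1 - b) * Num.max (e t k x) m)).
Proof.
move=> m0 mD; apply: bm_dsum => //; first exact: sub_sigmaT.
  move=> k; have [] // : bmT (fun x => (1 - b) * Num.max (e t k x) m).
  have ? := bm_envT t k; bmt.
exists C => k x; have /andP[/ltW e0 eD] := env_index_bound t k x.
rewrite -DC normrM ger0_norm ?(ltW ob0)// ler_wpM2l ?(ltW ob0)//.
by rewrite ger0_norm ?ge_max ?eD// le_max e0.
Qed.

(* Both sides of the identity, seen as functions of the retirement reward m,
   have the subgradient [E beta^(sigma(t; m) - t)] and agree at [m = D]. *)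
Lemma reward_env_identity t A : G t A ->
  Ex (fun x => \1_A x * dsum b (fun k => h (t + k).+1 x)) =
  Ex (fun x => \1_A x * dsum b (fun k => (1 - b) * e t k x)).
Proof.
move=> GA.
have bA : bmT \1_A by apply: (bm_weak (sG t)); exact: (bm_ind (sG t)).
pose f m := Ex (fun x => \1_A x * W t m x).
pose g m := Ex (fun x => \1_A x * dsum b (fun k => (1 - b) * Num.max (e t k x) m)).
pose q m := Ex (fun x => \1_A x * below_weight t m x).
have bW m : 0 <= m -> bmT (W t m) by move=> m0; exact: (bm_weak (sG t) (bm_W t m0)).
have bQ m := bm_below_weight t m.
have bS m m' (m'0 : 0 <= m') := bm_adapted_payoff m'0 (@below_adapted t m).
have bE m (m0 : 0 <= m) (mD : m <= D) := bm_env_max t m0 mD.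
have q01 m : 0 <= m -> m <= D -> 0 <= q m <= 1.
  move=> m0 mD; have bQm := bQ m.
  have i01 x : 0 <= \1_A x * below_weight t m x <= 1.
    have /andP[w0 w1] := below_weight_bound t m x.
    by rewrite indicE; case: (_ \in _); rewrite ?mul1r ?mul0r ?w0 ?lexx ?ler01.
  apply/andP; split; first by apply: Ex_ge0 => x; case/andP: (i01 x).
  rewrite -(Ex_cst P 1); apply: ler_Ex => [||x]; [bmt|bmt|].
  by case/andP: (i01 x).
have sf : subgradient f q D.
  move=> m m' m0 mD m'0 m'D; have bQm := bQ m; have bSm := bS m m m0.
  have bSm' := bS m m' m'0.
  rewrite /f optimal_stopping// -ExZ; last bmt.
  rewrite -ExD; [|bmt|bmt].
  rewrite (_ : (fun x => _) = (fun x => \1_A x * stop_payoff (below t m) t m' x)).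
    by apply: W_ge => //; exact: below_adapted.
  by apply/funext => x; rewrite (below_payoff_affine _ _ m0 m'0) mulrDr mulrCA.
(* Pointwise, [Num.max e m] has in [m] the subgradient given by the indicator of [e <= m]. *)
have sg : subgradient g q D.
  move=> m m' m0 mD m'0 m'D; have bQm := bQ m; have bEm := bE m m0 mD.
  have bEm' := bE m' m'0 m'D.
  rewrite /g -ExZ; last bmt.
  rewrite -ExD; [|bmt|bmt].
  apply: ler_Ex => [||x]; [bmt|bmt|].
  rewrite mulrCA -mulrDr ler_wpM2l ?indicE// -dsumZ//; last exact: below_weight_bseq.
  have bw := below_weight_bseq t m x.
  have bm1 := env_max_bseq t x m0 mD.
  rewrite -dsumD//; last exact: bseqZ.
  apply: ler_dsum => // [||k]; [by apply: bseqD => //; exact: bseqZ|exact: env_max_bseq|].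
  case: (leP (e t k x) m) => em.
    by rewrite [X in _ + X]mulrC -mulrDr ler_wpM2l ?(ltW ob0)// subrKC le_max lexx orbT.
  by rewrite mulr0 addr0 ler_wpM2l ?(ltW ob0)// le_max lexx.
have := subgradient_unique D0 q01 sf sg.
(* At [m = D] the value of stopping is [D] and no index exceeds [D], so both sides are the
   expectation of [\1_A x * D]. *)
have -> : f D = g D.
  have bWD := bW D (ltW D0); have bED := bE D (ltW D0) (lexx D).
  apply: ae_eq_Ex; [bmt|bmt|].
  apply: filterS3 (ae_W t (ltW D0)) (V_le_cst t (lexx D)) (V_ge_cst t (ltW D0)).
  move=> x <- VD DV; congr (_ * _).
  have -> : V t D x = D by apply/eqP; rewrite eq_le VD DV.
  rewrite -[LHS](dsum_cst b0 b1); congr dsum; apply/funext => k; congr (_ * _).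
  by rewrite max_r//; case/andP: (env_index_bound t k x).
move=> /addrI /oppr_inj.
rewrite /f optimal_stopping// /g => eq0.
(* At [m = 0] the rule never stops, because the index is positive. *)
transitivity (Ex (fun x => \1_A x * stop_payoff (below t 0) t 0 x)).
  congr Ex; apply/funext => x; congr (_ * dsum _ _); apply/funext => k.
  by rewrite in_below leNgt; case/andP: (env_index_bound t k x) => ->.
rewrite eq0; congr Ex; apply/funext => x; congr (_ * dsum _ _); apply/funext => k.
by rewrite max_l//; case/andP: (env_index_bound t k x) => /ltW.
Qed.

(* The discounted excess, from local time s + j on, of the rewards over the
   decreasing rewards built from the envelope started at s. *)
Definition excess s j x :=
  dsum b (fun k => h (s + j + k).+1 x - (1 - b) * e s (j + k) x).

Lemma excess_term_bound s j k x :
  `|h (s + j + k).+1 x - (1 - b) * e s (j + k) x| <= C.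
Proof.
have /andP[e0 eD] := env_index_bound s (j + k) x.
have := h0 (s + j + k) x; have := hC (s + j + k) x.
have : (1 - b) * e s (j + k) x <= C by rewrite -DC ler_wpM2l // ltW.
have : 0 <= (1 - b) * e s (j + k) x by rewrite mulr_ge0 ?ltW.
rewrite ler_norml; lra.
Qed.

Lemma bm_excess s j : bmT (excess s j).
Proof.
apply: bm_dsum => //; first exact: sub_sigmaT.
  move=> k; have [] // : bmT (fun x => h (s + j + k).+1 x - (1 - b) * e s (j + k) x).
  have ? := bm_envT s (j + k); have ? := bm_weak (sG (s + j + k)) (bm_h (s + j + k)).
  by bmt.
by exists C => k x; exact: excess_term_bound.
Qed.

Lemma env_bseq t j x : bseq (fun k => (1 - b) * e t (j + k) x).
Proof.
apply: bseqZ; exists D => k.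
by have /andP[e0 eD] := env_index_bound t (j + k) x; rewrite gtr0_norm.
Qed.

Lemma reward_bseq t x : bseq (fun k => h (t + k).+1 x).
Proof. by exists C => k; rewrite gtr0_norm. Qed.

Lemma excessE s j x : excess s j x =
  dsum b (fun k => h (s + j + k).+1 x) - dsum b (fun k => (1 - b) * e s (j + k) x).
Proof. by rewrite /excess dsumB//; [exact: reward_bseq|exact: env_bseq]. Qed.

Lemma bm_dsum_reward t : bmT (fun x => dsum b (fun k => h (t + k).+1 x)).
Proof.
apply: bm_dsum => //; first exact: sub_sigmaT.
  by move=> k; case: (bm_weak (sG (t + k)) (bm_h (t + k))).
by exists C => k x; rewrite gtr0_norm.
Qed.

Lemma bm_dsum_env t j : bmT (fun x => dsum b (fun k => (1 - b) * e t (j + k) x)).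
Proof.
apply: bm_dsum => //; first exact: sub_sigmaT.
  move=> k; have [] // : bmT (fun x => (1 - b) * e t (j + k) x).
  by have ? := bm_envT t (j + k); bmt.
exists C => k x; have /andP[e0 eD] := env_index_bound t (j + k) x.
rewrite ger0_norm; last by rewrite mulr_ge0 ?(ltW ob0) ?(ltW e0).
by rewrite -DC ler_wpM2l ?(ltW ob0).
Qed.

(** [reward_env_identity] at time [s + j] involves the envelope restarted there, which dominates the
    older one by [env_add_le]. *)
Lemma excess_ge0 s j A : G (s + j) A -> 0 <= Ex (fun x => \1_A x * excess s j x).
Proof.
move=> GA.
have bA : bmT \1_A by apply: (bm_weak (sG (s + j))); exact: (bm_ind (sG (s + j))).
have b1' := bm_dsum_reward (s + j); have b2' := bm_dsum_env s j.
have b3' := bm_dsum_env (s + j) 0.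
rewrite (_ : (fun x => _) = (fun x => \1_A x * dsum b (fun k => h (s + j + k).+1 x) -
   \1_A x * dsum b (fun k => (1 - b) * e s (j + k) x))); last first.
  by apply/funext => x; rewrite excessE mulrBr.
rewrite ExB; [|bmt|bmt].
rewrite reward_env_identity// subr_ge0; apply: ler_Ex => [||x]; [bmt|bmt|].
rewrite ler_wpM2l ?indicE//; apply: ler_dsum => // [||k].
- exact: env_bseq.
- exact: (env_bseq (s + j) 0).
- by rewrite ler_wpM2l ?(ltW ob0)// env_add_le.
Qed.

Lemma excess_eq0 s j A : G (s + j) A ->
  (forall x, A x -> gittins_index (s + j) x <= e s j x) ->
  Ex (fun x => \1_A x * excess s j x) = 0.
Proof.
move=> GA Aie.
have bA : bmT \1_A by apply: (bm_weak (sG (s + j))); exact: (bm_ind (sG (s + j))).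
have b1' := bm_dsum_reward (s + j); have b2' := bm_dsum_env s j.
rewrite (_ : (fun x => _) = (fun x => \1_A x * dsum b (fun k => h (s + j + k).+1 x) -
   \1_A x * dsum b (fun k => (1 - b) * e s (j + k) x))); last first.
  by apply/funext => x; rewrite excessE mulrBr.
rewrite ExB; [|bmt|bmt].
rewrite reward_env_identity//; apply/eqP; rewrite subr_eq0; apply/eqP; congr Ex.
apply/funext => x; rewrite indicE; case: (boolP (x \in A)) => [/set_mem Ax|_].
  congr (_ * dsum _ _); apply/funext => k.
  by rewrite (@env_add_eq _ (gittins_index^~ x) s j k (Aie _ Ax)).
by rewrite !mul0r.
Qed.

End Project.

(** * Passing to a larger sigma-algebra by conditional independence *)

Section TransferByIndependence.
Context {R : realType} {d0 : measure_display} {Omega : measurableType d0}.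
Variable P : probability Omega R.
Variables (G1 H : set (set Omega)) (b K : R) (X : Omega -> R).
Local Notation bmT := (@bm R d0 Omega (@measurable d0 Omega)).
Local Notation Ex := (Ex P).
Hypotheses (b0 : 0 < b) (b1 : b < 1).
Hypotheses (s1 : sub_sigma G1) (sH : sub_sigma H).
Hypothesis bX : bmT X.
Hypothesis approxX : forall n, exists G2 z,
  [/\ sub_sigma G2, cond_indep P G1 G2 H, bm G2 z &
      forall x, `|X x - z x| <= b ^+ n * K].

(** [cond_indep_Ex] for a uniform limit of functions, each with its own sigma-algebra [G2]. The
    passage to the limit works because [y] depends on [B] and [H] alone. *)
Lemma cond_indep_approx B : G1 B -> exists y,
  [/\ bm H y, (forall x, 0 <= y x <= 1),
      (forall A, H A -> Ex (fun x => \1_A x * y x) = Ex (fun x => \1_A x * \1_B x)) &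
      Ex (fun x => \1_B x * X x) = Ex (fun x => y x * X x)].
Proof.
move=> GB; have bB : bmT \1_B by apply: (bm_weak s1); exact: (bm_ind s1).
have ind01 x : (0 : R) <= \1_B x <= (1 : R).
  by rewrite indicE; case: (_ \in _); rewrite ?lexx ?ler01.
have [y [by_ y01 yE]] := cond_exp_exists P sH bB ind01.
exists y; split => //; have byT := bm_weak sH by_.
have bound w n z : bmT w -> (forall x, 0 <= w x <= 1) -> bmT z ->
    (forall x, `|X x - z x| <= b ^+ n * K) ->
    `|Ex (fun x => w x * X x) - Ex (fun x => w x * z x)| <= b ^+ n * K.
  move=> bw w01 bz Xz; rewrite -ExB; [|bmt|bmt].
  apply: Ex_bound => [|x]; first bmt.
  have /andP[w0 w1] := w01 x; rewrite -mulrBr normrM (ger0_norm w0).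
  by apply: le_trans (Xz x); rewrite ler_piMl.
apply/eqP; rewrite -subr_eq0 -normr_eq0 eq_le normr_ge0 andbT.
apply: (@eq0_le_geo _ b b0 b1 _ (K + K)) => n.
have [G2 [z [s2 ci bz Xz]]] := approxX n; have bzT := bm_weak s2 bz.
have E1 := bound _ _ _ bB ind01 bzT Xz.
have E2 := bound _ _ _ byT y01 bzT Xz.
rewrite (cond_indep_Ex s1 s2 sH ci GB by_ y01 yE bz) in E1.
move: E1 E2; rewrite mulrDr !ler_norml => /andP[? ?] /andP[? ?].
by apply/andP; split; lra.
Qed.

Lemma cond_indep_ge0 B : (forall A, H A -> 0 <= Ex (fun x => \1_A x * X x)) ->
  G1 B -> 0 <= Ex (fun x => \1_B x * X x).
Proof.
move=> X0 GB; have [y [by_ y01 yE ->]] := cond_indep_approx GB.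
by apply: (Ex_mul_ge0 sH) => // x; case/andP: (y01 x).
Qed.

(** The expectations are known to vanish only inside [I]. As [B] is contained in the event [I] of
    [H], the conditional probability [y] of [B] carries no mass off [I], and only [\1_I x * X x]
    remains to be tested. *)
Lemma cond_indep_eq0 B I : H I ->
  (forall A, H A -> A `<=` I -> Ex (fun x => \1_A x * X x) = 0) ->
  G1 B -> B `<=` I -> Ex (fun x => \1_B x * X x) = 0.
Proof.
move=> HI X0 GB BI; have [y [by_ y01 yE ->]] := cond_indep_approx GB.
have bI A : H A -> bmT \1_A by move=> HA; apply: (bm_weak sH); exact: (bm_ind sH).
have HCI : H (~` I) by exact: (subsigC sH).
have bi := bI _ HI; have bci := bI _ HCI; have byT := bm_weak sH by_.
rewrite (_ : (fun x => _) = (fun x => y x * (\1_I x * X x) + \1_(~` I) x * y x * X x)); last first.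
  apply/funext => x; rewrite !indicE in_setC; case: (_ \in _) => /=.
    by rewrite !mul0r !mul1r addr0.
  by rewrite mul0r mulr0 !mul1r add0r.
rewrite ExD; [|bmt|bmt].
rewrite (Ex_mul_eq0 sH) ?add0r//; first last.
- move=> A HA; rewrite -[RHS](X0 (A `&` I)); [|exact: (subsigI sH)|exact: subIsetr].
  by congr Ex; apply/funext => x; rewrite indicI mulrA.
- by bmt.
have [L XL] := proj2 bX.
have L0 : 0 <= L := le_trans (normr_ge0 _) (XL point).
have yC : Ex (fun x => \1_(~` I) x * y x) = 0.
  rewrite yE// -[RHS](Ex_cst P 0); congr Ex; apply/funext => x.
  rewrite !indicE in_setC; case: (boolP (x \in B)) => [/set_mem/BI xI|_].
    by rewrite mem_set//= mul0r.
  by rewrite mulr0.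
apply/eqP; rewrite eq_le; apply/andP; split.
  apply: (@le_trans _ _ (Ex (fun x => L * (\1_(~` I) x * y x)))); last by rewrite ExZ ?yC ?mulr0//; bmt.
  apply: ler_Ex => [||x]; [bmt|bmt|].
  rewrite mulrC ler_wpM2r ?mulr_ge0 ?indicE//; first by case/andP: (y01 x).
  by apply: le_trans (XL x); exact: ler_norm.
apply: (@le_trans _ _ (Ex (fun x => - L * (\1_(~` I) x * y x)))); first by rewrite ExZ ?yC ?mulr0//; bmt.
apply: ler_Ex => [||x]; [bmt|bmt|].
rewrite [leRHS]mulrC ler_wpM2r ?mulr_ge0 ?indicE//; first by case/andP: (y01 x).
by have := XL x; rewrite ler_norml => /andP[].
Qed.

End TransferByIndependence.

(** * The greedy allocation along a path *)

Section HittingIndex.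
Context {R : realType}.
Implicit Types (e : nat -> R) (k : nat) (m : R).

Definition hit e m : \bar R :=
  ereal_inf [set k%:R%:E | k in [set k | e k <= m]].

Lemma hit_le e k m : e k <= m -> (hit e m <= k%:R%:E)%E.
Proof. by move=> ekm; apply: ereal_inf_lbound; exists k. Qed.

Lemma hit_ge e k m : (forall k', (k' < k)%N -> m < e k') -> (k%:R%:E <= hit e m)%E.
Proof.
move=> H; apply: le_ereal_inf_tmp => _ [k' /= ek' <-].
by rewrite lee_fin ler_nat leqNgt; apply/negP => /H; rewrite ltNge ek'.
Qed.

Lemma hit_eq e k m : e k <= m -> (forall k', (k' < k)%N -> m < e k') ->
  hit e m = k%:R%:E.
Proof. by move=> ek H; apply/eqP; rewrite eq_le hit_le// hit_ge. Qed.

Lemma hit_ge0 e m : (0 <= hit e m)%E.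
Proof. exact: (@hit_ge e 0). Qed.

Lemma hit_oo e m : (forall k, m < e k) -> hit e m = +oo%E.
Proof.
move=> H; rewrite /hit (_ : [set k | _] = set0) ?image_set0 ?ereal_inf0//.
by apply/seteqP; split => // k /=; rewrite leNgt H.
Qed.

Lemma hit_cases e m :
  (exists k, e k <= m /\ forall k', (k' < k)%N -> m < e k') \/ forall k, m < e k.
Proof.
have [[k ek]|ne] := pselect (exists k, e k <= m).
  left; have ex : exists k, e k <= m by exists k.
  exists (ex_minn ex); case: ex_minnP => k0 ek0 mink; split=> // k' k'k0.
  by rewrite ltNge; apply/negP => /mink; rewrite leqNgt k'k0.
by right => k; rewrite ltNge; apply/negP => ek; apply: ne; exists k.
Qed.

(** For [m] between [e k] and [N], the first value at most [m] is the first one strictly below [N].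
    The hitting index is thus constant on the left of [N], and its left limit is attained. *)
Lemma lim_hit_left (e : nat -> R) (N c : R) k : 0 < N ->
  (forall j k, (j <= k)%N -> e k <= e j) -> e k < N ->
  (forall k', (k' < k)%N -> N <= e k') ->
  \forall m \near N^'-, c%:E + hit e m = c%:E + k%:R%:E :> \bar R.
Proof.
move=> N0 ne ekN H.
have : \forall m \near N^'-, e k < m by exact: nbhs_left_gt.
have : \forall m \near N^'-, m < N by exact: nbhs_left_lt.
apply: filterS2 => m mN ekm; rewrite (@hit_eq _ k)//; first exact: ltW.
by move=> k' /H; exact: lt_le_trans.
Qed.

Lemma lim_hit_left_oo (e : nat -> R) (N c : R) : (forall k, N <= e k) ->
  \forall m \near N^'-, (c%:E + hit e m = +oo)%E.
Proof.
move=> H; have : \forall m \near N^'-, m < N by exact: nbhs_left_lt.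
by apply: filterS => m mN; rewrite hit_oo// => k; exact: lt_le_trans (H k).
Qed.

(** As [N] is nonincreasing, [m < N t] says that [t] precedes the hitting index; the right side is a
    truncated geometric sum. *)
Lemma epow_hit (b : R) (N : nat -> R) m : 0 < b -> b < 1 ->
  (forall j k, (j <= k)%N -> N k <= N j) ->
  (1 - epow b (hit N m) =
   \sum_(t <oo) (((1 - b) * b ^+ t) * (m < N t)%R%:R)%:E)%E.
Proof.
move=> b0 b1 nN.
have bs (f : nat -> bool) : bseq (fun t => (1 - b) * (f t)%:R).
  by exists (1 - b) => t; case: (f t); rewrite ?mulr1 ?mulr0 ?normr0 ?ger0_norm ?subr_ge0// ltW.
rewrite (_ : (\sum_(_ <oo) _)%E = (dsum b (fun t => (1 - b) * (m < N t)%R%:R))%:E); last first.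
  rewrite -eseries_dsum//; apply: eq_eseriesr => t _.
  by rewrite mulrCA mulrA.
have [[k [Nk mk]]|mN] := hit_cases N m.
  rewrite (hit_eq Nk mk) /epow powR_mulrn ?(ltW b0)// -EFinB; congr EFin.
  have {1}-> : 1 = dsum b (fun=> (1 - b) * 1) by rewrite dsum_cst.
  rewrite (dsum_split b0 b1 k); last exact: bseq_cst.
  rewrite dsum_cst// !mulr1 addrK [RHS](dsum_split b0 b1 k)//.
  rewrite (_ : (fun _ => _ * _) = (fun=> 0)).
    rewrite dsum0// mulr0 addr0; apply: eq_bigr => t _.
    by rewrite mk//= mulr1.
  apply/funext => t; rewrite ltNge (le_trans _ Nk) ?mulr0//.
  by apply: nN; exact: leq_addr.
rewrite hit_oo// /epow sube0; congr EFin; rewrite -[LHS](dsum_cst b0 b1).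
by congr dsum; apply/funext => t; rewrite mN.
Qed.

End HittingIndex.

Section Greedy.
Context {R : realType} {d : nat}.
Variables (i0 : 'I_d) (e : 'I_d -> nat -> R).
Hypothesis e_noninc : forall i j k, (j <= k)%N -> e i k <= e i j.
Implicit Types (c : 'I_d -> nat) (i j p : 'I_d) (t k n : nat).

(** Ties go to the smallest project index: this is the order in which [Tstar_val] moves projects
    from [sigma_] to [sigma_minus]. *)
Definition leader c j :=
  (forall i, e i (c i) <= e j (c j)) /\ (forall i, (i < j)%N -> e i (c i) < e j (c j)).

Definition greedy_choice c : 'I_d :=
  let jmax := [arg max_(i > i0) e i (c i)]%O in
  [arg min_(j < jmax | [forall i, e i (c i) <= e j (c j)]) (j : nat)].

Lemma greedy_choiceP c : leader c (greedy_choice c).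
Proof.
rewrite /greedy_choice; set jmax := [arg max_(i > i0) _]%O.
have jm : [forall i, e i (c i) <= e jmax (c jmax)].
  by apply/forallP => i; rewrite /jmax; case: arg_maxP => // j _; apply.
case: arg_minnP => //= j /forallP mj minj; split => // i ij.
rewrite lt_neqAle mj andbT; apply/eqP => eij.
have : [forall i', e i' (c i') <= e i (c i)] by apply/forallP => i'; rewrite eij.
by move/minj; rewrite leqNgt ij.
Qed.

Lemma leader_uniq c j j' : leader c j -> leader c j' -> j = j'.
Proof.
move=> [mj sj] [mj' sj']; apply/val_inj; case: (ltngtP j j') => //= jj.
  by have := sj' _ jj; rewrite ltNge mj.
by have := sj _ jj; rewrite ltNge mj'.
Qed.

Lemma greedy_choice_eq c j : (greedy_choice c = j) <-> leader c j.
Proof.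
split=> [<-|lj]; first exact: greedy_choiceP.
exact: leader_uniq (greedy_choiceP c) lj.
Qed.

Fixpoint greedy t : 'I_d -> nat :=
  if t is t'.+1 then fun i => (greedy t' i + (i == greedy_choice (greedy t')))%N
  else fun=> 0%N.

Definition served t := greedy_choice (greedy t).

Definition level t := e (served t) (greedy t (served t)).

Lemma greedyS t i : greedy t.+1 i = (greedy t i + (i == served t))%N.
Proof. by []. Qed.

Lemma sum_greedy t : (\sum_i greedy t i)%N = t.
Proof.
elim: t => [|t IH]; first by rewrite big1.
rewrite /= big_split/= IH (bigD1 (served t))//= eqxx big1 ?addn0 ?addn1//.
by move=> i /negbTE ->.
Qed.

Lemma level_ge t i : e i (greedy t i) <= level t.
Proof. by case: (greedy_choiceP (greedy t)). Qed.

Lemma level_gt t i : (i < served t)%N -> e i (greedy t i) < level t.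
Proof. by case: (greedy_choiceP (greedy t)) => _; apply. Qed.

(** A collected value was the best offer of its round, strictly better than the offers of smaller
    project index, and offers only decrease afterwards. *)
Lemma greedy_played t i k j : (k < greedy t i)%N ->
  e j (greedy t j) <= e i k /\ ((j < i)%N -> e j (greedy t j) < e i k).
Proof.
elim: t => // t IH; rewrite !greedyS => kg.
have ej : e j (greedy t j + (j == served t))%N <= e j (greedy t j).
  by apply: e_noninc; exact: leq_addr.
have [kt|tk] := ltnP k (greedy t i).
  by have [h1 h2] := IH kt; split => [|/h2]; [exact: le_trans h1|exact: le_lt_trans].
have [ip|ip] := eqVneq i (served t); last first.
  by move: kg; rewrite (negbTE ip) addn0 ltnNge tk.
have -> : k = greedy t i by move: kg tk; rewrite ip eqxx; lia.
rewrite ip; split; first exact: le_trans (level_ge t j).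
by move=> jp; apply: le_lt_trans (level_gt jp).
Qed.

Lemma level_le_played t i k : (k < greedy t i)%N -> level t <= e i k.
Proof. by move=> kt; case: (greedy_played (served t) kt). Qed.

Lemma level_noninc t u : (t <= u)%N -> level u <= level t.
Proof.
move=> /subnK <-; elim: (u - t)%N => [|n IH]; first by rewrite add0n.
apply: le_trans IH; rewrite addSn.
apply: le_trans (level_ge (n + t) (served (n + t).+1)).
by apply: e_noninc; rewrite greedyS leq_addr.
Qed.

Lemma sum_hit_le t m : level t <= m -> (\sum_i hit (e i) m <= t%:R%:E)%E.
Proof.
move=> lm; rewrite -{1}(sum_greedy t) natr_sum -sumEFin; apply: lee_sum => i _.
by apply: hit_le; exact: le_trans (level_ge t i) lm.
Qed.

(** The [t + 1] values collected in rounds 0 to [t] are all at least [level t], hence above [m]. *)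
Lemma sum_hit_ge t m : m < level t -> (t.+1%:R%:E <= \sum_i hit (e i) m)%E.
Proof.
move=> ml.
have -> : t.+1 = (\sum_i (greedy t i + (i == served t)))%N.
  by rewrite -[LHS]sum_greedy.
rewrite natr_sum -sumEFin; apply: lee_sum => i _; apply: hit_ge => k.
have [->|ip] := eqVneq i (served t); last by rewrite addn0 => /level_le_played; exact: lt_le_trans.
rewrite addn1 ltnS leq_eqVlt => /predU1P[->//|/level_le_played]; exact: lt_le_trans.
Qed.

Lemma sum_hit m : (\sum_i hit (e i) m = hit level m)%E.
Proof.
have [[k [lk mk]]|ml] := hit_cases level m.
  rewrite (hit_eq lk mk); apply/eqP; rewrite eq_le sum_hit_le//=.
  case: k {lk} mk => [|k] mk; first by apply: sume_ge0 => i _; exact: hit_ge0.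
  exact: sum_hit_ge (mk k _).
rewrite (hit_oo ml); apply/eqyP => r r0.
apply: le_trans (sum_hit_ge (ml (Num.trunc r))).
by rewrite lee_fin ltW// truncnS_gt.
Qed.

Lemma ereal_inf_level t : (forall k, 0 < level k) ->
  ereal_inf [set m%:E | m in [set m : R | (0 <= m)%R /\ (\sum_i hit (e i) m <= t%:R%:E)%E]]
  = (level t)%:E.
Proof.
move=> l0; apply/eqP; rewrite eq_le; apply/andP; split.
  apply: ereal_inf_lbound; exists (level t) => //=; split; first exact: ltW.
  exact: sum_hit_le.
apply: le_ereal_inf_tmp => _ [m /= [m0 hm] <-]; rewrite lee_fin leNgt.
apply/negP => /sum_hit_ge h; have := le_trans h hm.
by rewrite lee_fin ler_nat ltnn.
Qed.

Section Exchange.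
Variable j : nat -> 'I_d.

Definition plays t i := (\sum_(u < t) (j u == i))%N.

Lemma playsS t i : plays t.+1 i = (plays t i + (j t == i))%N.
Proof. by rewrite /plays big_ord_recr. Qed.

Lemma sum_plays t : (\sum_i plays t i)%N = t.
Proof.
elim: t => [|t IH]; first by rewrite big1// => i _; rewrite /plays big_ord0.
under eq_bigr do rewrite playsS.
rewrite big_split/= IH (bigD1 (j t))//= eqxx big1 ?addn0 ?addn1//.
by move=> i; rewrite eq_sym => /negbTE ->.
Qed.

Lemma sum_path_values t :
  \sum_(u < t) e (j u) (plays u (j u)) = \sum_i \sum_(k < plays t i) e i k.
Proof.
elim: t => [|t IH].
  by rewrite big_ord0 big1// => i _; rewrite /plays big_ord0 big_ord0.
rewrite big_ord_recr/= IH [RHS](bigD1 (j t))//= [in LHS](bigD1 (j t))//=.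
rewrite playsS eqxx addn1 big_ord_recr/= -!addrA; congr (_ + _).
rewrite addrC; congr (_ + _); apply: eq_bigr => i /negbTE ij.
by rewrite playsS eq_sym ij addn0.
Qed.

End Exchange.

Lemma greedyE t i : greedy t i = plays served t i.
Proof.
elim: t i => [|t IH] i; first by rewrite /plays big_ord0.
by rewrite greedyS IH playsS eq_sym.
Qed.

Lemma greedy_sum_max (j : nat -> 'I_d) n :
  \sum_(u < n) e (j u) (plays j u (j u)) <= \sum_(u < n) level u.
Proof.
have -> : \sum_(u < n) level u = \sum_(u < n) e (served u) (plays served u (served u)).
  by apply: eq_bigr => u _; rewrite /level greedyE.
rewrite !sum_path_values -subr_ge0.
(* Both paths make [n] plays, so each may be charged the price [level n] per play at no net cost.
   The comparison then splits over the projects: surplus plays of the greedy path are worth at least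
   the price, surplus plays of [j] at most the price. *)
have mn : level n * (\sum_i plays served n i)%:R - level n * (\sum_i plays j n i)%:R = 0.
  by rewrite !sum_plays subrr.
rewrite -[leRHS]subr0 -[X in _ - X]mn !natr_sum !mulr_sumr -!sumrB.
apply: sumr_ge0 => i _.
set c := plays j n i; rewrite -greedyE; set g := greedy n i.
have [cg|gc] := leqP c g.
  rewrite -(subnKC cg) big_split_ord/= natrD mulrDr.
  set A := \sum_(k < c) _; set B := \sum_(k < _) _.
  suff : level n * (g - c)%:R <= B by lra.
  rewrite mulr_natr -[X in _ *+ X]card_ord -sumr_const; apply: ler_sum => k _.
  by apply: level_le_played; rewrite -ltn_subRL.
rewrite -(subnKC (ltnW gc)) big_split_ord/= natrD mulrDr.
set A := \sum_(k < g) _; set B := \sum_(k < _) _.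
suff : B <= level n * (c - g)%:R by lra.
rewrite mulr_natr -[X in _ *+ X]card_ord -sumr_const; apply: ler_sum => k _.
apply: le_trans (level_ge n i); apply: e_noninc; exact: leq_addr.
Qed.

End Greedy.

(** * From partial sums to discounted sums *)

Section AbelComparison.
Context {R : realType} (b : R).
Hypotheses (b0 : 0 < b) (b1 : b < 1).

(** Abel summation: the weights [b ^+ t] are positive and decreasing, so nonnegative partial sums
    stay nonnegative after discounting. *)
Lemma ler_dsum_partial (r u : nat -> R) : bseq r -> bseq u ->
  (forall n, \sum_(t < n) r t <= \sum_(t < n) u t) -> dsum b r <= dsum b u.
Proof.
move=> br bu ru; rewrite -subr_ge0 -dsumB//.
pose w t := u t - r t; pose U n := \sum_(t < n) w t.
have U0 n : 0 <= U n by rewrite /U /w sumrB subr_ge0.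
have abel n : \sum_(t < n) b ^+ t * w t =
    b ^+ n * U n + \sum_(t < n) (b ^+ t - b ^+ t.+1) * U t.+1.
  elim: n => [|n IH]; first by rewrite /U !big_ord0 mulr0 addr0.
  rewrite !big_ord_recr/= IH /U big_ord_recr/= exprS.
  by set s := \sum_(t < n) (_ * _); ring.
have S0 n : 0 <= \sum_(t < n) b ^+ t * w t.
  rewrite abel addr_ge0 ?mulr_ge0 ?exprn_ge0 ?(ltW b0)//.
  apply: sumr_ge0 => t _; rewrite mulr_ge0// subr_ge0 exprS ler_piMl//.
    by rewrite exprn_ge0 ?ltW.
  exact: ltW.
have bw : bseq w by exact: bseqB.
have [K wK] := bw.
rewrite -oppr_le0; apply: (@eq0_le_geo _ b b0 b1 _ (K / (1 - b))) => n.
have := dsum_trunc b0 b1 n wK; rewrite ler_norml => /andP[+ _].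
have := S0 n; rewrite /w; lra.
Qed.

End AbelComparison.

Section GreedyRecords.
Context {R : realType} {d : nat}.
Variables (i0 : 'I_d) (M : 'I_d -> nat -> R) (s : 'I_d -> nat).
Let e i := env (M i) (s i).

Let e_noninc i j k : (j <= k)%N -> e i k <= e i j.
Proof. exact: env_noninc. Qed.

(* A project that is not being served has just reached a new minimum of its
   index: otherwise its envelope would not have dropped and it would still lead. *)
Lemma idle_record t i : i != served i0 e t ->
  M i (s i + greedy i0 e t i)%N <= e i (greedy i0 e t i).
Proof.
elim: t i => [|t IH] i ip; first by rewrite /= addn0.
rewrite greedyS; have [ip'|ip'] := eqVneq i (served i0 e t); last first.
  by rewrite addn0; exact: IH.
set g := greedy i0 e t i; rewrite addn1.
have [Mle|lt_M] := leP (M i (s i + g.+1)%N) (e i g).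
  by rewrite /e /= le_min Mle lexx.
have eg : e i g.+1 = e i g by rewrite {1}/e /= -/(e i g) min_l// ltW.
case/eqP: ip; apply/esym/greedy_choice_eq; split => j; rewrite !greedyS.
  rewrite ip' eqxx addn1 -ip' -/g eg ip' /g ip' -/(level i0 e t).
  apply: le_trans (level_ge i0 e t j); apply: e_noninc; exact: leq_addr.
move=> ji; rewrite ip' eqxx addn1 -ip' -/g eg ip' /g ip' -/(level i0 e t).
apply: le_lt_trans (level_gt (_ : (j < served i0 e t)%N)); last by rewrite -ip'.
by apply: e_noninc; exact: leq_addr.
Qed.

End GreedyRecords.

Lemma big_minn_le (I : finType) (Q : pred I) (m : nat) (i : I) (f : I -> nat) :
  Q i -> (\big[minn/m]_(k | Q k) f k <= f i)%N.
Proof.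
rewrite unlock /reducebig; have := mem_index_enum i.
elim: (index_enum I) => //= a r IH; rewrite inE => /predU1P[<-|ir] Qi.
  by rewrite Qi geq_minl.
by case: (Q a); rewrite ?(leq_trans (geq_minr _ _))// IH.
Qed.

(** * The closed formula for the strategy describes the greedy allocation *)

Section GreedyFormula.
Context {R : realType} {d0 : measure_display} {Omega : measurableType d0} {d : nat}.
Variables (V : 'I_d -> nat -> R -> Omega -> R) (s : mindex d) (x : Omega).
Variables (i0 : 'I_d) (e : 'I_d -> nat -> R) (t : nat).
Hypothesis e_noninc : forall i j k, (j <= k)%N -> e i k <= e i j.
Hypothesis sigmaE : forall i m, 0 <= m ->
  sigma_ V i (s i) m x = ((s i)%:R%:E + hit (e i) m)%E.
Hypothesis NtE : Nt V s t x = (level i0 e t)%:E.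
Hypothesis level_gt0 : 0 < level i0 e t.

Local Notation N := (level i0 e t).
Local Notation g := (greedy i0 e t).
Local Notation p := (served i0 e t).

Let near_sigma i (v : \bar R) :
  (\forall m \near N^'-, ((s i)%:R%:E + hit (e i) m)%E = v) ->
  sigma_minus V i (s i) N x = v.
Proof.
move=> H; apply: lim_near_cst => //.
have : \forall m \near N^'-, 0 < m by exact: nbhs_left_gt.
by apply: filterS2 H => m <- m0; rewrite sigmaE// ltW.
Qed.

Lemma sigma_minus_fin i k : e i k < N -> (forall k', (k' < k)%N -> N <= e i k') ->
  sigma_minus V i (s i) N x = (s i + k)%:R%:E.
Proof.
move=> eN H; rewrite natrD EFinD; apply: near_sigma.
exact: lim_hit_left level_gt0 (e_noninc i) eN H.
Qed.

Lemma sigma_minus_ge i k : (forall k', (k' < k)%N -> N <= e i k') ->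
  (k%:R%:E <= sigma_minus V i (s i) N x - (s i)%:R%:E)%E.
Proof.
move=> H; have [[k1 [ek1 H1]]|H1] :
    (exists k1, e i k1 < N /\ forall k', (k' < k1)%N -> N <= e i k') \/ forall k, N <= e i k.
  have [[k1 ek1]|ne] := pselect (exists k1, e i k1 < N); last first.
    by right => k1; rewrite leNgt; apply/negP => ek; apply: ne; exists k1.
  left; have ex : exists k1, e i k1 < N by exists k1.
  exists (ex_minn ex); case: ex_minnP => k2 ek2 mink; split=> // k' k'k2.
  by rewrite leNgt; apply/negP => /mink; rewrite leqNgt k'k2.
  rewrite (sigma_minus_fin ek1 H1) -EFinB lee_fin natrD [_ + k1%:R]addrC addrK ler_nat.
  by rewrite leqNgt; apply/negP => /H; rewrite leNgt ek1.
rewrite (near_sigma (lim_hit_left_oo _ H1)).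
by rewrite addye// leey.
Qed.

Let hitE i : (sigma_ V i (s i) N x - (s i)%:R%:E = hit (e i) N)%E.
Proof. by rewrite sigmaE ?(ltW level_gt0)// addeAC -EFinB subrr add0e. Qed.

Let hit_le_g i : (hit (e i) N <= (g i)%:R%:E)%E.
Proof. by apply: hit_le; exact: level_ge. Qed.

(** The tie-break decides which limit applies. Projects after [p] have collected only values
    strictly above [N] and stand at [sigma_]; projects before [p] now offer strictly less than [N]
    and stand at [sigma_minus]. *)
Let hit_after (i : 'I_d) : (p < i)%N -> hit (e i) N = (g i)%:R%:E.
Proof.
move=> pi; apply: hit_eq; first exact: level_ge.
by move=> k kg; case: (greedy_played e_noninc p kg) => _; apply.
Qed.

Let sigma_minus_before (i : 'I_d) : (i < p)%N -> sigma_minus V i (s i) N x = (s i + g i)%:R%:E.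
Proof.
move=> ip; apply: sigma_minus_fin; first exact: level_gt.
by move=> k; exact: level_le_played.
Qed.

Let ycoordE (i : nat) : (ycoord V s i t x = \sum_(j < d)
  (if (j < i)%N then sigma_minus V j (s j) N x - (s j)%:R%:E else hit (e j) N))%E.
Proof.
rewrite /ycoord NtE/= [RHS](bigID (fun j : 'I_d => (j < i)%N))/=; congr (_ + _)%E.
  by apply: eq_bigr => j ->.
under eq_bigl do rewrite leqNgt.
by apply: eq_bigr => j /negbTE ->; exact: hitE.
Qed.

Lemma kidx_served : kidx V s t x = p :> nat.
Proof.
(* The play of round [t] is counted as well: its value is [N], so [sigma_minus] of project [p] lies
   beyond it, and the total is at least [t + 1]. *)
have Pp : ((t%:R)%:E < ycoord V s p.+1 t x)%E.
  apply: (@lt_le_trans _ _ (t.+1%:R%:E)); first by rewrite lte_fin ltr_nat.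
  have -> : t.+1 = (\sum_i (g i + (i == p)))%N by rewrite -[LHS](sum_greedy i0 e).
  rewrite ycoordE natr_sum -sumEFin; apply: lee_sum => i _; case: ifPn => ip.
    apply: sigma_minus_ge => k; have [->|ip'] := eqVneq i p; last first.
      by rewrite addn0; exact: level_le_played.
    rewrite addn1 ltnS leq_eqVlt => /predU1P[->//|]; exact: level_le_played.
  rewrite ltnS -ltnNge in ip; rewrite (hit_after ip) (_ : (i == p) = false) ?addn0//.
  by rewrite -val_eqE/= gtn_eqF.
have nP (i : 'I_d) : (i < p)%N -> (ycoord V s i.+1 t x <= t%:R%:E)%E.
  move=> ip; apply: (@le_trans _ _ ((\sum_i g i)%N%:R%:E)); last by rewrite sum_greedy.
  rewrite ycoordE natr_sum -sumEFin.
  apply: lee_sum => j _; case: ifP => ji; last exact: hit_le_g.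
  rewrite sigma_minus_before; last by apply: leq_ltn_trans ip; rewrite -ltnS.
  by rewrite -EFinB lee_fin natrD [_ + (g j)%:R]addrC addrK.
apply/eqP; rewrite eqn_leq; apply/andP; split.
  exact: (@big_minn_le 'I_d (fun i => (t%:R%:E < ycoord V s i.+1 t x)%E) d p (@nat_of_ord d)).
apply: (big_ind (fun k => p <= k)%N) => [|a b' pa pb|i ti]; first exact: ltnW.
  by rewrite leq_min pa.
by rewrite leqNgt; apply/negP => /nP; rewrite leNgt ti.
Qed.

Lemma Tstar_val_greedy i : Tstar_val V s t x i = (s i + g i)%:R%:E.
Proof.
rewrite /Tstar_val kidx_served NtE/=; case: ltngtP => [ip|pi|/val_inj ->].
- exact: sigma_minus_before.
- by rewrite sigmaE ?(ltW level_gt0)// hit_after// natrD EFinD.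
rewrite sigmaE ?(ltW level_gt0)// ycoordE.
(* This time may be smaller than [g p], but it occurs in both [sigma_] and [ycoord]. Being finite,
   it cancels, and [t] minus the plays of the other projects is left. *)
have [a ha] : exists a : nat, hit (e p) N = a%:R%:E.
  have [[k [ek Hk]]|H] := hit_cases (e p) N; first by exists k; exact: hit_eq.
  by have := H (g p); rewrite ltxx.
rewrite (bigD1 p)//= ltnn ha.
rewrite (eq_bigr (fun j => (g j)%:R%:E)); last first.
  move=> j jp; case: ltnP => [jp'|pj].
    by rewrite sigma_minus_before// -EFinB natrD [_ + (g j)%:R]addrC addrK.
  by rewrite hit_after// ltn_neqAle pj andbT eq_sym.
rewrite sumEFin -natr_sum -!EFinD; congr EFin.
have -> : t%:R = (g p)%:R + (\sum_(j | j != p) g j)%N%:R :> R.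
  by rewrite -natrD -[in LHS](sum_greedy i0 e t) (bigD1 p).
by rewrite !natrD; ring.
Qed.

End GreedyFormula.

(** * Allocations of several projects *)

Section ExpectedDiscountedSum.
Context {R : realType} {d0 : measure_display} {Omega : measurableType d0}.
Variables (P : probability Omega R) (b : R).
Hypotheses (b0 : 0 < b) (b1 : b < 1).
Local Notation bmT := (@bm R d0 Omega (@measurable d0 Omega)).

Lemma Ex_dsum (f : nat -> Omega -> R) K : (forall t, bmT (f t)) ->
  (forall t x, `|f t x| <= K) ->
  Ex P (fun x => dsum b (f^~ x)) = dsum b (fun t => Ex P (f t)).
Proof.
move=> bf fK; have bD : bmT (fun x => dsum b (f^~ x)).
  apply: bm_dsum => //; [exact: sub_sigmaT|by move=> k; case: (bf k)|by exists K].
have eK t : `|Ex P (f t)| <= K by exact: Ex_bound.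
apply/eqP; rewrite -subr_eq0 -normr_eq0 eq_le normr_ge0 andbT.
apply: (@eq0_le_geo _ b b0 b1 _ (K / (1 - b) + K / (1 - b))) => n.
have bS : bmT (fun x => \sum_(t < n) b ^+ t * f t x).
  by apply: bm_sum => [|t]; [exact: sub_sigmaT|have ? := bf t; bmt].
have E1 : Ex P (fun x => \sum_(t < n) b ^+ t * f t x) = \sum_(t < n) b ^+ t * Ex P (f t).
  rewrite Ex_sum; first by apply: eq_bigr => t _; rewrite ExZ.
  by move=> t; have ? := bf t; bmt.
have : `|Ex P (fun x => dsum b (f^~ x)) - \sum_(t < n) b ^+ t * Ex P (f t)|
    <= b ^+ n * (K / (1 - b)).
  rewrite -E1 -ExB//; apply: Ex_bound => [|x]; first by bmt.
  by apply: dsum_trunc => // k; exact: fK.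
have := dsum_trunc b0 b1 n eK.
rewrite mulrDr !ler_norml => /andP[? ?] /andP[? ?].
by apply/andP; split; lra.
Qed.

End ExpectedDiscountedSum.

Section Paths.
Context {R : realType} {d : nat} (b : R).
Hypotheses (b0 : 0 < b) (b1 : b < 1).

(* Summation by parts along a path: project i contributes the excess from its
   start, minus what remains of it at the times when i is idle. *)
Lemma path_excess (x X : 'I_d -> nat -> R) (j : nat -> 'I_d) :
  (forall i k, X i k = x i k + b * X i k.+1) ->
  (exists K, forall i k, `|X i k| <= K) -> (exists K, forall i k, `|x i k| <= K) ->
  dsum b (fun t => x (j t) (plays j t (j t))) =
  \sum_i (X i 0%N - dsum b (fun t => (1 - b) * ((i != j t)%:R * X i (plays j t i)))).
Proof.
move=> XS [K XK] [K' xK].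
have bI i : bseq (fun t => (i != j t)%:R * X i (plays j t i)).
  exists K => t; rewrite normrM; case: (_ != _); rewrite ?normr1 ?normr0 ?mul1r ?mul0r//.
  exact: le_trans (XK i 0%N).
(* Finite horizon version. A play of [i] moves [X i] on by [XS]; an idle period discounts what
   remains once more, and the loss is the fraction [1 - b] of it. *)
have fin i n : \sum_(t < n) b ^+ t * ((j t == i)%:R * x i (plays j t i)) =
  X i 0%N - b ^+ n * X i (plays j n i) -
  \sum_(t < n) b ^+ t * ((1 - b) * ((i != j t)%:R * X i (plays j t i))).
  elim: n => [|n IH]; first by rewrite !big_ord0 expr0 mul1r /plays big_ord0 !subr0 subrr.
  rewrite !big_ord_recr/= IH playsS eq_sym; case: eqVneq => _ /=.
    rewrite addn1 (XS i (plays j n i)) exprS !mul1r !mul0r !mulr0 addr0.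
    by set S := \sum_(t < n) _; ring.
  rewrite addn0 exprS !mul0r !mul1r mulr0 addr0.
  by set S := \sum_(t < n) _; ring.
have bP i : bseq (fun t => (j t == i)%:R * x i (plays j t i)).
  exists K' => t; rewrite normrM; case: (_ == _); rewrite ?normr1 ?normr0 ?mul1r ?mul0r//.
  exact: le_trans (xK i 0%N).
have each i : dsum b (fun t => (j t == i)%:R * x i (plays j t i)) =
    X i 0%N - dsum b (fun t => (1 - b) * ((i != j t)%:R * X i (plays j t i))).
  apply/eqP; rewrite -subr_eq0 -normr_eq0 eq_le normr_ge0 andbT.
  have bJ := bseqZ (1 - b) (bI i).
  have [K1 h1] := bP i; have [K2 h2] := bJ.
  apply: (@eq0_le_geo _ b b0 b1 _ (K1 / (1 - b) + K2 / (1 - b) + K)) => n.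
  have := dsum_trunc b0 b1 n h1; have := dsum_trunc b0 b1 n h2.
  rewrite fin; have : `|b ^+ n * X i (plays j n i)| <= b ^+ n * K.
    by rewrite normrM ger0_norm ?exprn_ge0 ?(ltW b0)// ler_wpM2l ?exprn_ge0 ?(ltW b0).
  rewrite !mulrDr !ler_norml => /andP[? ?] /andP[? ?] /andP[? ?].
  by apply/andP; split; lra.
under eq_bigr do rewrite -each.
have sumd (I : Type) (r : seq I) (f : I -> nat -> R) : (forall i, bseq (f i)) ->
    dsum b (fun t => \sum_(i <- r) f i t) = \sum_(i <- r) dsum b (f i) /\
    bseq (fun t => \sum_(i <- r) f i t).
  move=> bf; elim: r => [|i r [IH1 IH2]].
    rewrite big_nil (_ : (fun t => _) = (fun=> 0)) ?dsum0//; last by apply/funext => t; rewrite big_nil.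
    by split => //; exact: bseq_cst.
  rewrite big_cons -IH1 -dsumD//.
  rewrite (_ : (fun t => \sum_(i <- i :: r) f i t) = (fun t => f i t + \sum_(i <- r) f i t)).
    by split => //; exact: bseqD.
  by apply/funext => t; rewrite big_cons.
rewrite -(sumd _ _ _ bP).1; congr dsum; apply/funext => t.
rewrite (bigD1 (j t))//= eqxx mul1r big1 ?addr0// => i.
by rewrite eq_sym => /negbTE ->; rewrite mul0r.
Qed.

End Paths.

Lemma madd_unit_inj d (r : mindex d) (i j : 'I_d) :
  madd r (munit i 1) = madd r (munit j 1) -> i = j.
Proof.
move=> /(congr1 (fun f => f i)); rewrite /madd /munit eqxx.
by move=> /addnI; case: eqP.
Qed.

(** * Decomposition of an allocation according to its position and next move *)

Section Allocation.
Context {R : realType} {d0 : measure_display} {Omega : measurableType d0}.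
Variables (P : probability Omega R) (d : nat).
Variables (F : mindex d -> set (set Omega)) (s : mindex d).
Variable T : nat -> Omega -> mindex d.
Hypothesis sF : forall r, sub_sigma (F r).
Hypothesis alloc : allocation F s T.
Local Notation bmT := (@bm R d0 Omega (@measurable d0 Omega)).

Definition choice_of x t : 'I_d :=
  projT1 (cid (let: And3 _ h _ := alloc in h t x)).

Lemma choice_ofP x t : T t.+1 x = madd (T t x) (munit (choice_of x t) 1).
Proof. by rewrite /choice_of; case: cid. Qed.

Lemma allocE x t i : T t x i = (s i + plays (choice_of x) t i)%N.
Proof.
elim: t => [|t IH]; first by case: alloc => -> _ _; rewrite /plays big_ord0 addn0.
by rewrite choice_ofP /madd IH playsS addnA /munit eq_sym; case: eqP.
Qed.

Lemma plays_lt x t i : (plays (choice_of x) t i < t.+1)%N.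
Proof.
by rewrite ltnS -[leqRHS](sum_plays (choice_of x) t) (bigD1 i)//= leq_addr.
Qed.

(** After [t] plays no project is more than [t] ahead of [s], so the position ranges over a finite
    type. *)
Definition offset t (f : {ffun 'I_d -> 'I_t.+1}) : mindex d := fun i => (s i + f i)%N.

Definition move_event t j (f : {ffun 'I_d -> 'I_t.+1}) : set Omega :=
  [set x | T t.+1 x = madd (T t x) (munit j 1) /\ T t x = offset f].

Lemma move_event_meas t j f : F (offset f) (@move_event t j f).
Proof. by case: alloc => _ _; apply. Qed.

(** Trades the random position for deterministic ones, each on an event of [F (offset f)], where
    (F4) can be used. *)
Lemma alloc_decomp t (phi : 'I_d -> mindex d -> R) x :
  phi (choice_of x t) (T t x) =
  \sum_j \sum_f \1_(@move_event t j f) x * phi j (offset f).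
Proof.
pose f0 : {ffun 'I_d -> 'I_t.+1} := [ffun i => Ordinal (plays_lt x t i)].
have Tf0 : T t x = offset f0.
  by apply/funext => i; rewrite allocE /offset ffunE.
rewrite (bigD1 (choice_of x t))//= (bigD1 f0)//=.
rewrite indicE mem_set ?mul1r -?Tf0; last first.
  by split => //; exact: choice_ofP.
rewrite big1 ?addr0; last first.
  move=> f ff0; rewrite indicE memNset ?mul0r// => -[_].
  rewrite Tf0 => e; case/eqP: ff0; apply/ffunP => i; apply/val_inj.
  by have := congr1 (fun g => g i) e; rewrite /offset => /addnI.
rewrite big1 ?addr0// => j jc; rewrite big1// => f _.
rewrite indicE memNset ?mul0r// => -[e _].
by move: jc; rewrite (madd_unit_inj (etrans (esym e) (choice_ofP x t))) eqxx.
Qed.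

Lemma bm_alloc t (phi : 'I_d -> mindex d -> Omega -> R) :
  (forall j (f : {ffun 'I_d -> 'I_t.+1}), bmT (phi j (offset f))) ->
  bmT (fun x => phi (choice_of x t) (T t x) x).
Proof.
move=> bphi; rewrite (_ : (fun x => _) =
    (fun x => \sum_j \sum_f \1_(@move_event t j f) x * phi j (offset f) x)); last first.
  by apply/funext => x; rewrite (alloc_decomp t (fun j r => phi j r x)).
apply: bm_sum => [|j]; first exact: sub_sigmaT.
apply: bm_sum => [|f]; first exact: sub_sigmaT.
apply: bmM => //; first exact: sub_sigmaT.
by apply: (bm_weak (sF (offset f))); apply: bm_ind => //; exact: move_event_meas.
Qed.

Lemma Ex_alloc A t (phi : 'I_d -> mindex d -> Omega -> R) : measurable A ->
  (forall j (f : {ffun 'I_d -> 'I_t.+1}), bmT (phi j (offset f))) ->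
  Ex P (fun x => \1_A x * phi (choice_of x t) (T t x) x) =
  \sum_j \sum_f Ex P (fun x => \1_(A `&` @move_event t j f) x * phi j (offset f) x).
Proof.
move=> mA bphi.
have bt j f : bmT (fun x => \1_(A `&` @move_event t j f) x * phi j (offset f) x).
  apply: bmM => //; first exact: sub_sigmaT.
  apply: bm_ind; first exact: sub_sigmaT.
  apply: measurableI => //; apply: (proj2 (sF (offset f))); exact: move_event_meas.
transitivity (Ex P (fun x => \sum_j \sum_f \1_(A `&` @move_event t j f) x * phi j (offset f) x)).
  congr Ex; apply/funext => x; rewrite (alloc_decomp t (fun j r => phi j r x)).
  rewrite mulr_sumr; apply: eq_bigr => j _; rewrite mulr_sumr; apply: eq_bigr => f _.
  by rewrite mulrA indicI.
rewrite Ex_sum; last by move=> j; apply: bm_sum => [|f]; [exact: sub_sigmaT|].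
by apply: eq_bigr => j _; rewrite Ex_sum.
Qed.

End Allocation.

(** * Comparison of the original and the decreasing rewards over all allocations *)

Section Bandit.
Context {R : realType} {d0 : measure_display} {Omega : measurableType d0}.
Variables (P : probability Omega R) (d : nat).
Variables (F : mindex d -> set (set Omega)) (b C : R).
Variables (h : 'I_d -> nat -> Omega -> R) (V : 'I_d -> nat -> R -> Omega -> R).
Variables (M : 'I_d -> nat -> Omega -> \bar R) (s : mindex d) (i0 : 'I_d).
Local Notation bmT := (@bm R d0 Omega (@measurable d0 Omega)).
Local Notation Ex := (Ex P).
Hypotheses (b0 : 0 < b) (b1 : b < 1).
Hypothesis sF : forall r, sub_sigma (F r).
Hypothesis F1 : forall r1 r2, mle r1 r2 -> F r1 `<=` F r2.
Hypothesis F4 : forall r1 r2, cond_indep P (F r1) (F r2) (F (mmin r1 r2)).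
Hypothesis h0 : forall i t x, 0 < h i t.+1 x.
Hypothesis hC : forall i t x, h i t.+1 x <= C.
Hypothesis mh : forall i t, meas_wrt (Fi F i t) (h i t.+1).
Hypothesis essV : forall i t (m : R), 0 <= m ->
  ess_sup_of P (Fi F i t)
    [set Y | exists tau, stopping_from F i t tau /\
                         cond_exp P (Fi F i t) (gain b (h i) t m tau) Y]
    (fun x => (V i t m x)%:E).
Hypothesis contV : forall i t, {ae P, forall x,
  {within [set m : R | 0 <= m], continuous (fun m => V i t m x)}}.
Hypothesis essM : forall i t, ess_sup_of P (Fi F i t)
  [set Y | exists X : Omega -> R,
     [/\ Y = (fun x => (X x)%:E), meas_wrt (Fi F i t) X,
         (forall x, 0 < X x) & {ae P, forall x, X x < V i t (X x) x}]]
  (M i t).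

Local Notation D := (C / (1 - b)).

Let ob0 : 0 < 1 - b. Proof. by rewrite subr_gt0. Qed.
Let C0 : 0 < C. Proof. exact: lt_le_trans (h0 i0 0%N point) (hC _ _ _). Qed.
Let D0 : 0 < D. Proof. by rewrite divr_gt0. Qed.
Let DC : (1 - b) * D = C. Proof. by rewrite mulrC divfK// gt_eqF. Qed.

Let sG i t : sub_sigma (Fi F i t). Proof. exact: sF. Qed.

Let GS i t : Fi F i t `<=` Fi F i t.+1.
Proof. by apply: F1 => k; rewrite /munit; case: eqP. Qed.

Let GF i r : Fi F i (r i) `<=` F r.
Proof. by apply: F1 => k; rewrite /munit; case: eqP => // ->. Qed.

Definition idx i u x := gittins_index b C (M i) u x.

Definition lenv x i := env (idx i ^~ x) (s i).

Local Notation Xe i k := (excess b C (h i) (M i) (s i) k).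

Let lenv_noninc x i j k : (j <= k)%N -> lenv x i k <= lenv x i j.
Proof. exact: env_noninc. Qed.

Let lenv_bound x i k : 0 < lenv x i k <= D.
Proof. exact: (env_index_bound b1 (h0 i) (hC i)). Qed.

Let bm_lenv i k : bm (Fi F i (s i + k)) (fun x => lenv x i k).
Proof. exact: (bm_env b1 (sG i) (GS (i := i)) (h0 i) (hC i) (essM i)). Qed.

Let bm_idx i u : bm (Fi F i u) (idx i u).
Proof. exact: (bm_index b1 (sG i) (h0 i) (hC i) (essM i)). Qed.

Let bm_hi i t : bm (Fi F i t) (h i t.+1).
Proof. exact: (bm_h (h0 i) (hC i) (mh i)). Qed.

Let bm_Xe i k : bmT (Xe i k).
Proof. exact: (bm_excess b0 b1 (sG i) (GS (i := i)) (h0 i) (hC i) (mh i) (essM i)). Qed.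

Let mmin_unit (r : mindex d) i v : (r i <= v)%N -> mmin r (munit i v) = munit i (r i).
Proof.
move=> rv; apply/funext => k; rewrite /mmin /munit; case: eqP => [->|_].
  exact/minn_idPl.
exact: minn0.
Qed.

(** The first [n] terms are known at local time [s i + k + n]. The componentwise minimum of [r] with
    that multiple of the unit vector keeps only the coordinate [r i], so (F4) conditions on the
    single-project sigma-algebra at [r i]. *)
Let excess_approx (r : mindex d) i k : r i = (s i + k)%N -> forall n, exists G2 z,
  [/\ sub_sigma G2, cond_indep P (F r) G2 (Fi F i (r i)),
      bm G2 z & forall x, `|Xe i k x - z x| <= b ^+ n * D].
Proof.
move=> ri n; exists (Fi F i (s i + k + n)).
have FM := Fi_mono (GS (i := i)).
exists (fun x => \sum_(l < n) b ^+ l * (h i (s i + k + l).+1 x - (1 - b) * lenv x i (k + l))).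
split => //.
- have := @F4 r (munit i (s i + k + n)); rewrite mmin_unit//.
  by rewrite ri leq_addr.
- apply: bm_sum => [|l]; first exact: sG.
  have sGn := sG i (s i + k + n).
  have ? : bm (Fi F i (s i + k + n)) (h i (s i + k + l).+1).
    by apply: bm_sub (bm_hi i _); apply: FM; rewrite leq_add2l ltnW.
  have ? : bm (Fi F i (s i + k + n)) (fun x => lenv x i (k + l)).
    by apply: bm_sub (bm_lenv i _); apply: FM; rewrite addnA leq_add2l ltnW.
  by bmt.
- move=> x; apply: dsum_trunc => // l.
  exact: (excess_term_bound b1 (h0 i) (hC i)).
Qed.

Lemma excess_F_ge0 (r : mindex d) i k B : r i = (s i + k)%N -> F r B ->
  0 <= Ex (fun x => \1_B x * Xe i k x).
Proof.
move=> ri FB; apply: (cond_indep_ge0 b0 b1 (sF r) (sG i (r i)) (bm_Xe i k)) => //.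
  exact: (excess_approx ri).
move=> A; rewrite ri.
exact: (excess_ge0 b0 b1 (sG i) (GS (i := i)) (h0 i) (hC i) (mh i) (essV i) (contV i) (essM i)).
Qed.

Lemma excess_F_eq0 (r : mindex d) i k B : r i = (s i + k)%N -> F r B ->
  (forall x, B x -> idx i (s i + k) x <= lenv x i k) ->
  Ex (fun x => \1_B x * Xe i k x) = 0.
Proof.
move=> ri FB Bix.
apply: (cond_indep_eq0 b0 b1 (sF r) (sG i (r i)) (bm_Xe i k) _
  (I := [set x | idx i (s i + k) x <= lenv x i k])) => //.
- exact: (excess_approx ri).
- rewrite ri; apply: (meas_le (sG i _)); first by case: (bm_idx i (s i + k)).
  by case: (bm_lenv i k).
- move=> A; rewrite ri => GA AI.
  exact: (excess_eq0 b0 b1 (sG i) (GS (i := i)) (h0 i) (hC i) (mh i) (essV i) (contV i) (essM i)).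
Qed.

Section OneAllocation.
Variable T : nat -> Omega -> mindex d.
Hypothesis al : allocation F s T.
Local Notation jT := (choice_of al).

Definition payoff x := dsum b (fun t => h (jT x t) (T t x (jT x t)).+1 x).

Definition payoff' x :=
  dsum b (fun t => (1 - b) * lenv x (jT x t) (plays (jT x) t (jT x t))).

Lemma payoff_rate_bound x t : 0 <= h (jT x t) (T t x (jT x t)).+1 x <= C.
Proof. by rewrite hC ltW. Qed.

Lemma payoff'_rate_bound x t :
  0 <= (1 - b) * lenv x (jT x t) (plays (jT x) t (jT x t)) <= C.
Proof.
have /andP[l0 lD] := lenv_bound x (jT x t) (plays (jT x) t (jT x t)).
by rewrite mulr_ge0 ?(ltW ob0) ?(ltW l0)//= -DC ler_wpM2l ?(ltW ob0).
Qed.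

Let bseq_of (f : nat -> R) : (forall t, 0 <= f t <= C) -> bseq f.
Proof. by move=> H; exists C => t; have /andP[? ?] := H t; rewrite ger0_norm. Qed.

Let dsum_bnd (f : nat -> R) : (forall t, 0 <= f t <= C) -> 0 <= dsum b f <= D.
Proof.
move=> H; apply/andP; split.
  by apply: dsum_ge0 => // [|t]; [exact: bseq_of|case/andP: (H t)].
rewrite -[leRHS](dsum_cst b0 b1) DC; apply: ler_dsum => // [||t].
- exact: bseq_of.
- exact: bseq_cst.
- by case/andP: (H t).
Qed.

Lemma payoff_bound x : 0 <= payoff x <= D.
Proof. by apply: dsum_bnd => t; exact: payoff_rate_bound. Qed.

Lemma payoff'_bound x : 0 <= payoff' x <= D.
Proof. by apply: dsum_bnd => t; exact: payoff'_rate_bound. Qed.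

Let plays_sub x t i : plays (jT x) t i = (T t x i - s i)%N.
Proof. by rewrite (allocE al) addKn. Qed.

Lemma bm_payoff_rate t : bmT (fun x => h (jT x t) (T t x (jT x t)).+1 x).
Proof.
apply: (bm_alloc sF al (phi := fun j r x => h j (r j).+1 x)) => j f.
exact: (bm_weak (sG j _) (bm_hi j _)).
Qed.

Lemma bm_payoff'_rate t :
  bmT (fun x => (1 - b) * lenv x (jT x t) (plays (jT x) t (jT x t))).
Proof.
rewrite (_ : (fun x => _) = (fun x => (1 - b) * lenv x (jT x t) (T t x (jT x t) - s (jT x t)))).
  apply: (bm_alloc sF al (phi := fun j r x => (1 - b) * lenv x j (r j - s j))) => j f.
  have ? := bm_weak (sG j _) (bm_lenv j (offset s f j - s j)); bmt.
by apply/funext => x; rewrite plays_sub.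
Qed.

Lemma bm_payoff : bmT payoff.
Proof.
apply: bm_dsum => //; first exact: sub_sigmaT.
  by move=> t; case: (bm_payoff_rate t).
by exists C => t x; have /andP[? ?] := payoff_rate_bound x t; rewrite ger0_norm.
Qed.

Lemma bm_payoff' : bmT payoff'.
Proof.
apply: bm_dsum => //; first exact: sub_sigmaT.
  by move=> t; case: (bm_payoff'_rate t).
by exists C => t x; have /andP[? ?] := payoff'_rate_bound x t; rewrite ger0_norm.
Qed.

Definition idle i t x := (i != jT x t)%:R * Xe i (plays (jT x) t i) x.

Let Xe_bound i k x : `|Xe i k x| <= D.
Proof. by apply: dsum_bound => // l; exact: (excess_term_bound b1 (h0 i) (hC i)). Qed.

Let idle_bound i t x : `|idle i t x| <= D.
Proof.
rewrite normrM; case: (_ != _); rewrite ?normr1 ?normr0 ?mul1r ?mul0r ?(ltW D0)//.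
Qed.

Let idleE i t : idle i t = (fun x => (i != jT x t)%:R * Xe i (T t x i - s i) x).
Proof. by apply/funext => x; rewrite /idle plays_sub. Qed.

Let bm_idle_phi i (t : nat) j (f : {ffun 'I_d -> 'I_t.+1}) :
  bmT (fun x => (i != j)%:R * Xe i (offset s f i - s i) x).
Proof. have ? := bm_Xe i (offset s f i - s i); bmt. Qed.

Lemma bm_idle i t : bmT (idle i t).
Proof.
rewrite idleE.
apply: (bm_alloc sF al (phi := fun j r x => (i != j)%:R * Xe i (r i - s i) x)) => j f.
exact: bm_idle_phi.
Qed.

Lemma payoff_diff x : payoff x - payoff' x =
  \sum_i (Xe i 0%N x - dsum b (fun t => (1 - b) * idle i t x)).
Proof.
rewrite /payoff /payoff' -dsumB//; first last.
- by apply: bseq_of => t; exact: payoff'_rate_bound.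
- by apply: bseq_of => t; exact: payoff_rate_bound.
pose f i k := h i (s i + k).+1 x - (1 - b) * lenv x i k.
have XS i k : Xe i k x = f i k + b * Xe i k.+1 x.
  rewrite {1}/excess dsumS//; last first.
    by exists C => l; exact: (excess_term_bound b1 (h0 i) (hC i)).
  rewrite !addn0; congr (_ + _ * dsum _ _); apply/funext => l.
  by rewrite !addnS !addSn.
rewrite -(path_excess b0 b1 (jT x) XS); first last.
- exists C => i k.
  have := excess_term_bound b1 (h0 i) (hC i) (M i) (s i) 0 k x.
  by rewrite addn0 add0n.
- by exists D => i k; exact: Xe_bound.
congr dsum; apply/funext => t.
by rewrite /f -(allocE al).
Qed.

Lemma Ex_payoff_diff A : F s A ->
  Ex (fun x => \1_A x * payoff x) - Ex (fun x => \1_A x * payoff' x) =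
  - \sum_i dsum b (fun t => (1 - b) * Ex (fun x => \1_A x * idle i t x)).
Proof.
move=> FA; have bA : bmT \1_A by apply: (bm_weak (sF s)); exact: (bm_ind (sF s)).
have bP := bm_payoff; have bP' := bm_payoff'.
rewrite -ExB; [|bmt|bmt].
have bid i t : bmT (fun x => \1_A x * ((1 - b) * idle i t x)).
  by have ? := bm_idle i t; bmt.
have idK i t x : `|\1_A x * ((1 - b) * idle i t x)| <= (1 - b) * D.
  rewrite normrM -[leRHS]mul1r ler_pM//.
    by rewrite indicE; case: (_ \in _); rewrite ?normr1 ?normr0 ?ler01.
  by rewrite normrM ger0_norm ?(ltW ob0)// ler_wpM2l ?(ltW ob0).
have bd i : bmT (fun x => dsum b (fun t => \1_A x * ((1 - b) * idle i t x))).
  apply: bm_dsum => //; first exact: sub_sigmaT.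
    by move=> t; case: (bid i t).
  by exists ((1 - b) * D).
rewrite (_ : (fun x => _) = (fun x =>
    \sum_i (\1_A x * Xe i 0%N x - dsum b (fun t => \1_A x * ((1 - b) * idle i t x))))); last first.
  apply/funext => x; rewrite -mulrBr payoff_diff mulr_sumr; apply: eq_bigr => i _.
  have bI : bseq (fun t => (1 - b) * idle i t x).
    by apply: bseqZ; exists D => t; exact: idle_bound.
  by rewrite mulrBr -(dsumZ b0 b1 _ bI).
rewrite Ex_sum; last by move=> i; have ? := bm_Xe i 0; have ? := bd i; bmt.
rewrite -sumrN; apply: eq_bigr => i _.
have ? := bm_Xe i 0; have ? := bd i; rewrite ExB; [|bmt|bmt].
(* At offset 0 the envelope is the index itself, so the excess from the start has mean 0 on every
   event of [F s]. *)
rewrite (@excess_F_eq0 s i 0 A) ?addn0// sub0r; congr (- _).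
rewrite (Ex_dsum P b0 b1 (bid i) (idK i)); congr dsum; apply/funext => t.
rewrite -ExZ; last by have ? := bm_idle i t; bmt.
by congr Ex; apply/funext => x; rewrite mulrCA.
Qed.

(** On each piece the local time of project [i] is the constant [s i + f i], as the lemmas on the
    excess require. *)
Let Ex_idle A i t : F s A -> Ex (fun x => \1_A x * idle i t x) =
  \sum_j \sum_(f : {ffun 'I_d -> 'I_t.+1}) (i != j)%:R *
    Ex (fun x => \1_(A `&` move_event s T j f) x * Xe i (f i) x).
Proof.
move=> FA; rewrite idleE.
rewrite (Ex_alloc P sF al (phi := fun j r x => (i != j)%:R * Xe i (r i - s i) x)); first last.
- by move=> j f; exact: bm_idle_phi.
- exact: (proj2 (sF s)).
apply: eq_bigr => j _; apply: eq_bigr => f _.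
rewrite -ExZ; last first.
  apply: bmM; [exact: sub_sigmaT| |exact: bm_Xe].
  apply: bm_ind; first exact: sub_sigmaT.
  apply: measurableI; first exact: (proj2 (sF s)).
  by apply: (proj2 (sF (offset s f))); exact: (move_event_meas al).
by congr Ex; apply/funext => x; rewrite mulrCA /offset addKn.
Qed.

Let F_event A t j (f : {ffun 'I_d -> 'I_t.+1}) : F s A ->
  F (offset s f) (A `&` move_event s T j f).
Proof.
move=> FA; apply: (subsigI (sF _)); last exact: (move_event_meas al).
by apply: F1 FA => i; rewrite /offset leq_addr.
Qed.

Lemma idle_ge0 A i t : F s A -> 0 <= Ex (fun x => \1_A x * idle i t x).
Proof.
move=> FA; rewrite Ex_idle//; apply: sumr_ge0 => j _; apply: sumr_ge0 => f _.
by rewrite mulr_ge0//; apply: (@excess_F_ge0 (offset s f)) => //; exact: F_event.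
Qed.

Lemma Ex_payoff_le A : F s A ->
  Ex (fun x => \1_A x * payoff x) <= Ex (fun x => \1_A x * payoff' x).
Proof.
move=> FA; rewrite -subr_le0 Ex_payoff_diff// oppr_le0; apply: sumr_ge0 => i _.
apply: dsum_ge0 => // [|t]; last by rewrite mulr_ge0 ?(ltW ob0)// idle_ge0.
apply: bseqZ; exists D => t.
have bA : bmT \1_A by apply: (bm_weak (sF s)); exact: (bm_ind (sF s)).
have ? := bm_idle i t; apply: Ex_bound => [|x]; first bmt.
rewrite normrM -[leRHS]mul1r ler_pM// indicE; case: (_ \in _); by rewrite ?normr1 ?normr0 ?ler01.
Qed.

Lemma Ex_payoff_eq A : F s A ->
  (forall i t x, i != jT x t -> idx i (T t x i) x <= lenv x i (plays (jT x) t i)) ->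
  Ex (fun x => \1_A x * payoff x) = Ex (fun x => \1_A x * payoff' x).
Proof.
move=> FA rec; apply/eqP; rewrite -subr_eq0 Ex_payoff_diff// oppr_eq0 big1// => i _.
rewrite -[RHS](dsum0 b0 b1); congr dsum; apply/funext => t.
rewrite Ex_idle// big1 ?mulr0// => j _; rewrite big1// => f _.
have [->|ij] := eqVneq i j; first by rewrite mul0r.
rewrite mul1r; apply: (@excess_F_eq0 (offset s f)) => //; first exact: F_event.
move=> x [_ [Tj Tf]].
have jx : jT x t = j.
  by apply: (@madd_unit_inj _ (T t x)); rewrite -Tj; exact/esym/choice_ofP.
by have := rec i t x; rewrite jx plays_sub Tf /offset addKn; exact.
Qed.

Lemma payoff'_le x :
  payoff' x <= dsum b (fun t => (1 - b) * level i0 (lenv x) t).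
Proof.
apply: ler_dsum_partial => //.
- by apply: bseq_of => t; exact: payoff'_rate_bound.
- apply: bseqZ; exists D => t; have /andP[? ?] := lenv_bound x (served i0 (lenv x) t) (greedy i0 (lenv x) t (served i0 (lenv x) t)).
  by rewrite gtr0_norm.
- move=> n; rewrite -!mulr_sumr ler_wpM2l ?(ltW ob0)//.
  by apply: greedy_sum_max => i j k; exact: lenv_noninc.
Qed.

Lemma reward_payoff x : reward b (fun i n x => (h i n x)%:E) T x = (payoff x)%:E.
Proof.
rewrite /reward /payoff -eseries_dsum//; last first.
  by apply: bseq_of => t; exact: payoff_rate_bound.
apply: eq_eseriesr => t _; rewrite (bigD1 (jT x t))//= big1 ?adde0.
  by rewrite (choice_ofP al) /madd /munit eqxx addn1 subSnn mule1.
by move=> i ij; rewrite (choice_ofP al) /madd /munit (negbTE ij) addn0 subnn mule0.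
Qed.

Lemma reward_payoff' x : (forall i u, M i u x = (idx i u x)%:E) ->
  reward b (fun i n x => ((1 - b)%:E * \big[Order.min/+oo%E]_(s i <= u < n) M i u x)%E) T x
  = (payoff' x)%:E.
Proof.
move=> Mx; rewrite /reward /payoff' -eseries_dsum//; last first.
  by apply: bseq_of => t; exact: payoff'_rate_bound.
have minE i k : \big[Order.min/+oo%E]_(s i <= u < s i + k.+1) M i u x = (lenv x i k)%:E.
  elim: k => [|k IH]; first by rewrite addn1 big_nat1 Mx.
  rewrite addnS big_nat_recr/=; last by rewrite addnS leqW// leq_addr.
  by rewrite IH Mx EFin_min.
apply: eq_eseriesr => t _; rewrite (bigD1 (jT x t))//= [X in (_ + X)%E]big1 ?adde0.
  rewrite (choice_ofP al) /madd /munit eqxx addn1 subSnn mule1 (allocE al) -addnS minE.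
  by rewrite EFinM.
by move=> i ij; rewrite (choice_ofP al) /madd /munit (negbTE ij) addn0 subnn mule0.
Qed.

End OneAllocation.

Definition greedy_alloc t x : mindex d := fun i => (s i + greedy i0 (lenv x) t i)%N.

Let F_leader (c : mindex d) j : F (madd s c) [set x | leader (lenv x) c j].
Proof.
have ml i : meas_wrt (F (madd s c)) (fun x => lenv x i (c i)).
  by apply: meas_wrt_sub (@GF i (madd s c)) _; case: (bm_lenv i (c i)).
rewrite (_ : [set x | _] = [set x | forall i, lenv x i (c i) <= lenv x j (c j)] `&`
   [set x | forall i : 'I_d, (i < j)%N -> lenv x i (c i) < lenv x j (c j)]).
  apply: (subsigI (sF _)); first by apply: (subsig_forallT (sF _)) => i; exact: (meas_le (sF _)).
  apply: (subsig_forallT (sF _)) => i.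
  case: (ltnP i j) => ij.
    rewrite (_ : (fun x => _) = [set x | lenv x i (c i) < lenv x j (c j)]).
      exact: (meas_lt (sF _)).
    by apply/seteqP; split => x /=; [apply|].
  rewrite (_ : (fun x => _) = setT); first exact: (subsigT (sF _)).
  by apply/seteqP; split.
by apply/seteqP; split => x.
Qed.

Let F_greedy t (c : mindex d) : F (madd s c) [set x | greedy i0 (lenv x) t = c].
Proof.
elim: t c => [|t IH] c.
  exact: (subsig_cstP (sF (madd s c)) ((fun=> 0%N) = c :> mindex d)).
(* The position before a last play of [j]. Being there, and [j] leading there, are events of the
   smaller sigma-algebra at [pr j]. The condition [0 < c j] below guards against the truncated
   subtraction. *)
pose pr j : mindex d := fun i => (c i - (i == j))%N.
rewrite (_ : [set x | _] = [set x | exists j, ([set _ | (0 < c j)%N] `&`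
   ([set x | greedy i0 (lenv x) t = pr j] `&` [set x | leader (lenv x) (pr j) j])) x]).
  apply: (subsig_existsT (sF _)) => j; apply: (subsigI (sF _)).
    exact: (subsig_cstP (sF _)).
  have sub : F (madd s (pr j)) `<=` F (madd s c).
    by apply: F1 => i; rewrite /madd leq_add2l leq_subr.
  by apply: (subsigI (sF _)); apply: sub; [exact: IH|exact: F_leader].
apply/seteqP; split => x /=.
  move=> gc; exists (served i0 (lenv x) t).
  have cE i : c i = (greedy i0 (lenv x) t i + (i == served i0 (lenv x) t))%N by rewrite -gc.
  have prE : pr (served i0 (lenv x) t) = greedy i0 (lenv x) t.
    by apply/funext => i; rewrite /pr cE addnK.
  rewrite prE cE eqxx addn1; split=> //; split => //; exact: greedy_choiceP.
move=> [j [cj [gp lp]]]; apply/funext => i.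
have -> : greedy_choice i0 (lenv x) (greedy i0 (lenv x) t) = j.
  by apply/greedy_choice_eq; rewrite gp.
by rewrite gp /pr; case: eqVneq => [->|_]; rewrite ?subnK// subn0 addn0.
Qed.

Lemma greedy_allocS t x :
  greedy_alloc t.+1 x = madd (greedy_alloc t x) (munit (served i0 (lenv x) t) 1).
Proof.
apply/funext => i; rewrite /greedy_alloc /madd /munit greedyS addnA.
by case: eqP.
Qed.

Lemma greedy_alloc_allocation : allocation F s greedy_alloc.
Proof.
split=> [x|t x|j r t]; first by apply/funext => i; exact: addn0.
  by exists (served i0 (lenv x) t); exact: greedy_allocS.
have [sr|nsr] := pselect (mle s r); last first.
  rewrite (_ : [set x | _] = set0); first exact: (subsig0 (sF _)).
  by apply/seteqP; split => // x /= [_ e]; apply: nsr => i; rewrite -e leq_addr.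
pose c : mindex d := fun i => (r i - s i)%N.
have rc : r = madd s c by apply/funext => i; rewrite /madd subnKC.
rewrite rc (_ : [set x | _] =
    [set x | greedy i0 (lenv x) t = c] `&` [set x | leader (lenv x) c j]).
  by apply: (subsigI (sF _)).
have gE x : (greedy_alloc t x = madd s c) <-> (greedy i0 (lenv x) t = c).
  split=> [e|<- //]; apply/funext => i.
  by have := congr1 (fun f => f i) e; rewrite /greedy_alloc /madd => /addnI.
apply/seteqP; split => x /=; rewrite gE greedy_allocS => -[].
  by move=> /madd_unit_inj + gc => /greedy_choice_eq; rewrite gc.
by move=> gc lj; split=> //; congr (madd _ (munit _ _)); apply/greedy_choice_eq; rewrite gc.
Qed.

Local Notation ga := greedy_alloc_allocation.

Let choice_greedy x : choice_of ga x = served i0 (lenv x).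
Proof.
apply/funext => t; apply: (@madd_unit_inj _ (greedy_alloc t x)).
by rewrite -choice_ofP greedy_allocS.
Qed.

Definition opt x := dsum b (fun t => (1 - b) * level i0 (lenv x) t).

Let level_bound x t : 0 < level i0 (lenv x) t <= D.
Proof. exact: lenv_bound. Qed.

Let level_bseq x : bseq (level i0 (lenv x)).
Proof. by exists D => t; have /andP[? ?] := level_bound x t; rewrite gtr0_norm. Qed.

Lemma payoff'_greedy x : payoff' ga x = opt x.
Proof.
congr dsum; apply/funext => t; rewrite choice_greedy; congr (_ * _).
by rewrite /level (greedyE i0 (lenv x)).
Qed.

Lemma Ex_payoff_greedy A : F s A ->
  Ex (fun x => \1_A x * payoff ga x) = Ex (fun x => \1_A x * opt x).
Proof.
move=> FA; rewrite (Ex_payoff_eq (al := ga) FA).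
  by congr Ex; apply/funext => x; rewrite payoff'_greedy.
move=> i t x; rewrite choice_greedy -greedyE => ij.
by have := idle_record ij; exact.
Qed.

Let bm_opt : bmT opt.
Proof.
rewrite (_ : opt = payoff' ga); first exact: bm_payoff'.
by apply/funext => x; rewrite payoff'_greedy.
Qed.

Lemma ae_indices : {ae P, forall x,
  (forall i u, M i u x = (idx i u x)%:E) /\
  (forall i u (m : R), 0 <= m -> (V i u m x = m <-> idx i u x <= m))}.
Proof.
have H1 : {ae P, forall x, forall i u, M i u x = (idx i u x)%:E}.
  apply: filter_forall => i; apply: ae_foralln => u.
  exact: (ae_index b0 b1 (sG i) (GS (i := i)) (h0 i) (hC i) (mh i) (essV i) (contV i) (essM i)).
have H2 : {ae P, forall x, forall i u (m : R), 0 <= m -> (V i u m x = m <-> idx i u x <= m)}.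
  apply: filter_forall => i; apply: ae_foralln => u.
  exact: (V_eq_iff b0 b1 (sG i) (GS (i := i)) (h0 i) (hC i) (mh i) (essV i) (contV i) (essM i)).
by apply: filterS2 H1 H2.
Qed.

(** * Pathwise identities off the exceptional null set *)

Section GoodPoint.
Variable x : Omega.
Hypothesis Vx : forall i u (m : R), 0 <= m -> (V i u m x = m <-> idx i u x <= m).

Lemma sigma_hit i m : 0 <= m -> sigma_ V i (s i) m x = ((s i)%:R%:E + hit (lenv x i) m)%E.
Proof.
move=> m0; rewrite /sigma_.
have lek th : (s i <= th)%N -> V i th m x = m -> lenv x i (th - s i) <= m.
  move=> sth /(Vx i th m0); apply: le_trans.
  by rewrite -{2}(subnKC sth); exact: (env_le (idx i ^~ x) (s i) (leqnn _)).
have [[k [ek Hk]]|H] := hit_cases (lenv x i) m.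
  rewrite (hit_eq ek Hk) -EFinD -natrD; apply/eqP; rewrite eq_le; apply/andP; split.
    apply: ereal_inf_lbound; exists (s i + k)%N => //=; split; first exact: leq_addr.
    (* When the envelope first falls to [m], the entry just added to the minimum is responsible, so
       the index itself is at most [m] at that time. *)
    apply/Vx => //; case: k ek Hk => [|k] ek Hk; first by rewrite addn0.
    move: ek; rewrite /lenv/= ge_min => /orP[|//].
    by rewrite leNgt (Hk k).
  apply: le_ereal_inf_tmp => _ [th [sth Vth] <-]; rewrite lee_fin ler_nat.
  rewrite -leq_subRL//; rewrite leqNgt; apply/negP => /Hk.
  by rewrite ltNge lek.
rewrite (hit_oo H) addey// (_ : [set th | _] = set0) ?image_set0 ?ereal_inf0//.
by apply/seteqP; split => // th [/= sth /(lek _ sth)]; rewrite leNgt H.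
Qed.

Lemma tau_hit m : 0 <= m -> tau_ V s m x = hit (level i0 (lenv x)) m.
Proof.
move=> m0; rewrite -(sum_hit i0 (@lenv_noninc x)).
apply: eq_bigr => i _; rewrite sigma_hit//.
by rewrite addeAC -EFinB subrr add0e.
Qed.

Lemma Nt_level t : Nt V s t x = (level i0 (lenv x) t)%:E.
Proof.
rewrite -(ereal_inf_level (@lenv_noninc x)); last by move=> k; case/andP: (level_bound x k).
congr (ereal_inf (_ @` _)); apply/seteqP; split => m /= [m0];
  by rewrite tau_hit// (sum_hit i0 (@lenv_noninc x)).
Qed.

(** Layer-cake formula: [epow_hit] expands the integrand over [t], and the indicator of [m < N t],
    integrated over [m >= 0], gives back [N t]. *)
Lemma integral_tau :
  (\int[lebesgue_measure]_(m in [set m : R | (0 <= m)%R]) (1%E - epow b (tau_ V s m x)))%E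
  = (opt x)%:E.
Proof.
have mD : measurable [set m : R | 0 <= m].
  rewrite (_ : [set m : R | 0 <= m] = `[0, +oo[%classic); first exact: measurable_itv.
  by apply/seteqP; split => m; rewrite /= in_itv/= andbT.
pose N := level i0 (lenv x).
pose f t (m : R) : \bar R := ((1 - b) * b ^+ t * \1_(`]-oo, N t[%classic) m)%:E.
transitivity (\int[lebesgue_measure]_(m in [set m : R | (0 <= m)%R])
    (\sum_(0 <= t <oo) f t m))%E.
  apply: eq_integral => m /set_mem m0; rewrite tau_hit// epow_hit//; last first.
    by move=> j k; apply: level_noninc => i j' k'; exact: lenv_noninc.
  apply: eq_eseriesr => t _; rewrite /f indicE; congr (_ * _)%:E; congr (_ %:R).
  congr nat_of_bool; apply/idP/idP => [mN|/set_mem]; last by rewrite /= in_itv.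
  by apply/mem_set; rewrite /= in_itv.
have c0 t : 0 <= (1 - b) * b ^+ t by rewrite mulr_ge0 ?exprn_ge0 ?(ltW ob0) ?(ltW b0).
rewrite integral_nneseries//; last 2 first.
- move=> t; apply/measurable_EFinP; apply: measurable_funM; first exact: measurable_cst.
  exact: measurable_indic.
- by move=> t m _; rewrite lee_fin mulr_ge0// indicE.
rewrite /opt -eseries_dsum//; last by apply: bseqZ; exact: level_bseq.
apply: eq_eseriesr => t _; rewrite /f.
under eq_integral do rewrite EFinM.
rewrite ge0_integralZl//; last 2 first.
- apply: measurable_funTS; apply: measurableT_comp; first exact: EFin_measurable.
  exact: measurable_indic.
- by rewrite lee_fin.
rewrite integral_indic//.
rewrite (_ : _ `&` _ = `[0, N t[%classic); last first.
  by apply/seteqP; split => m; rewrite /= !in_itv/=; [move=> [-> ->]|move=> /andP[-> ->]].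
have /andP[N0 _] := level_bound x t.
have muE : lebesgue_measure (`[0%R, N t[%classic : set R) = (N t)%:E.
  by rewrite lebesgue_measure_itv/= lte_fin N0 oppr0 adde0.
transitivity (((1 - b) * b ^+ t)%:E * (N t)%:E)%E; first by congr (_ * _)%E; exact: muE.
by rewrite -EFinM mulrA [b ^+ t * _]mulrC.
Qed.

Lemma sum_Nt : (\sum_(t <oo) ((b ^+ t)%:E * Nt V s t x) = ((1 - b)^-1 * opt x)%:E)%E.
Proof.
rewrite /opt dsumZ//.
rewrite mulKf ?gt_eqF// -eseries_dsum//.
by apply: eq_eseriesr => t _; rewrite Nt_level EFinM.
Qed.

Lemma Tstar_val_alloc t i : ((greedy_alloc t x i)%:R)%:E = Tstar_val V s t x i.
Proof.
have /andP[l0 _] := level_bound x t.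
exact/esym/(Tstar_val_greedy (@lenv_noninc x) sigma_hit (Nt_level t) l0).
Qed.

End GoodPoint.

Hypothesis Pc : measure_is_complete P.

(** Completeness enters here: quantities built from [V] and [M] are known to agree with measurable
    functions only almost surely. *)
Let ae_measurable (X : Omega -> \bar R) f : bmT f ->
  {ae P, forall x, X x = (f x)%:E} -> measurable_fun setT X.
Proof.
move=> bf Xf; apply: (ae_measurable_fun Pc (f := EFin \o f)).
  by apply: filterS Xf => x /= -> _.
by apply/measurable_EFinP; exact: bm_meas.
Qed.

Variables Phi Phi' : Omega -> \bar R.
Hypothesis essPhi : ess_sup_of P (F s)
  [set Y | exists T, allocation F s T /\
             cond_exp P (F s) (reward b (fun i n x => (h i n x)%:E) T) Y] Phi.
Hypothesis essPhi' : ess_sup_of P (F s)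
  [set Y | exists T, allocation F s T /\
     cond_exp P (F s) (reward b (fun i n x =>
        ((1 - b)%:E * \big[Order.min/+oo%E]_(s i <= u < n) M i u x)%E) T) Y] Phi'.

Let ess_sup_max (fam : set (Omega -> \bar R)) (Z : Omega -> \bar R) y : bm (F s) y ->
  ess_sup_of P (F s) fam Z ->
  (forall Y, fam Y -> {ae P, forall x, (Y x <= (y x)%:E)%E}) ->
  fam (fun x => (y x)%:E) -> {ae P, forall x, Z x = (y x)%:E}.
Proof.
move=> by_ [_ ubZ minZ] famy yfam.
have byT := bm_weak (sF s) by_.
have my : measurable_fun setT (fun x => (y x)%:E).
  by apply/measurable_EFinP; exact: bm_meas.
apply: filterS2 (minZ _ my famy) (ubZ _ yfam) => x le1 le2.
by apply/eqP; rewrite eq_le le1.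
Qed.

(** One real version serves both values: [y] represents [opt] given [F s]. The greedy allocation
    attains it for either kind of reward, and no allocation exceeds it on any event of [F s]. *)
Lemma value_version : exists y, [/\ bm (F s) y,
  forall A, F s A -> Ex (fun x => \1_A x * y x) = Ex (fun x => \1_A x * opt x),
  {ae P, forall x, Phi x = (y x)%:E} & {ae P, forall x, Phi' x = (y x)%:E}].
Proof.
have bA A : F s A -> bmT \1_A.
  by move=> FA; apply: (bm_weak (sF s)); exact: (bm_ind (sF s)).
have rE T (al : allocation F s T) :
    {ae P, forall x, reward b (fun i n x => (h i n x)%:E) T x = (payoff al x)%:E}.
  by apply: aeW => x; exact: reward_payoff.
have rE' T (al : allocation F s T) : {ae P, forall x, reward b (fun i n x =>
     ((1 - b)%:E * \big[Order.min/+oo%E]_(s i <= u < n) M i u x)%E) T x = (payoff' al x)%:E}.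
  by apply: filterS ae_indices => x [Mx _]; exact: reward_payoff'.
have [y [by_ _ yE cy _]] := cond_exp_real (sF s) (ae_measurable (bm_payoff ga) (rE _ ga))
  (bm_payoff ga) (payoff_bound ga) (rE _ ga).
have yopt A : F s A -> Ex (fun x => \1_A x * y x) = Ex (fun x => \1_A x * opt x).
  by move=> FA; rewrite yE// Ex_payoff_greedy.
have bopt := bm_opt.
have le_opt T (al : allocation F s T) A : F s A ->
    Ex (fun x => \1_A x * payoff' al x) <= Ex (fun x => \1_A x * opt x).
  move=> FA; have ? := bA _ FA; have ? := bm_payoff' al.
  apply: ler_Ex => [||x]; [bmt|bmt|].
  by rewrite ler_wpM2l ?indicE//; exact: payoff'_le.
exists y; split => //.
- apply: ess_sup_max essPhi _ _ => //; last by exists greedy_alloc; split => //; exact: ga.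
  move=> Y [T [al cY]].
  have [z [bz _ zE _ zU]] := cond_exp_real (sF s) (ae_measurable (bm_payoff al) (rE _ al))
    (bm_payoff al) (payoff_bound al) (rE _ al).
  have zy : {ae P, forall x, z x <= y x}.
    apply: (ae_le_of_Ex (sF s)) => // A FA; rewrite zE// yopt//.
    by apply: le_trans (le_opt _ al _ FA); exact: Ex_payoff_le.
  by apply: filterS2 (zU _ cY) zy => x ->; rewrite lee_fin.
- apply: ess_sup_max essPhi' _ _ => //.
    move=> Y [T [al cY]].
    have [z [bz _ zE _ zU]] := cond_exp_real (sF s) (ae_measurable (bm_payoff' al) (rE' _ al))
      (bm_payoff' al) (payoff'_bound al) (rE' _ al).
    have zy : {ae P, forall x, z x <= y x}.
      by apply: (ae_le_of_Ex (sF s)) => // A FA; rewrite zE// yopt// le_opt.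
    by apply: filterS2 (zU _ cY) zy => x ->; rewrite lee_fin.
  exists greedy_alloc; split; first exact: ga.
  split; first by case: cy.
  move=> A FA; have mA := proj2 (sF s) _ FA.
  rewrite (integral_ae_bm (ae_measurable (bm_payoff' ga) (rE' _ ga)) (bm_payoff' ga) (rE' _ ga) mA).
  rewrite integral_bm_in//; last exact: bm_weak (sF s) by_.
  rewrite yopt//; congr ((Ex _)%:E); apply/funext => x.
  by rewrite payoff'_greedy.
Qed.

(** The common source of the integral formula, with [f] equal to [opt], and of the optimality of the
    greedy allocation, with [f] its payoff. *)
Lemma value_cond_exp (X : Omega -> \bar R) f : bmT f ->
  {ae P, forall x, X x = (f x)%:E} ->
  (forall A, F s A -> Ex (fun x => \1_A x * f x) = Ex (fun x => \1_A x * opt x)) ->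
  cond_exp P (F s) X Phi.
Proof.
move=> bf Xf fopt; have [y [by_ yopt Phiy _]] := value_version.
have [mPhi _ _] := essPhi; split => // A FA; have mA := proj2 (sF s) _ FA.
have byT := bm_weak (sF s) by_.
rewrite (integral_ae_bm (ae_measurable bf Xf) bf Xf mA).
rewrite (integral_ae_bm (meas_wrt_measurable (sF s) mPhi) byT Phiy mA).
by rewrite yopt// fopt.
Qed.

Lemma value_eq : {ae P, forall x, Phi x = Phi' x}.
Proof.
have [y [_ _ Py Py']] := value_version.
by apply: filterS2 Py Py' => x -> ->.
Qed.

Lemma value_integral : cond_exp P (F s)
  (fun x => (\int[lebesgue_measure]_(m in [set m : R | (0 <= m)%R])
               (1%E - epow b (tau_ V s m x))%E)%E) Phi.
Proof.
apply: (value_cond_exp bm_opt) => //.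
by apply: filterS ae_indices => x [_ Vx]; exact: integral_tau.
Qed.

Lemma value_sum_Nt : exists Y,
  cond_exp P (F s) (fun x => (\sum_(t <oo) ((b ^+ t)%:E * Nt V s t x))%E) Y /\
  {ae P, forall x, Phi x = ((1 - b)%:E * Y x)%E}.
Proof.
have [y [by_ yopt Phiy _]] := value_version.
have bo : bmT (fun x => (1 - b)^-1 * opt x) by have ? := bm_opt; bmt.
have XE : {ae P, forall x, (\sum_(t <oo) ((b ^+ t)%:E * Nt V s t x))%E
    = ((1 - b)^-1 * opt x)%:E}.
  by apply: filterS ae_indices => x [_ Vx]; exact: sum_Nt.
exists (fun x => ((1 - b)^-1 * y x)%:E); split; last first.
  by apply: filterS Phiy => x ->; rewrite -EFinM mulVKf// gt_eqF.
have bz : bm (F s) (fun x => (1 - b)^-1 * y x) by have ? := sF s; bmt.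
split.
  apply/meas_wrtE => //; apply/measurable_EFinP; apply/meas_wrtE => //.
  by case: bz.
move=> A FA; have mA := proj2 (sF s) _ FA.
have bA : bmT \1_A by apply: (bm_weak (sF s)); exact: (bm_ind (sF s)).
have byT := bm_weak (sF s) by_; have bopt := bm_opt.
rewrite (integral_ae_bm (ae_measurable bo XE) bo XE mA).
rewrite integral_bm_in//; last exact: (bm_weak (sF s) bz).
congr (_ %:E).
transitivity ((1 - b)^-1 * Ex (fun x => \1_A x * y x)).
  by rewrite -ExZ; [congr Ex; apply/funext => x; rewrite mulrCA|bmt].
rewrite yopt// -ExZ; last by bmt.
by congr Ex; apply/funext => x; rewrite mulrCA.
Qed.

Lemma greedy_optimal : exists Tstar,
  [/\ allocation F s Tstar,
      {ae P, forall x, forall t, (0 < t)%N -> forall i,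
         ((Tstar t x i)%:R)%:E = Tstar_val V s t x i},
      cond_exp P (F s) (reward b (fun i n x => (h i n x)%:E) Tstar) Phi &
      forall T Y, allocation F s T ->
        cond_exp P (F s) (reward b (fun i n x => (h i n x)%:E) T) Y ->
        {ae P, forall x, (Y x <= Phi x)%E}].
Proof.
exists greedy_alloc; split.
- exact: ga.
- by apply: filterS ae_indices => x [_ Vx] t _ i; exact: Tstar_val_alloc.
- apply: (value_cond_exp (bm_payoff ga)); last exact: Ex_payoff_greedy.
  by apply: aeW => x; exact: reward_payoff.
- by move=> T Y al cY; have [_ ub _] := essPhi; apply: ub; exists T.
Qed.

End Bandit.

Theorem theorem8p2
  (R : realType) (dO : measure_display) (Omega : measurableType dO)
  (P : probability Omega R)
  (d : nat) (beta : R)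
  (F : mindex d -> set (set Omega))
  (h : 'I_d -> nat -> Omega -> R)
  (V : 'I_d -> nat -> R -> Omega -> R)
  (M : 'I_d -> nat -> Omega -> \bar R)
  (s : mindex d)
  (Phi Phi' : Omega -> \bar R) :
  (* complete probability space, d >= 1, beta in (0,1) *)
  measure_is_complete P ->
  (0 < d)%N ->
  0 < beta < 1 ->
  (* the filtration: sub-sigma-algebras, (F1), (F2), (F4) *)
  (forall r, sub_sigma (F r)) ->
  (forall r1 r2, mle r1 r2 -> F r1 `<=` F r2) ->
  (forall N, P.-negligible N -> F (@mzero_idx d) N) ->
  (forall r1 r2, cond_indep P (F r1) (F r2) (F (mmin r1 r2))) ->
  (* rewards: positive, bounded, F_i-predictable (defined for t >= 1) *)
  (forall i t x, (0 < t)%N -> 0 < h i t x) ->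
  (exists C : R, forall i t x, (0 < t)%N -> h i t x <= C) ->
  (forall i t, (0 < t)%N -> meas_wrt (Fi F i t.-1) (h i t)) ->
  (* V_i(t;m): versions of the essential supremum, for every m >= 0 ... *)
  (forall i t m, 0 <= m ->
     ess_sup_of P (Fi F i t)
       [set Y | exists tau, stopping_from F i t tau /\
                  cond_exp P (Fi F i t) (gain beta (h i) t m tau) Y]
       (fun x => (V i t m x)%:E)) ->
  (* ... chosen a.s. continuous in m *)
  (forall i t, {ae P, forall x,
     {within [set m : R | 0 <= m], continuous (fun m => V i t m x)}}) ->
  (* Gittins indices M_i(t) *)
  (forall i t,
     ess_sup_of P (Fi F i t)
       [set Y | exists X : Omega -> R,
          [/\ Y = (fun x => (X x)%:E), meas_wrt (Fi F i t) X,
              (forall x, 0 < X x) &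
              {ae P, forall x, X x < V i t (X x) x}]]
       (M i t)) ->
  (* the value Phi(s) *)
  ess_sup_of P (F s)
    [set Y | exists T, allocation F s T /\
               cond_exp P (F s) (reward beta (fun i n x => (h i n x)%:E) T) Y]
    Phi ->
  (* the value Phi'(s) for the rewards h'_i(t+1) = (1-beta) min_{s_i<=u<=t} M_i(u) *)
  ess_sup_of P (F s)
    [set Y | exists T, allocation F s T /\
               cond_exp P (F s)
                 (reward beta (fun i n x =>
                    ((1 - beta)%:E * \big[Order.min/+oo%E]_(s i <= u < n) M i u x)%E) T)
                 Y]
    Phi' ->
  [/\ {ae P, forall x, Phi x = Phi' x},
      cond_exp P (F s)
        (fun x => (\int[lebesgue_measure]_(m in [set m : R | (0 <= m)%R])
                     (1%E - epow beta (tau_ V s m x))%E)%E)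
        Phi,
      (exists Y, cond_exp P (F s)
                   (fun x => (\sum_(t <oo) ((beta ^+ t)%:E * Nt V s t x))%E) Y
                 /\ {ae P, forall x, Phi x = ((1 - beta)%:E * Y x)%E}) &
      exists Tstar,
        [/\ allocation F s Tstar,
            {ae P, forall x, forall t, (0 < t)%N -> forall i,
               ((Tstar t x i)%:R)%:E = Tstar_val V s t x i},
            cond_exp P (F s) (reward beta (fun i n x => (h i n x)%:E) Tstar) Phi &
            forall T Y, allocation F s T ->
              cond_exp P (F s) (reward beta (fun i n x => (h i n x)%:E) T) Y ->
              {ae P, forall x, (Y x <= Phi x)%E}]].
Proof.
move=> Pc d_gt0 /andP[b0 b1] sF F1 _ F4 h0 [C hC] mh essV contV essM essPhi essPhi'.
have h0S i t x : 0 < h i t.+1 x by exact: h0.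
have hCS i t x : h i t.+1 x <= C by exact: hC.
have mhS i t : meas_wrt (Fi F i t) (h i t.+1) by exact: (mh i t.+1).
(* Some project, available because [d] is positive; it is the default of the maximum in
   [greedy_choice]. *)
pose i0 := Ordinal d_gt0.
split.
- exact: (value_eq i0 b0 b1 sF F1 F4 h0S hCS mhS essV contV essM Pc essPhi essPhi').
- exact: (value_integral i0 b0 b1 sF F1 F4 h0S hCS mhS essV contV essM Pc essPhi essPhi').
- exact: (value_sum_Nt i0 b0 b1 sF F1 F4 h0S hCS mhS essV contV essM Pc essPhi essPhi').
- exact: (greedy_optimal i0 b0 b1 sF F1 F4 h0S hCS mhS essV contV essM Pc essPhi essPhi').
Qed.
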